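(* Consider the second-order equation $$\phi''-2\phi^3+c\phi=b$$ for a real-valued function $\phi$ of one real variable $x$, with real constants $b,c$; its solutions satisfy the first-order invariant $(\phi')^2=\phi^4-c\phi^2+2b\phi+2d$ for a real constant $d$. Bounded periodic (nonconstant) solutions of the second-order equation exist if and only if $(b,c)\in\Omega$, where $$\Omega=\{(b,c):\ b\in(-b_c,b_c),\ c>0\},\qquad b_c:=\frac{\sqrt{2c^3}}{\sqrt{27}}.$$ These solutions for $b\in(0,b_c)$ and $c>0$ can be uniquely parameterized by real parameters $(\zeta_1,\zeta_2,\zeta_3)$ satisfying $0<\zeta_3<\zeta_2<\zeta_1$ with $$b=4\zeta_1\zeta_2\zeta_3,\quad c=2(\zeta_1^2+\zeta_2^2+\zeta_3^2),\quad d=\tfrac12(\zeta_1^4+\zeta_2^4+\zeta_3^4)-\zeta_1^2\zeta_2^2-\zeta_1^2\zeta_3^2-\zeta_2^2\zeta_3^2.$$ If $\zeta_1\neq\zeta_2+\zeta_3$, the periodic profile $\phi$ is given explicitly by $$\phi(x)=(\zeta_1-\zeta_2-\zeta_3)\frac{H(\nu x-\beta)H(\nu x+\beta)}{\Theta(\nu x-\alpha)\Theta(\nu x+\alpha)}\frac{\Theta^2(\alpha)}{H^2(\beta)},$$ where $\nu>0$, $k\in(0,1)$, $\alpha\in(0,K)$ and $\beta\in(0,K)\cup i(0,K')$ are uniquely expressed by $$\nu=\sqrt{\zeta_1^2-\zeta_3^2},\qquad k=\sqrt{\frac{\zeta_1^2-\zeta_2^2}{\zeta_1^2-\zeta_3^2}},$$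 $$\mathrm{sn}(\alpha)=\sqrt{\frac{\zeta_1-\zeta_3}{\zeta_1+\zeta_2}},\qquad \mathrm{sn}(\beta)=\sqrt{\frac{(\zeta_1+\zeta_3)(\zeta_1-\zeta_2-\zeta_3)}{(\zeta_1-\zeta_2)(\zeta_1+\zeta_2+\zeta_3)}},$$ such that $\beta$ is real for $\zeta_1>\zeta_2+\zeta_3$ and purely imaginary for $\zeta_1<\zeta_2+\zeta_3$. If $\zeta_1=\zeta_2+\zeta_3$, the periodic profile is given by $$\phi(x)=\frac{2(\zeta_2+\zeta_3)\zeta_3\,\mathrm{sn}^2(\nu x)\,\Theta^2(\nu x)\,\Theta^2(\alpha)}{(\zeta_2+2\zeta_3)\,\Theta(\nu x-\alpha)\Theta(\nu x+\alpha)\,\Theta^2(0)},$$ with the same $\nu>0$, $k\in(0,1)$ and $\alpha\in(0,K)$.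
   Context: For an elliptic modulus $k\in(0,1)$, $K=K(k)$ is the complete elliptic integral of the first kind, $k'=\sqrt{1-k^2}$, $K'=K(k')$, and $q=e^{-\pi K'/K}$. Jacobi's theta functions are $\theta_1(y)=2\sum_{n\ge1}(-1)^{n-1}q^{(n-1/2)^2}\sin((2n-1)y)$ and $\theta_4(y)=1+2\sum_{n\ge1}(-1)^nq^{n^2}\cos(2ny)$, and $H(x)=\theta_1\!\left(\frac{\pi x}{2K}\right)$, $\Theta(x)=\theta_4\!\left(\frac{\pi x}{2K}\right)$. $\mathrm{sn},\mathrm{cn},\mathrm{dn}$ denote Jacobi elliptic functions with modulus $k$ (the modulus $k$ defined in the statement). *)

(* Defs.v *)
From Stdlib Require Import Reals.
From Coquelicot Require Import Coquelicot.

Open Scope R_scope.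

Definition ellK (k : R) : R :=
  RInt (fun t => / sqrt (1 - k ^ 2 * sin t ^ 2)) 0 (PI / 2).

Definition kprime (k : R) : R := sqrt (1 - k ^ 2).

Definition nome (k : R) : R := exp (- PI * ellK (kprime k) / ellK k).

Definition Csin (z : C) : C :=
  (sin (fst z) * cosh (snd z), cos (fst z) * sinh (snd z)).
Definition Ccos (z : C) : C :=
  (cos (fst z) * cosh (snd z), - (sin (fst z) * sinh (snd z))).

Definition Cscal (r : R) (z : C) : C := (r * fst z, r * snd z).

Definition CSeries (a : nat -> C) : C :=
  (Series (fun n => fst (a n)), Series (fun n => snd (a n))).

(** theta_1(y) = 2 sum_{n>=1} (-1)^(n-1) q^((n-1/2)^2) sin((2n-1) y),
    the summation index is shifted: n = S m. *)
Definition theta1 (q : R) (y : C) : C :=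
  Cscal 2 (CSeries (fun m =>
    Cscal ((-1) ^ m * Rpower q ((INR (S m) - 1 / 2) ^ 2))
          (Csin (RtoC (2 * INR (S m) - 1) * y)%C))).

Definition theta4 (q : R) (y : C) : C :=
  (RtoC 1 + Cscal 2 (CSeries (fun m =>
    Cscal ((-1) ^ (S m) * q ^ (S m * S m)) (Ccos (RtoC (2 * INR (S m)) * y)%C))))%C.

Definition theta2_0 (q : R) : R :=
  2 * Series (fun m => Rpower q ((INR (S m) - 1 / 2) ^ 2)).
Definition theta3_0 (q : R) : R :=
  1 + 2 * Series (fun m => q ^ (S m * S m)).

Definition Hth (k : R) (x : C) : C :=
  theta1 (nome k) (RtoC (PI / (2 * ellK k)) * x)%C.
Definition Theta (k : R) (x : C) : C :=
  theta4 (nome k) (RtoC (PI / (2 * ellK k)) * x)%C.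

(** Jacobi sn with modulus k on the complex plane (DLMF 22.2.4):
    sn(z) = theta_3(0)/theta_2(0) * theta_1(pi z/(2K)) / theta_4(pi z/(2K)). *)
Definition sn (k : R) (z : C) : C :=
  (RtoC (theta3_0 (nome k) / theta2_0 (nome k)) * Hth k z / Theta k z)%C.

Definition ode_solution (b c : R) (phi : R -> R) : Prop :=
  forall x, ex_derive phi x /\ ex_derive (Derive phi) x /\
    Derive_n phi 2 x - 2 * phi x ^ 3 + c * phi x = b.

Definition invariant (b c d : R) (phi : R -> R) : Prop :=
  forall x, (Derive phi x) ^ 2 = phi x ^ 4 - c * phi x ^ 2 + 2 * b * phi x + 2 * d.

Definition periodic_fun (phi : R -> R) : Prop :=
  exists T, 0 < T /\ forall x, phi (x + T) = phi x.

Definition bounded_fun (phi : R -> R) : Prop :=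
  exists M, forall x, Rabs (phi x) <= M.

Definition nonconstant_fun (phi : R -> R) : Prop :=
  exists x y, phi x <> phi y.

Definition b_crit (c : R) : R := sqrt (2 * c ^ 3) / sqrt 27.

Definition b_of (z1 z2 z3 : R) : R := 4 * z1 * z2 * z3.
Definition c_of (z1 z2 z3 : R) : R := 2 * (z1 ^ 2 + z2 ^ 2 + z3 ^ 2).
Definition d_of (z1 z2 z3 : R) : R :=
  1 / 2 * (z1 ^ 4 + z2 ^ 4 + z3 ^ 4)
  - z1 ^ 2 * z2 ^ 2 - z1 ^ 2 * z3 ^ 2 - z2 ^ 2 * z3 ^ 2.

Definition nu_of (z1 z2 z3 : R) : R := sqrt (z1 ^ 2 - z3 ^ 2).
Definition k_of (z1 z2 z3 : R) : R := sqrt ((z1 ^ 2 - z2 ^ 2) / (z1 ^ 2 - z3 ^ 2)).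

Definition sa2 (z1 z2 z3 : R) : R := (z1 - z3) / (z1 + z2).
Definition sb2 (z1 z2 z3 : R) : R :=
  (z1 + z3) * (z1 - z2 - z3) / ((z1 - z2) * (z1 + z2 + z3)).

Definition alpha_ok (z1 z2 z3 alpha : R) : Prop :=
  let k := k_of z1 z2 z3 in
  0 < alpha < ellK k /\ sn k (RtoC alpha) = RtoC (sqrt (sa2 z1 z2 z3)).

(** beta in (0,K) (real case, zeta1 > zeta2+zeta3) or beta in i(0,K')
    (imaginary case, zeta1 < zeta2+zeta3) with sn(beta) = sqrt(sb2),
    the square root of a negative number being the principal one, i sqrt(-sb2). *)
Definition beta_ok (z1 z2 z3 : R) (beta : C) : Prop :=
  let k := k_of z1 z2 z3 in
  (z2 + z3 < z1 -> exists t, beta = (t, 0) /\ 0 < t < ellK k /\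
       sn k beta = RtoC (sqrt (sb2 z1 z2 z3))) /\
  (z1 < z2 + z3 -> exists t, beta = (0, t) /\ 0 < t < ellK (kprime k) /\
       sn k beta = (0, sqrt (- sb2 z1 z2 z3))).

Definition profile1 (z1 z2 z3 alpha : R) (beta : C) (x : R) : C :=
  let k := k_of z1 z2 z3 in
  let u := RtoC (nu_of z1 z2 z3 * x) in
  (RtoC (z1 - z2 - z3)
   * (Hth k (u - beta) * Hth k (u + beta))
   / (Theta k (u - RtoC alpha) * Theta k (u + RtoC alpha))
   * (Theta k (RtoC alpha) * Theta k (RtoC alpha))
   / (Hth k beta * Hth k beta))%C.

Definition profile2 (z1 z2 z3 alpha : R) (x : R) : C :=
  let k := k_of z1 z2 z3 in
  let u := RtoC (nu_of z1 z2 z3 * x) in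
  (RtoC (2 * (z2 + z3) * z3) * (sn k u * sn k u) * (Theta k u * Theta k u)
   * (Theta k (RtoC alpha) * Theta k (RtoC alpha))
   / (RtoC (z2 + 2 * z3) * (Theta k (u - RtoC alpha) * Theta k (u + RtoC alpha))
      * (Theta k (RtoC 0) * Theta k (RtoC 0))))%C.

(* Main.v *)
Require Import Defs.
From Stdlib Require Import Reals Ranalysis5 Lra Lia ZArith.
From Coquelicot Require Import Coquelicot.
Open Scope R_scope.

(** The profile is a Moebius function of sn^2, so everything rests on the theta
    quotients in [sn] being the Jacobi functions of modulus k when q = exp (- PI K'/K).

    Re-indexing the product of two theta series by the sum and the difference of
    the summation indices (Schroeter) makes all addition formulas algebraic
    identities. They give sn' = lam cn dn along the real and the imaginary axis,
    for the modulus theta_2^2 / theta_3^2 and a constant lam. Landen's doubling formulas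
    theta_3 theta_4 (z|q) = theta_4 (2z|q^2) theta_4 (0|q^2) and
    theta_1 theta_2 (z|q) = theta_1 (2z|q^2) theta_4 (0|q^2), iterated, push a zero
    to nome q^(2^n) -> 0, where there is none; this locates the zeros. Integrating
    sn' from 0 to the first zero of cn (real axis) and of theta_4 (imaginary axis)
    gives K = lam PI/2 and K' = lam (- ln q)/2, so the modulus has nome q, and the nome
    determines the modulus.

    A bounded periodic solution moves between two simple roots of the quartic
    u^4 - c u^2 + 2 b u + 2 d; the zeta_i are half-sums of pairs of its roots.
    Uniqueness for the Cauchy problem identifies the solution with the explicit one. *)

(** The nome is defined through K(k) and K(k'), which are integrals, while a theta series knows only
    its nome. The link is built from the theta side: each L = - ln q > 0 has an explicit modulus
    [kap L], whose two integrals can be computed; a given k is then recognised as one of these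
    moduli, since K increases and K' decreases with the modulus and the nome is therefore strictly
    monotone.

    Algebra is done for complex arguments, analysis only along the two axes, where each theta
    function is real or purely imaginary and real calculus applies. K and K' come from one inversion
    argument: sn/cn on the real axis and sn/i on the imaginary axis both satisfy the equation of
    tan(amplitude), with complementary moduli, and both blow up at the end of their interval. To
    know these ends is to know the zeros of theta_1, theta_2 and theta_4; they are visible only for
    small nome, where the leading term outweighs all others, and this is what the doubling is for.

    The profile depends on beta only through sn^2(beta), which is real in both cases, so real and
    imaginary beta need no separate computation. *)

Ltac Rring := match goal with |- @eq _ ?a ?b => change (@eq R a b); ring end.

(** * Dominated convergence and interchange for real series *)

Lemma sum_n_0R (a : nat -> R) : sum_n a 0 = a 0%nat.
Proof. exact (sum_O a). Qed.

Lemma sum_n_SR (a : nat -> R) (n : nat) : sum_n a (S n) = sum_n a n + a (S n).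
Proof. exact (sum_Sn a n). Qed.

Lemma Series_tail_small (M : nat -> R) (eps : posreal) :
  ex_series M -> exists N, Rabs (Series (fun k => M (S N + k)%nat)) < eps.
Proof.
  intros HM.
  assert (Hl := Series_correct _ HM).
  assert (Hl2 := proj2 (is_lim_seq_spec (sum_n M) (Series M)) Hl).
  destruct (Hl2 eps) as [N HN].
  exists N. specialize (HN N (le_n N)).
  rewrite (Series_incr_n M (S N)) in HN by (auto with arith).
  rewrite <- sum_n_Reals in HN. simpl pred in HN.
  rewrite Rabs_minus_sym in HN.
  replace (Series (fun k => M (S N + k)%nat)) with
    (sum_n M N + Series (fun k => M (S N + k)%nat) - sum_n M N) by ring.
  exact HN.
Qed.

Lemma filterlim_sum_n {T : Type} (F : (T -> Prop) -> Prop) {FF : Filter F}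
  (f : T -> nat -> R) (g : nat -> R) (N : nat) :
  (forall j, filterlim (fun t => f t j) F (locally (g j))) ->
  filterlim (fun t => sum_n (f t) N) F (locally (sum_n g N)).
Proof.
  intros H. induction N as [|N IH].
  - rewrite sum_O. apply filterlim_ext with (fun t => f t 0%nat).
    + intros t. now rewrite sum_O.
    + apply H.
  - rewrite sum_Sn. apply filterlim_ext with (fun t => plus (sum_n (f t) N) (f t (S N))).
    + intros t. now rewrite sum_Sn.
    + apply (filterlim_comp_2 (G := locally (sum_n g N)) (H := locally (g (S N)))); auto.
      apply @filterlim_plus.
Qed.

Lemma ex_series_bound (a M : nat -> R) :
  ex_series M -> (forall n, Rabs (a n) <= M n) -> ex_series (fun n => Rabs (a n)) /\ ex_series a.
Proof.
  intros HM Ha.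
  assert (ex_series (fun n => Rabs (a n))).
  { apply (ex_series_le (fun n => Rabs (a n)) M); auto.
    intros n. change (norm (Rabs (a n))) with (Rabs (Rabs (a n))). rewrite Rabs_Rabsolu; auto. }
  split; auto. now apply ex_series_Rabs.
Qed.

(** The remainder is controlled by a tail of the majorant that does not depend on [a]; this
    uniformity is what [Series_dominated] lives on. *)
Lemma Series_split_bound (a M : nat -> R) (N : nat) :
  ex_series M -> (forall n, Rabs (a n) <= M n) ->
  Rabs (Series a - sum_n a N) <= Rabs (Series (fun k => M (S N + k)%nat)).
Proof.
  intros HM Ha. destruct (ex_series_bound a M HM Ha) as [H1 H2].
  rewrite (Series_incr_n a (S N)) by (auto with arith).
  rewrite <- sum_n_Reals. simpl pred.
  replace (_ + _ - _) with (Series (fun k => a (S N + k)%nat)) by ring.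
  eapply Rle_trans. apply Series_Rabs.
  { apply (ex_series_incr_n (fun n => Rabs (a n)) (S N)). exact H1. }
  eapply Rle_trans; [|apply Rle_abs].
  apply Series_le.
  - intros n; split; [apply Rabs_pos| apply Ha].
  - now apply (ex_series_incr_n M (S N)).
Qed.

(** Tannery's theorem. The filter is arbitrary so that it serves both a limit of partial sums
    (interchange of summations) and a limit of difference quotients (termwise differentiation). *)
Lemma Series_dominated {T : Type} (F : (T -> Prop) -> Prop) {FF : ProperFilter F}
  (f : T -> nat -> R) (g M : nat -> R) :
  ex_series M ->
  F (fun t => forall j, Rabs (f t j) <= M j) ->
  (forall j, filterlim (fun t => f t j) F (locally (g j))) ->
  filterlim (fun t => Series (f t)) F (locally (Series g)).
Proof.
  intros HM Hb Hl.
  assert (Hg : forall j, Rabs (g j) <= M j).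
  { intros j. change (Rbar_le (Rabs (g j)) (M j)).
    apply (filterlim_le (F := F) (fun t => Rabs (f t j)) (fun _ => M j)).
    - apply filter_imp with (2 := Hb). intros t Ht. apply Ht.
    - apply (filterlim_comp _ _ _ (fun t => f t j) Rabs F (locally (g j))).
      apply Hl. apply (continuous_Rabs (g j)).
    - apply filterlim_const. }
  apply filterlim_locally. intros eps.
  assert (He : 0 < eps / 3) by (destruct eps; simpl; lra).
  destruct (Series_tail_small M (mkposreal _ He) HM) as [N HN]. change (Rabs (Series (fun k => M (S N + k)%nat)) < eps / 3) in HN.
  assert (Hs := filterlim_sum_n F f g N Hl).
  assert (Hs2 := proj1 (filterlim_locally (F := F) (fun t => sum_n (f t) N) (sum_n g N)) Hs (mkposreal _ He)).
  generalize (filter_and _ _ Hb Hs2). apply filter_imp.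
  intros t [Ht1 Ht2].
  assert (B1 := Series_split_bound (f t) M N HM Ht1).
  assert (B2 := Series_split_bound g M N HM Hg).
  change (Rabs (sum_n (f t) N - sum_n g N) < eps / 3) in Ht2.
  change (Rabs (Series (f t) - Series g) < eps).
  replace (Series (f t) - Series g) with
    ((Series (f t) - sum_n (f t) N) + (sum_n (f t) N - sum_n g N) - (Series g - sum_n g N)) by ring.
  eapply Rle_lt_trans; [apply Rabs_triang|]. rewrite Rabs_Ropp.
  eapply Rle_lt_trans; [apply Rplus_le_compat_r, Rabs_triang|].
  lra.
Qed.

Lemma Series_partial_le (a : nat -> R) (N : nat) :
  (forall n, 0 <= a n) -> ex_series a -> sum_n a N <= Series a.
Proof.
  intros Hp Ha. rewrite (Series_incr_n a (S N)) by (auto with arith).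
  rewrite <- sum_n_Reals. simpl pred.
  assert (0 <= Series (fun k => a (S N + k)%nat)); [|lra].
  rewrite <- (Rmult_0_l (Series (fun k => a (S N + k)%nat))) at 1.
  rewrite <- Series_scal_l. apply Series_le.
  - intros n. specialize (Hp (S N + n)%nat). lra.
  - now apply (ex_series_incr_n a (S N)).
Qed.

Lemma Series_nonneg (a : nat -> R) : (forall n, 0 <= a n) -> ex_series a -> 0 <= Series a.
Proof.
  intros Hp Ha. assert (H := Series_partial_le a 0 Hp Ha). rewrite sum_O in H.
  specialize (Hp 0%nat). lra.
Qed.

Lemma ex_series_of_bounded (a : nat -> R) (B : R) :
  (forall n, 0 <= a n) -> (forall n, sum_n a n <= B) -> ex_series a.
Proof.
  intros Hp HB.
  destruct (ex_finite_lim_seq_incr (sum_n a) B) as [l Hl]; auto.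
  - intros n. rewrite sum_Sn. specialize (Hp (S n)). change (sum_n a n <= sum_n a n + a (S n)). lra.
  - exists l. exact Hl.
Qed.

Lemma Series_sum_n (f : nat -> nat -> R) (N : nat) :
  (forall i, ex_series (f i)) ->
  ex_series (fun j => sum_n (fun i => f i j) N) /\
  Series (fun j => sum_n (fun i => f i j) N) = sum_n (fun i => Series (f i)) N.
Proof.
  intros H. induction N as [|N [IH1 IH2]].
  - split.
    + apply ex_series_ext with (f 0%nat); auto. intros n; now rewrite sum_O.
    + rewrite sum_O. apply Series_ext. intros n; now rewrite sum_O.
  - assert (E : forall j, sum_n (fun i => f i j) (S N) = sum_n (fun i => f i j) N + f (S N) j).
    { intros j. rewrite sum_Sn. reflexivity. }
    split.
    + apply ex_series_ext with (fun j => sum_n (fun i => f i j) N + f (S N) j).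
      { intros j; now rewrite E. }
      apply (ex_series_plus (fun j => sum_n (fun i => f i j) N) (f (S N))); auto.
    + rewrite (Series_ext _ _ E), Series_plus; auto.
      rewrite IH2, sum_Sn. reflexivity.
Qed.

Lemma sum_n_nonneg (a : nat -> R) N : (forall n, 0 <= a n) -> 0 <= sum_n a N.
Proof.
  intros H. induction N; [rewrite sum_O; auto|].
  rewrite sum_Sn. change (0 <= sum_n a N + a (S N)). specialize (H (S N)). lra.
Qed.

Lemma sum_n_Rabs (a : nat -> R) N : Rabs (sum_n a N) <= sum_n (fun n => Rabs (a n)) N.
Proof. exact (norm_sum_n_m a 0 N). Qed.

Lemma sum_n_term_le (a : nat -> R) N : (forall n, 0 <= a n) -> a N <= sum_n a N.
Proof.
  intros H. destruct N; [rewrite sum_O; lra|].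
  rewrite sum_Sn. change (a (S N) <= sum_n a N + a (S N)).
  generalize (sum_n_nonneg a N H). lra.
Qed.

(** Fubini for double series. The partial sums over [i], seen as functions of [j], are dominated by
    the column sums of absolute values, so the interchange is an instance of [Series_dominated]. *)
Lemma Series_swap (f : nat -> nat -> R) :
  (forall i, ex_series (fun j => Rabs (f i j))) ->
  ex_series (fun i => Series (fun j => Rabs (f i j))) ->
  (forall j, ex_series (fun i => Rabs (f i j))) /\
  ex_series (fun j => Series (fun i => Rabs (f i j))) /\
  Series (fun i => Series (f i)) = Series (fun j => Series (fun i => f i j)).
Proof.
  intros H1 H2.
  assert (P1 : forall i, 0 <= Series (fun j => Rabs (f i j))).
  { intros i. apply Series_nonneg; auto. intros; apply Rabs_pos. }
  assert (C1 : forall j, ex_series (fun i => Rabs (f i j))).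
  { intros j. apply (ex_series_bound (fun i => f i j) _ H2).
    intros i. eapply Rle_trans; [|apply (Series_partial_le (fun j => Rabs (f i j)) j); auto].
    apply (sum_n_term_le (fun j => Rabs (f i j))). all: intros; apply Rabs_pos. }
  assert (C2 : ex_series (fun j => Series (fun i => Rabs (f i j)))).
  { apply ex_series_of_bounded with (Series (fun i => Series (fun j => Rabs (f i j)))).
    - intros j. apply Series_nonneg; auto. intros; apply Rabs_pos.
    - intros J.
      destruct (Series_sum_n (fun j i => Rabs (f i j)) J C1) as [_ E].
      rewrite <- E. apply Series_le; auto.
      intros i; split.
      + apply sum_n_nonneg. intros; apply Rabs_pos.
      + apply Series_partial_le; auto. intros; apply Rabs_pos. }
  split; [exact C1|split;[exact C2|]].
  assert (K : filterlim (fun N => Series (fun j => sum_n (fun i => f i j) N)) eventually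
    (locally (Series (fun j => Series (fun i => f i j))))).
  { apply (Series_dominated eventually) with (M := fun j => Series (fun i => Rabs (f i j))); auto.
    - exists 0%nat. intros N _ j.
      eapply Rle_trans; [apply sum_n_Rabs|].
      apply (Series_partial_le (fun i => Rabs (f i j))); auto. intros; apply Rabs_pos.
    - intros j. apply (Series_correct (fun i => f i j)). now apply ex_series_Rabs. }
  assert (K2 : is_lim_seq (sum_n (fun i => Series (f i))) (Series (fun j => Series (fun i => f i j)))).
  { apply filterlim_ext with (2 := K). intros N.
    apply (Series_sum_n f N). intros i; now apply ex_series_Rabs. }
  apply is_series_unique. exact K2.
Qed.

(** * Bilateral series *)

(** Pairing [n] with [- n - 1] lists every integer once, without a special term at 0, and joins the
    opposite half-integers n + 1/2 and - (n + 1/2) of theta_1 and theta_2. *)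
Definition zpair (f : Z -> R) (n : nat) : R := f (Z.of_nat n) + f (- Z.of_nat n - 1)%Z.
Definition zabs (f : Z -> R) : Prop := ex_series (zpair (fun n => Rabs (f n))).
Definition zsum (f : Z -> R) : R := Series (zpair f).

Lemma zpair_abs (f : Z -> R) n : Rabs (zpair f n) <= zpair (fun n => Rabs (f n)) n.
Proof. unfold zpair. apply Rabs_triang. Qed.

Lemma zabs_ex (f : Z -> R) : zabs f -> ex_series (zpair f).
Proof. intros H. apply (ex_series_bound _ _ H). apply zpair_abs. Qed.

Lemma zabs_half (f : Z -> R) : zabs f ->
  ex_series (fun n => Rabs (f (Z.of_nat n))) /\ ex_series (fun n => Rabs (f (- Z.of_nat n - 1)%Z)).
Proof.
  intros H. split;
  [apply (ex_series_bound (fun n => f (Z.of_nat n)) _ H)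
  |apply (ex_series_bound (fun n => f (- Z.of_nat n - 1)%Z) _ H)]; intros n; unfold zpair.
  - generalize (Rabs_pos (f (- Z.of_nat n - 1)%Z)); lra.
  - generalize (Rabs_pos (f (Z.of_nat n))); lra.
Qed.

Lemma zabs_of_half (f : Z -> R) :
  ex_series (fun n => Rabs (f (Z.of_nat n))) -> ex_series (fun n => Rabs (f (- Z.of_nat n - 1)%Z)) ->
  zabs f.
Proof.
  intros H1 H2. exact (ex_series_plus _ _ H1 H2).
Qed.

Lemma zabs_le (f g : Z -> R) : zabs g -> (forall n, Rabs (f n) <= Rabs (g n)) -> zabs f.
Proof.
  intros Hg H. apply (ex_series_le (zpair (fun n => Rabs (f n))) (zpair (fun n => Rabs (g n)))); [|exact Hg].
  intros n. unfold zpair. change (Rabs (Rabs (f (Z.of_nat n)) + Rabs (f (- Z.of_nat n - 1)%Z))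
    <= Rabs (g (Z.of_nat n)) + Rabs (g (- Z.of_nat n - 1)%Z)).
  rewrite Rabs_pos_eq; [apply Rplus_le_compat; apply H|].
  apply Rplus_le_le_0_compat; apply Rabs_pos.
Qed.

Lemma zsum_ext (f g : Z -> R) : (forall n, f n = g n) -> zsum f = zsum g.
Proof. intros H. apply Series_ext. intros n. unfold zpair. now rewrite !H. Qed.

Lemma zabs_ext (f g : Z -> R) : (forall n, f n = g n) -> zabs f -> zabs g.
Proof. intros H Hf. apply zabs_le with f; auto. intros n. rewrite H. lra. Qed.

Lemma zabs_scal (c : R) (f : Z -> R) : zabs f -> zabs (fun n => c * f n).
Proof.
  intros H. unfold zabs.
  apply ex_series_ext with (fun n => scal (Rabs c) (zpair (fun n => Rabs (f n)) n)).
  - intros n. unfold zpair, scal; simpl; unfold mult; simpl. rewrite !Rabs_mult. ring.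
  - exact (ex_series_scal_l (Rabs c) _ H).
Qed.

Lemma zsum_scal (c : R) (f : Z -> R) : zsum (fun n => c * f n) = c * zsum f.
Proof.
  unfold zsum. rewrite <- Series_scal_l. apply Series_ext.
  intros n. unfold zpair. ring.
Qed.

Lemma zabs_plus (f g : Z -> R) : zabs f -> zabs g -> zabs (fun n => f n + g n).
Proof.
  intros H1 H2. apply (ex_series_le (zpair (fun n => Rabs (f n + g n)))
     (fun n => zpair (fun n => Rabs (f n)) n + zpair (fun n => Rabs (g n)) n)).
  - intros n. unfold zpair. change (Rabs (Rabs (f (Z.of_nat n) + g (Z.of_nat n)) +
      Rabs (f (- Z.of_nat n - 1)%Z + g (- Z.of_nat n - 1)%Z)) <=
      Rabs (f (Z.of_nat n)) + Rabs (f (- Z.of_nat n - 1)%Z) + (Rabs (g (Z.of_nat n)) + Rabs (g (- Z.of_nat n - 1)%Z))).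
    rewrite Rabs_pos_eq by (apply Rplus_le_le_0_compat; apply Rabs_pos).
    generalize (Rabs_triang (f (Z.of_nat n)) (g (Z.of_nat n)))
      (Rabs_triang (f (- Z.of_nat n - 1)%Z) (g (- Z.of_nat n - 1)%Z)). lra.
  - exact (ex_series_plus _ _ H1 H2).
Qed.

Lemma zsum_plus (f g : Z -> R) : zabs f -> zabs g ->
  zsum (fun n => f n + g n) = zsum f + zsum g.
Proof.
  intros H1 H2. unfold zsum. rewrite <- Series_plus by now apply zabs_ex.
  apply Series_ext. intros n. unfold zpair. ring.
Qed.

Lemma zsum_abs (f : Z -> R) : zabs f -> Rabs (zsum f) <= zsum (fun n => Rabs (f n)).
Proof.
  intros H. unfold zsum. eapply Rle_trans. apply Series_Rabs.
  - refine (proj1 (ex_series_bound _ _ H _)). apply zpair_abs.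
  - apply Series_le; [|exact H]. intros n; split; [apply Rabs_pos| apply zpair_abs].
Qed.

Lemma zsum_limit (f : Z -> R) : zabs f -> is_lim_seq (sum_n (zpair f)) (zsum f).
Proof. intros H. apply (Series_correct (zpair f)). now apply zabs_ex. Qed.

Lemma zabs_lim0 (f : Z -> R) : zabs f ->
  is_lim_seq (fun n => f (Z.of_nat n)) 0 /\ is_lim_seq (fun n => f (- Z.of_nat n - 1)%Z) 0.
Proof.
  intros H. destruct (zabs_half f H) as [H1 H2]. split;
  [apply (ex_series_lim_0 (fun n => f (Z.of_nat n)))|apply (ex_series_lim_0 (fun n => f (- Z.of_nat n - 1)%Z))];
  now apply ex_series_Rabs.
Qed.

Lemma zabs_shift1 (f : Z -> R) : zabs f -> zabs (fun n => f (n + 1)%Z).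
Proof.
  intros H. destruct (zabs_half f H) as [H1 H2]. apply zabs_of_half.
  - apply ex_series_incr_1 in H1. apply ex_series_ext with (2 := H1).
    intros n. do 2 f_equal. lia.
  - apply ex_series_incr_1. apply ex_series_ext with (2 := H2).
    intros n. do 2 f_equal. lia.
Qed.

(** The partial sums of the shifted series differ from the original ones by two boundary terms,
    which tend to 0 by summability. *)
Lemma zsum_shift1 (f : Z -> R) : zabs f -> zsum (fun n => f (n + 1)%Z) = zsum f.
Proof.
  intros H.
  assert (E : forall n, sum_n (zpair (fun n => f (n + 1)%Z)) n =
     sum_n (zpair f) n + f (Z.of_nat (S n)) - f (- Z.of_nat n - 1)%Z).
  { induction n as [|n IH].
    - rewrite !sum_n_0R. unfold zpair.
      replace (Z.of_nat 0 + 1)%Z with (Z.of_nat 1) by lia.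
      replace (- Z.of_nat 0 - 1 + 1)%Z with (Z.of_nat 0) by lia. Rring.
    - rewrite !sum_n_SR, IH. unfold zpair.
      replace (Z.of_nat (S n) + 1)%Z with (Z.of_nat (S (S n))) by lia.
      replace (- Z.of_nat (S n) - 1 + 1)%Z with (- Z.of_nat n - 1)%Z by lia. Rring. }
  assert (L1 := zsum_limit f H).
  destruct (zabs_lim0 f H) as [L2 L3]. apply is_lim_seq_incr_1 in L2.
  assert (L4 := zsum_limit _ (zabs_shift1 f H)).
  assert (L5 : is_lim_seq (sum_n (zpair (fun n => f (n + 1)%Z))) (zsum f + 0 - 0)).
  { apply is_lim_seq_ext with (1 := fun n => eq_sym (E n)).
    apply is_lim_seq_minus'; auto. apply is_lim_seq_plus'; auto. }
  rewrite Rplus_0_r, Rminus_0_r in L5.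
  apply is_lim_seq_unique in L4, L5. rewrite L4 in L5. now injection L5.
Qed.

Lemma zabs_refl (f : Z -> R) : zabs f -> zabs (fun n => f (- n - 1)%Z).
Proof.
  intros H. destruct (zabs_half f H) as [H1 H2]. apply zabs_of_half; auto.
  apply ex_series_ext with (2 := H1). intros n. do 2 f_equal. lia.
Qed.

Lemma zsum_refl (f : Z -> R) : zsum (fun n => f (- n - 1)%Z) = zsum f.
Proof.
  apply Series_ext. intros n. unfold zpair. rewrite Rplus_comm. do 2 f_equal; lia.
Qed.

Lemma zabs_shift_nat (m : nat) (f : Z -> R) : zabs f ->
  zabs (fun n => f (n + Z.of_nat m)%Z) /\ zsum (fun n => f (n + Z.of_nat m)%Z) = zsum f.
Proof.
  intros H. induction m as [|m [IH1 IH2]].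
  - split; [apply zabs_ext with (2 := H)|apply zsum_ext]; intros n; f_equal; lia.
  - assert (E : forall n, f (n + 1 + Z.of_nat m)%Z = f (n + Z.of_nat (S m))%Z) by (intros; f_equal; lia).
    split.
    + apply zabs_ext with (1 := E). exact (zabs_shift1 _ IH1).
    + rewrite <- (zsum_ext _ _ E). now rewrite (zsum_shift1 _ IH1).
Qed.

Lemma zabs_zsum_shift (m : Z) (f : Z -> R) : zabs f ->
  zabs (fun n => f (n + m)%Z) /\ zsum (fun n => f (n + m)%Z) = zsum f.
Proof.
  intros H. destruct (Z_le_gt_dec 0 m) as [Hm|Hm].
  - rewrite <- (Z2Nat.id m Hm). now apply zabs_shift_nat.
  (* A negative shift is a positive one conjugated by the reflection [n -> - n - 1]. *)
  - destruct (zabs_shift_nat (Z.to_nat (- m)) _ (zabs_refl f H)) as [A1 A2].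
    assert (E : forall n, f (- (- n - 1 + Z.of_nat (Z.to_nat (- m))) - 1)%Z = f (n + m)%Z).
    { intros n. f_equal. rewrite Z2Nat.id by lia. lia. }
    split.
    + apply zabs_ext with (1 := E).
      exact (zabs_refl _ A1).
    + rewrite <- (zsum_ext _ _ E).
      rewrite (zsum_refl (fun n => f (- (n + Z.of_nat (Z.to_nat (- m))) - 1)%Z)).
      rewrite A2. apply zsum_refl.
Qed.

Lemma zabs_shift (m : Z) (f : Z -> R) : zabs f -> zabs (fun n => f (n + m)%Z).
Proof. intros H. now apply zabs_zsum_shift. Qed.

Lemma zsum_shift (m : Z) (f : Z -> R) : zabs f -> zsum (fun n => f (n + m)%Z) = zsum f.
Proof. intros H. now apply zabs_zsum_shift. Qed.

Lemma zsum_reflect (m : Z) (f : Z -> R) : zabs f -> zsum (fun n => f (m - n)%Z) = zsum f.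
Proof.
  intros H. rewrite <- (zsum_shift (m + 1) f H), <- (zsum_refl (fun n => f (n + (m + 1))%Z)).
  apply zsum_ext. intros n; f_equal; lia.
Qed.

Lemma sum_n_even_odd (a : nat -> R) N :
  sum_n a (S (2 * N)) = sum_n (fun n => a (2 * n)%nat + a (S (2 * n))) N.
Proof.
  induction N as [|N IH].
  - change (2 * 0)%nat with 0%nat. rewrite sum_n_SR, !sum_n_0R. reflexivity.
  - replace (2 * S N)%nat with (S (S (2 * N))) by lia.
    rewrite sum_n_SR, (sum_n_SR a (S (2 * N))), IH, (sum_n_SR _ N).
    replace (2 * S N)%nat with (S (S (2 * N))) by lia.
    Rring.
Qed.

Lemma zsum_parity (f : Z -> R) : zabs f ->
  zabs (fun n => f (2 * n)%Z) /\ zabs (fun n => f (2 * n + 1)%Z) /\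
  zsum f = zsum (fun n => f (2 * n)%Z) + zsum (fun n => f (2 * n + 1)%Z).
Proof.
  intros H.
  (* The even and the odd pair at [n] make up the pairs [2 n] and [2 n + 1] of the whole series,
     though the negative indices change partners. It is needed for [f] and for its absolute
     value. *)
  assert (X : forall h : Z -> R, forall n,
    zpair (fun n => h (2 * n)%Z) n + zpair (fun n => h (2 * n + 1)%Z) n =
    zpair h (2 * n) + zpair h (S (2 * n))).
  { intros h n. unfold zpair.
    replace (Z.of_nat (2 * n)) with (2 * Z.of_nat n)%Z by lia.
    replace (Z.of_nat (S (2 * n))) with (2 * Z.of_nat n + 1)%Z by lia.
    replace (2 * (- Z.of_nat n - 1) + 1)%Z with (- (2 * Z.of_nat n) - 1)%Z by lia.
    replace (2 * (- Z.of_nat n - 1))%Z with (- (2 * Z.of_nat n + 1) - 1)%Z by lia.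
    Rring. }
  assert (B : ex_series (fun n => zpair (fun n => Rabs (f (2 * n)%Z)) n +
                zpair (fun n => Rabs (f (2 * n + 1)%Z)) n)).
  { apply ex_series_of_bounded with (zsum (fun n => Rabs (f n))).
    - intros n. unfold zpair. generalize (Rabs_pos (f (2 * Z.of_nat n)%Z))
       (Rabs_pos (f (2 * (- Z.of_nat n - 1))%Z)) (Rabs_pos (f (2 * Z.of_nat n + 1)%Z))
       (Rabs_pos (f (2 * (- Z.of_nat n - 1) + 1)%Z)). lra.
    - intros N. rewrite (sum_n_ext _ _ N (X (fun n => Rabs (f n)))).
      rewrite <- (sum_n_even_odd (zpair (fun n => Rabs (f n)))).
      apply Series_partial_le; auto. intros n. unfold zpair.
      apply Rplus_le_le_0_compat; apply Rabs_pos. }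
  assert (Z1 : zabs (fun n => f (2 * n)%Z)).
  { eapply (ex_series_le (zpair (fun n => Rabs (f (2 * n)%Z)))); [|exact B].
    intros n. unfold norm, abs; cbn [NormedModule.mixin NormedModule.norm]. unfold zpair.
    rewrite Rabs_pos_eq by (apply Rplus_le_le_0_compat; apply Rabs_pos).
    generalize (Rabs_pos (f (2 * Z.of_nat n + 1)%Z))
       (Rabs_pos (f (2 * (- Z.of_nat n - 1) + 1)%Z)). lra. }
  assert (Z2 : zabs (fun n => f (2 * n + 1)%Z)).
  { eapply (ex_series_le (zpair (fun n => Rabs (f (2 * n + 1)%Z)))); [|exact B].
    intros n. unfold norm, abs; cbn [NormedModule.mixin NormedModule.norm]. unfold zpair.
    rewrite Rabs_pos_eq by (apply Rplus_le_le_0_compat; apply Rabs_pos).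
    generalize (Rabs_pos (f (2 * Z.of_nat n)%Z))
       (Rabs_pos (f (2 * (- Z.of_nat n - 1))%Z)). lra. }
  split; [exact Z1|split;[exact Z2|]].
  assert (L1 := zsum_limit f H).
  assert (L2 : is_lim_seq (fun N => sum_n (zpair f) (S (2 * N))) (zsum f)).
  { apply (is_lim_seq_subseq (sum_n (zpair f)) (zsum f) (fun N => S (2 * N))); auto.
    apply eventually_subseq. intros n; lia. }
  assert (L3 : is_lim_seq (fun N => sum_n (zpair f) (S (2 * N)))
     (zsum (fun n => f (2 * n)%Z) + zsum (fun n => f (2 * n + 1)%Z))).
  { apply is_lim_seq_ext with (fun N => sum_n (zpair (fun n => f (2 * n)%Z)) N +
      sum_n (zpair (fun n => f (2 * n + 1)%Z)) N).
    - intros N. rewrite sum_n_even_odd, <- (sum_n_ext _ _ N (X f)).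
      symmetry. exact (sum_n_plus _ _ N).
    - apply is_lim_seq_plus'; now apply zsum_limit. }
  apply is_lim_seq_unique in L2, L3. rewrite L2 in L3. now injection L3.
Qed.

Lemma zsum_swap (f : Z -> Z -> R) :
  (forall i, zabs (f i)) -> zabs (fun i => zsum (fun j => Rabs (f i j))) ->
  (forall j, zabs (fun i => f i j)) /\
  zabs (fun j => zsum (fun i => Rabs (f i j))) /\
  zsum (fun i => zsum (f i)) = zsum (fun j => zsum (fun i => f i j)).
Proof.
  intros H1 H2.
  set (p := fun i : nat => Z.of_nat i). set (m := fun i : nat => (- Z.of_nat i - 1)%Z).
  (* The four quadrants of the integer lattice are folded onto one, which reduces the claim to
     [Series_swap]; [h] majorises the folded terms [g]. *)
  set (h := fun i j : nat => Rabs (f (p i) (p j)) + Rabs (f (p i) (m j)) +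
                             (Rabs (f (m i) (p j)) + Rabs (f (m i) (m j)))).
  set (g := fun i j : nat => f (p i) (p j) + f (p i) (m j) +
                             (f (m i) (p j) + f (m i) (m j))).
  assert (Hp : forall i j, 0 <= h i j).
  { intros i j. unfold h. generalize (Rabs_pos (f (p i) (p j))) (Rabs_pos (f (p i) (m j)))
     (Rabs_pos (f (m i) (p j))) (Rabs_pos (f (m i) (m j))). lra. }
  assert (Ha : forall i j, Rabs (h i j) = h i j) by (intros; now apply Rabs_pos_eq).
  assert (Hg : forall i j, Rabs (g i j) <= h i j).
  { intros i j. unfold g, h. eapply Rle_trans; [apply Rabs_triang|].
    apply Rplus_le_compat; apply Rabs_triang. }
  assert (Xh1 : forall i, ex_series (h i)).
  { intros i. exact (ex_series_plus _ _ (H1 (p i)) (H1 (m i))). }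
  assert (E1 : forall i, Series (h i) = zpair (fun i => zsum (fun j => Rabs (f i j))) i).
  { intros i. unfold h, zpair, zsum. rewrite <- Series_plus; [reflexivity| apply (H1 (p i))|apply (H1 (m i))]. }
  assert (Pz : forall i, 0 <= zsum (fun j => Rabs (f i j))).
  { intros i. apply Series_nonneg; [|apply H1]. intros n. unfold zpair.
    apply Rplus_le_le_0_compat; apply Rabs_pos. }
  assert (H2' : ex_series (zpair (fun i => zsum (fun j => Rabs (f i j))))).
  { exact (zabs_ex _ H2). }
  assert (Xh2 : ex_series (fun i => Series (h i))).
  { apply ex_series_ext with (2 := H2'). intros; now rewrite E1. }
  destruct (Series_swap h) as [S1 [S2 _]].
  { intros i. apply ex_series_ext with (2 := Xh1 i). intros; now rewrite Ha. }
  { apply ex_series_ext with (2 := Xh2). intros i. apply Series_ext. intros; now rewrite Ha. }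
  assert (Gx : forall i, ex_series (fun j => Rabs (g i j))).
  { intros i. apply (ex_series_bound (g i) (h i)); auto. }
  destruct (Series_swap g) as [T1 [T2 T3]]; auto.
  { apply (ex_series_bound (fun i => Series (fun j => Rabs (g i j))) _ Xh2).
    intros i. rewrite Rabs_pos_eq; [apply Series_le; auto|].
    - intros; split; [apply Rabs_pos|apply Hg].
    - apply Series_nonneg; auto. intros; apply Rabs_pos. }
  assert (Y : forall j, zabs (fun i => f i (p j)) /\ zabs (fun i => f i (m j))).
  { intros j. split;
      [apply (ex_series_bound (zpair (fun i => Rabs (f i (p j)))) (fun i => Rabs (h i j)))
      |apply (ex_series_bound (zpair (fun i => Rabs (f i (m j)))) (fun i => Rabs (h i j)))];
      auto; intros i; rewrite Ha; unfold zpair, h; fold (m i) (p i);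
      rewrite Rabs_pos_eq by (apply Rplus_le_le_0_compat; apply Rabs_pos);
      generalize (Rabs_pos (f (p i) (p j))) (Rabs_pos (f (p i) (m j)))
        (Rabs_pos (f (m i) (p j))) (Rabs_pos (f (m i) (m j))); lra. }
  assert (E2 : forall j, Series (fun i => Rabs (h i j)) = zpair (fun j => zsum (fun i => Rabs (f i j))) j).
  { intros j. unfold zpair, zsum. fold (m j) (p j).
    rewrite <- Series_plus; [|apply (Y j)|apply (Y j)].
    apply Series_ext. intros i. rewrite Ha. unfold h, zpair. fold (m i) (p i). Rring. }
  split; [|split].
  - intros j. destruct (Z_le_gt_dec 0 j) as [Hj|Hj].
    + rewrite <- (Z2Nat.id j Hj). apply (Y (Z.to_nat j)).
    + replace j with (m (Z.to_nat (- j - 1))) by (unfold m; rewrite Z2Nat.id; lia). apply Y.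
  - apply ex_series_ext with (2 := S2). intros j. rewrite E2. unfold zpair.
    rewrite !Rabs_pos_eq; auto; apply Series_nonneg; try apply Y;
    intros n; unfold zpair; apply Rplus_le_le_0_compat; apply Rabs_pos.
  - assert (L : zsum (fun i => zsum (f i)) = Series (fun i => Series (g i))).
    { apply Series_ext. intros i. unfold zpair, zsum, g. fold (m i) (p i).
      rewrite <- Series_plus; [reflexivity| |]; now apply zabs_ex. }
    rewrite L, T3. apply Series_ext. intros j. unfold zpair, zsum. fold (m j) (p j).
    rewrite <- Series_plus; try (apply zabs_ex, Y).
    apply Series_ext. intros i. unfold g, zpair. fold (m i) (p i). Rring.
Qed.

(** Bilateral Cauchy product along the diagonals m + n = a. For fixed [m], summing over [a] is a
    shifted sum of [g], hence [zsum g]. *)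
Lemma zsum_mult (f g : Z -> R) : zabs f -> zabs g ->
  (forall a, zabs (fun m => f m * g (a - m)%Z)) /\
  zabs (fun a => zsum (fun m => f m * g (a - m)%Z)) /\
  zsum f * zsum g = zsum (fun a => zsum (fun m => f m * g (a - m)%Z)).
Proof.
  intros Hf Hg.
  assert (Hs : forall m, zabs (fun a => g (a - m)%Z)).
  { intros m. apply (zabs_shift (- m) g Hg). }
  assert (Hga : zabs (fun n => Rabs (g n))).
  { apply zabs_le with g; auto. intros; rewrite Rabs_Rabsolu; lra. }
  destruct (zsum_swap (fun m a => f m * g (a - m)%Z)) as [S1 [S2 S3]].
  - intros m. now apply zabs_scal.
  - apply zabs_ext with (fun m => zsum (fun n => Rabs (g n)) * Rabs (f m)).
    + intros m. rewrite Rmult_comm.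
      rewrite <- (zsum_shift (- m) _ Hga), <- zsum_scal. apply zsum_ext.
      intros a. now rewrite Rabs_mult.
    + apply zabs_scal. apply zabs_le with f; auto. intros; rewrite Rabs_Rabsolu; lra.
  - split; [exact S1|split].
    + apply zabs_le with (1 := S2). intros a. eapply Rle_trans; [now apply zsum_abs|].
      apply Rle_abs.
    + rewrite <- S3, Rmult_comm, <- zsum_scal. apply zsum_ext. intros m.
      rewrite zsum_scal, Rmult_comm. f_equal.
      symmetry. exact (zsum_shift (- m) g Hg).
Qed.

(** * Bilateral series of complex terms *)

Definition Czabs (f : Z -> C) : Prop := zabs (fun n => fst (f n)) /\ zabs (fun n => snd (f n)).
Definition Czsum (f : Z -> C) : C := (zsum (fun n => fst (f n)), zsum (fun n => snd (f n))).

Lemma Czsum_ext (f g : Z -> C) : (forall n, f n = g n) -> Czsum f = Czsum g.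
Proof. intros H. unfold Czsum. f_equal; apply zsum_ext; intros n; now rewrite H. Qed.

Lemma zabs_lin (a b : R) (f g : Z -> R) : zabs f -> zabs g -> zabs (fun n => a * f n + b * g n).
Proof. intros. apply zabs_plus; now apply zabs_scal. Qed.

Lemma zsum_lin (a b : R) (f g : Z -> R) : zabs f -> zabs g ->
  zsum (fun n => a * f n + b * g n) = a * zsum f + b * zsum g.
Proof. intros. rewrite zsum_plus, !zsum_scal; auto; now apply zabs_scal. Qed.

Lemma Czsum_scal (c : C) (f : Z -> C) : Czabs f -> Czsum (fun n => c * f n)%C = (c * Czsum f)%C.
Proof.
  intros [H1 H2]. unfold Czsum. apply injective_projections; simpl.
  - rewrite (zsum_ext _ (fun n => fst c * fst (f n) + (- snd c) * snd (f n)));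
    [rewrite zsum_lin; auto; ring|intros n; ring].
  - now rewrite zsum_lin.
Qed.

Lemma Czsum_shift (m : Z) (f : Z -> C) : Czabs f -> Czsum (fun n => f (n + m)%Z) = Czsum f.
Proof.
  intros [H1 H2]. unfold Czsum.
  rewrite (zsum_shift m (fun n => fst (f n)) H1), (zsum_shift m (fun n => snd (f n)) H2). reflexivity.
Qed.

Lemma Czsum_reflect (m : Z) (f : Z -> C) : Czabs f -> Czsum (fun n => f (m - n)%Z) = Czsum f.
Proof.
  intros [H1 H2]. unfold Czsum.
  rewrite (zsum_reflect m (fun n => fst (f n)) H1), (zsum_reflect m (fun n => snd (f n)) H2). reflexivity.
Qed.

Lemma Czsum_parity (f : Z -> C) : Czabs f ->
  Czsum f = (Czsum (fun n => f (2 * n)%Z) + Czsum (fun n => f (2 * n + 1)%Z))%C.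
Proof.
  intros [H1 H2]. unfold Czsum. apply injective_projections; simpl fst; simpl snd.
  - apply (zsum_parity _ H1).
  - apply (zsum_parity _ H2).
Qed.

Lemma Czsum_mult (f g : Z -> C) : Czabs f -> Czabs g ->
  Czabs (fun a => Czsum (fun m => f m * g (a - m)%Z)%C) /\
  (Czsum f * Czsum g)%C = Czsum (fun a => Czsum (fun m => f m * g (a - m)%Z)%C).
Proof.
  intros [F1 F2] [G1 G2].
  destruct (zsum_mult _ _ F1 G1) as [A1 [B1 C1]].
  destruct (zsum_mult _ _ F1 G2) as [A2 [B2 C2]].
  destruct (zsum_mult _ _ F2 G1) as [A3 [B3 C3]].
  destruct (zsum_mult _ _ F2 G2) as [A4 [B4 C4]].
  assert (E1 : forall a, zsum (fun m => fst (f m * g (a - m)%Z)%C) =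
     1 * zsum (fun m => fst (f m) * fst (g (a - m)%Z)) + (-1) * zsum (fun m => snd (f m) * snd (g (a - m)%Z))).
  { intros a. rewrite <- zsum_lin; auto. apply zsum_ext; intros m; simpl; ring. }
  assert (E2 : forall a, zsum (fun m => snd (f m * g (a - m)%Z)%C) =
     1 * zsum (fun m => fst (f m) * snd (g (a - m)%Z)) + 1 * zsum (fun m => snd (f m) * fst (g (a - m)%Z))).
  { intros a. rewrite <- zsum_lin; auto. apply zsum_ext; intros m; simpl; ring. }
  split.
  - split; simpl.
    + apply zabs_ext with (1 := fun a => eq_sym (E1 a)). now apply zabs_lin.
    + apply zabs_ext with (1 := fun a => eq_sym (E2 a)). now apply zabs_lin.
  - unfold Czsum. apply injective_projections.
    + transitivity (zsum (fun a => zsum (fun m => fst (f m * g (a - m)%Z)%C))); [|reflexivity].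
      rewrite (zsum_ext _ _ E1), zsum_lin, <- C1, <- C4; auto. simpl. ring.
    + transitivity (zsum (fun a => zsum (fun m => snd (f m * g (a - m)%Z)%C))); [|reflexivity].
      rewrite (zsum_ext _ _ E2), zsum_lin, <- C2, <- C3; auto. simpl. ring.
Qed.

(** * Theta series with real characteristic *)

Lemma exp_pow_nat (x : R) (n : nat) : exp (INR n * x) = exp x ^ n.
Proof.
  induction n as [|n IH]; [simpl; rewrite Rmult_0_l; apply exp_0|].
  rewrite S_INR, Rmult_plus_distr_r, Rmult_1_l, exp_plus, IH. simpl. ring.
Qed.

Lemma exp_le (x y : R) : x <= y -> exp x <= exp y.
Proof. intros [H| ->]; [left; now apply exp_increasing|lra]. Qed.

Lemma Rabs_exp (x : R) : Rabs (exp x) = exp x.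
Proof. apply Rabs_pos_eq. left. apply exp_pos. Qed.

Lemma exp_lt_1 (x : R) : x < 0 -> exp x < 1.
Proof. intros H. rewrite <- exp_0. now apply exp_increasing. Qed.

Lemma ex_series_exp (x : R) : x < 0 -> ex_series (fun n => exp (INR n * x)).
Proof.
  intros Hx. apply ex_series_ext with (fun n => exp x ^ n).
  - intros n; now rewrite exp_pow_nat.
  - apply ex_series_geom. rewrite Rabs_exp. now apply exp_lt_1.
Qed.

Lemma zabs_exp : zabs (fun n => exp (- Rabs (IZR n))).
Proof.
  assert (E := ex_series_exp (-1) ltac:(lra)).
  assert (E' : ex_series (fun n => Rabs (exp (- INR n)))).
  { apply ex_series_ext with (2 := E). intros n. rewrite Rabs_exp.
    f_equal; ring. }
  apply zabs_of_half.
  - apply ex_series_ext with (2 := E'). intros n. rewrite <- INR_IZR_INZ.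
    now rewrite (Rabs_pos_eq (INR n)) by apply pos_INR.
  - apply ex_series_incr_1 in E'. apply ex_series_ext with (2 := E'). intros n.
    replace (- Z.of_nat n - 1)%Z with (- Z.of_nat (S n))%Z by lia.
    rewrite opp_IZR, <- INR_IZR_INZ, Rabs_Ropp.
    now rewrite (Rabs_pos_eq (INR (S n))) by apply pos_INR.
Qed.

(** Completing the square leaves [- Rabs c], that is, geometric decay. The linear term [B * Rabs c]
    makes room for the growth exp(2 |c| |Im z|) and for the factor [c] that a derivative brings
    down. *)
Lemma gauss_exponent_bound (L B c : R) : 0 < L ->
  - L * c ^ 2 + B * Rabs c <= (B + 1) ^ 2 / (4 * L) - Rabs c.
Proof.
  intros HL. rewrite <- (pow2_abs c). set (a := Rabs c).
  assert (0 <= (2 * L * a - (B + 1)) ^ 2 / (4 * L)).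
  { apply Rmult_le_pos; [apply pow2_ge_0|]. left. apply Rinv_0_lt_compat. lra. }
  replace ((B + 1) ^ 2 / (4 * L)) with
    ((2 * L * a - (B + 1)) ^ 2 / (4 * L) - L * a ^ 2 + (B + 1) * a) by (field; lra).
  lra.
Qed.

Lemma zabs_gauss (L B e : R) : 0 < L ->
  zabs (fun n => exp (- L * (IZR n + e) ^ 2 + B * Rabs (IZR n + e))).
Proof.
  intros HL.
  apply zabs_le with (fun n => exp ((B + 1) ^ 2 / (4 * L) + Rabs e) * exp (- Rabs (IZR n))).
  - apply zabs_scal, zabs_exp.
  - intros n. rewrite <- exp_plus. rewrite !Rabs_exp.
    apply exp_le. eapply Rle_trans; [now apply gauss_exponent_bound|].
    assert (Rabs (IZR n) <= Rabs (IZR n + e) + Rabs e); [|lra].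
    replace (IZR n) with (IZR n + e - e) at 1 by ring.
    unfold Rminus. eapply Rle_trans; [apply Rabs_triang|]. rewrite Rabs_Ropp. lra.
Qed.

Definition cexp (r a : R) : C := (exp r * cos a, exp r * sin a).

Lemma cexp_mult (r s a b : R) : (cexp r a * cexp s b)%C = cexp (r + s) (a + b).
Proof.
  unfold cexp. apply injective_projections; simpl; rewrite exp_plus, ?cos_plus, ?sin_plus; ring.
Qed.

Definition theta_term (L c : R) (z : C) : C := cexp (- L * c ^ 2 - 2 * c * snd z) (2 * c * fst z).

(* [theta L e] is sum_(n in Z) q^((n+e)^2) exp(2 i (n+e) z) with q = exp (-L). *)
Definition theta (L e : R) (z : C) : C := Czsum (fun n => theta_term L (IZR n + e) z).

Lemma theta_term_bound (L c : R) (z : C) :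
  Rabs (fst (theta_term L c z)) <= exp (- L * c ^ 2 + 2 * Rabs (snd z) * Rabs c) /\
  Rabs (snd (theta_term L c z)) <= exp (- L * c ^ 2 + 2 * Rabs (snd z) * Rabs c).
Proof.
  unfold theta_term, cexp; simpl fst; simpl snd.
  assert (H : exp (- L * c ^ 2 - 2 * c * snd z) <= exp (- L * c ^ 2 + 2 * Rabs (snd z) * Rabs c)).
  { apply exp_le. assert (- (c * snd z) <= Rabs (snd z) * Rabs c); [|lra].
    rewrite Rmult_comm, <- Rabs_mult, <- Rabs_Ropp. apply Rle_abs. }
  assert (M : forall u v, Rabs u <= 1 -> exp v * Rabs u <= exp v).
  { intros u v Hu. generalize (exp_pos v); nra. }
  split; rewrite Rabs_mult, Rabs_exp;
  (eapply Rle_trans; [|exact H]); apply M, Rabs_le.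
  - apply COS_bound.
  - apply SIN_bound.
Qed.

Lemma Czabs_theta (L e : R) (z : C) : 0 < L -> Czabs (fun n => theta_term L (IZR n + e) z).
Proof.
  intros HL. split; (apply zabs_le with (1 := zabs_gauss L (2 * Rabs (snd z)) e HL));
  intros n; rewrite Rabs_exp;
  apply (theta_term_bound L (IZR n + e) z).
Qed.

(** Parallelogram law: c^2 + d^2 = 2 ((c + d)/2)^2 + 2 ((c - d)/2)^2 separates the sum and the
    difference of the indices at the price of doubling [L]. *)
Lemma theta_term_mult (L c d : R) (x y : C) :
  (theta_term L c (x + y) * theta_term L d (x - y))%C =
  (theta_term (2 * L) ((c + d) / 2) (Cscal 2 x) * theta_term (2 * L) ((c - d) / 2) (Cscal 2 y))%C.
Proof.
  unfold theta_term. rewrite !cexp_mult. simpl. f_equal; field.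
Qed.

(** The sum and the difference of two integers have the same parity; the even and the odd diagonals
    give one product each. *)
Lemma schroeter (L e d : R) (x y : C) : 0 < L ->
  (theta L e (x + y) * theta L d (x - y))%C =
  (theta (2 * L) ((e + d) / 2) (Cscal 2 x) * theta (2 * L) ((e - d) / 2) (Cscal 2 y) +
   theta (2 * L) ((e + d + 1) / 2) (Cscal 2 x) * theta (2 * L) ((e - d + 1) / 2) (Cscal 2 y))%C.
Proof.
  intros HL. assert (HL2 : 0 < 2 * L) by lra.
  destruct (Czsum_mult _ _ (Czabs_theta L e (x + y) HL) (Czabs_theta L d (x - y) HL)) as [A E].
  unfold theta at 1 2. rewrite E, (Czsum_parity _ A).
  (* On the diagonal 2 a + r the inner sum is a theta series in [y]. Shifting its index by [- a - r]
     removes the dependence on [a] and turns the characteristic (e - d - r)/2 into (e - d + r)/2. *)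
  assert (X : forall (a r : Z) (b : R), b = IZR r ->
    Czsum (fun m => theta_term L (IZR m + e) (x + y) * theta_term L (IZR (2 * a + r - m) + d) (x - y))%C =
    (theta_term (2 * L) (IZR a + (e + d + b) / 2) (Cscal 2 x) * theta (2 * L) ((e - d + b) / 2) (Cscal 2 y))%C).
  { intros a r b ->. unfold theta.
    assert (H := Czabs_theta (2 * L) ((e - d + IZR r) / 2) (Cscal 2 y) HL2).
    rewrite <- (Czsum_shift (- a - r) _ H), <- Czsum_scal by
      (destruct H as [H1 H2]; split;
       [exact (zabs_shift (- a - r) _ H1)|exact (zabs_shift (- a - r) _ H2)]).
    apply Czsum_ext. intros m. rewrite theta_term_mult.
    rewrite !minus_IZR, !plus_IZR, minus_IZR, opp_IZR, mult_IZR. f_equal; f_equal; field. }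
  f_equal.
  - rewrite (Czsum_ext _ (fun a => theta (2 * L) ((e - d) / 2) (Cscal 2 y) *
      theta_term (2 * L) (IZR a + (e + d) / 2) (Cscal 2 x))%C).
    + rewrite Czsum_scal by now apply Czabs_theta. apply Cmult_comm.
    + intros a. rewrite Cmult_comm. rewrite <- (Z.add_0_r (2 * a)), (X a 0%Z 0 eq_refl).
      now rewrite !Rplus_0_r.
  - rewrite (Czsum_ext _ (fun a => theta (2 * L) ((e - d + 1) / 2) (Cscal 2 y) *
      theta_term (2 * L) (IZR a + (e + d + 1) / 2) (Cscal 2 x))%C).
    + rewrite Czsum_scal by now apply Czabs_theta. apply Cmult_comm.
    + intros a. rewrite Cmult_comm. apply (X a 1%Z 1 eq_refl).
Qed.

Lemma theta_shift (L e : R) (z : C) : 0 < L -> theta L (e + 1) z = theta L e z.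
Proof.
  intros HL. unfold theta. rewrite <- (Czsum_shift 1 (fun n => theta_term L (IZR n + e) z)) by now apply Czabs_theta.
  apply Czsum_ext. intros n. f_equal. rewrite plus_IZR. ring.
Qed.

Lemma theta_opp (L e : R) (z : C) : 0 < L -> theta L e (- z) = theta L (- e) z.
Proof.
  intros HL. unfold theta. rewrite <- (Czsum_reflect 0 (fun n => theta_term L (IZR n + - e) z)) by now apply Czabs_theta.
  apply Czsum_ext. intros n. rewrite minus_IZR. unfold theta_term. f_equal; simpl; ring.
Qed.

Lemma cos_sin_2nPI (n : Z) : cos (2 * (IZR n * PI)) = 1 /\ sin (2 * (IZR n * PI)) = 0.
Proof.
  assert (H : sin (IZR n * PI) = 0) by (apply sin_eq_0_1; now exists n).
  split.
  - rewrite cos_2a_sin, H. ring.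
  - rewrite sin_2a, H. ring.
Qed.

Lemma theta_PI (L e : R) (z : C) : 0 < L ->
  theta L e (z + RtoC PI) = (cexp 0 (2 * e * PI) * theta L e z)%C.
Proof.
  intros HL. unfold theta. rewrite <- Czsum_scal by now apply Czabs_theta.
  apply Czsum_ext. intros n. unfold theta_term. rewrite cexp_mult.
  destruct (cos_sin_2nPI n) as [Hc Hs]. simpl fst; simpl snd.
  unfold cexp. replace (2 * (IZR n + e) * (fst z + PI)) with
    (2 * e * PI + 2 * (IZR n + e) * fst z + 2 * (IZR n * PI)) by ring.
  rewrite (cos_plus (_ + _)), (sin_plus (_ + _)), Hc, Hs.
  f_equal; f_equal; try f_equal; ring.
Qed.

Definition hpi : C := RtoC (PI / 2).
(** With theta_2(z + pi/2) = - theta_1(z) as definition, theta_1 and theta_4 are translates of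
    theta_2 and theta_3, so that their product formulas follow by a translation. *)
Definition th1 (L : R) (z : C) : C := (- theta L (1 / 2) (z + hpi))%C.
Definition th2 (L : R) (z : C) : C := theta L (1 / 2) z.
Definition th3 (L : R) (z : C) : C := theta L 0 z.
Definition th4 (L : R) (z : C) : C := theta L 0 (z + hpi)%C.

(** * Comparison with the one-sided series *)

(** Regroups [n] with [- n], the symmetric pairing for characteristic 0. For characteristic 1/2 the
    pairing of [zpair] is already the symmetric one. *)
Lemma zsum_sym (f : Z -> R) : zabs f ->
  zsum f = f 0%Z + Series (fun m => f (Z.of_nat (S m)) + f (- Z.of_nat (S m))%Z).
Proof.
  intros H. destruct (zabs_half f H) as [H1 H2].
  assert (K1 := ex_series_Rabs _ H1). assert (K2 := ex_series_Rabs _ H2).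
  unfold zsum, zpair. rewrite Series_plus by auto.
  rewrite Series_incr_1 by auto. change (Z.of_nat 0) with 0%Z.
  rewrite Rplus_assoc, <- Series_plus; auto.
  - f_equal. apply Series_ext. intros n. do 2 f_equal. lia.
  - now apply (ex_series_incr_1 (fun n => f (Z.of_nat n))).
Qed.

Lemma pow_m1_cos_sin (n : nat) (a : R) :
  cos (a + INR n * PI) = (-1) ^ n * cos a /\ sin (a + INR n * PI) = (-1) ^ n * sin a.
Proof.
  induction n as [|n [I1 I2]].
  - simpl. rewrite Rmult_0_l, Rplus_0_r. lra.
  - rewrite S_INR. replace (a + (INR n + 1) * PI) with (a + INR n * PI + PI) by ring.
    rewrite neg_cos, neg_sin, I1, I2. simpl. lra.
Qed.

Lemma pow_exp_sq (L : R) (n : nat) : exp (- L) ^ (n * n) = exp (- L * INR n ^ 2).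
Proof. rewrite <- exp_pow_nat, mult_INR. f_equal. ring. Qed.

Lemma Rpower_exp_sq (L c : R) : Rpower (exp (- L)) (c ^ 2) = exp (- L * c ^ 2).
Proof. unfold Rpower. rewrite ln_exp. f_equal. ring. Qed.

Lemma theta4_th4 (L : R) (z : C) : 0 < L -> theta4 (exp (- L)) z = th4 L z.
Proof.
  intros HL. destruct (Czabs_theta L 0 (z + hpi) HL) as [H1 H2].
  unfold th4, theta, Czsum. rewrite (zsum_sym _ H1), (zsum_sym _ H2).
  unfold theta4, CSeries, Cscal, Cplus, RtoC. cbn [fst snd].
  rewrite <- !Series_scal_l.
  assert (E : forall m, exp (- L * (INR (S m)) ^ 2 - 2 * INR (S m) * snd z) =
     exp (- L * INR (S m) ^ 2) * exp (- (2 * INR (S m) * snd z))).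
  { intros; rewrite <- exp_plus; f_equal; ring. }
  assert (E' : forall m, exp (- L * (- INR (S m)) ^ 2 - 2 * (- INR (S m)) * snd z) =
     exp (- L * INR (S m) ^ 2) * exp (2 * INR (S m) * snd z)).
  { intros; rewrite <- exp_plus; f_equal; ring. }
  f_equal; f_equal.
  - unfold theta_term, cexp. cbn [fst snd].
    rewrite Rplus_0_l, Rmult_0_r, !Rmult_0_l, cos_0.
    replace (- L * 0 ^ 2 - 0) with 0 by ring. rewrite exp_0. ring.
  - apply Series_ext. intros m. unfold theta_term, cexp. cbn [fst snd].
    rewrite opp_IZR, <- INR_IZR_INZ. unfold Ccos, Cmult, hpi, RtoC. cbn [fst snd].
    rewrite !Rplus_0_r, E, E', pow_exp_sq.
    replace (2 * INR (S m) * (fst z + PI / 2)) with (2 * INR (S m) * fst z + INR (S m) * PI) by field.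
    replace (2 * - INR (S m) * (fst z + PI / 2)) with (- (2 * INR (S m) * fst z + INR (S m) * PI)) by field.
    rewrite cos_neg. rewrite (proj1 (pow_m1_cos_sin _ _)).
    replace (2 * INR (S m) * fst z - 0 * snd z) with (2 * INR (S m) * fst z) by ring.
    replace (2 * INR (S m) * snd z + 0 * fst z) with (2 * INR (S m) * snd z) by ring.
    unfold cosh. field.
  - unfold theta_term, cexp. cbn [fst snd].
    rewrite Rplus_0_l, Rmult_0_r, !Rmult_0_l, sin_0. ring.
  - apply Series_ext. intros m. unfold theta_term, cexp. cbn [fst snd].
    rewrite opp_IZR, <- INR_IZR_INZ. unfold Ccos, Cmult, hpi, RtoC. cbn [fst snd].
    rewrite !Rplus_0_r, E, E', pow_exp_sq.
    replace (2 * INR (S m) * (fst z + PI / 2)) with (2 * INR (S m) * fst z + INR (S m) * PI) by field.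
    replace (2 * - INR (S m) * (fst z + PI / 2)) with (- (2 * INR (S m) * fst z + INR (S m) * PI)) by field.
    rewrite sin_neg. rewrite (proj2 (pow_m1_cos_sin _ _)).
    replace (2 * INR (S m) * fst z - 0 * snd z) with (2 * INR (S m) * fst z) by ring.
    replace (2 * INR (S m) * snd z + 0 * fst z) with (2 * INR (S m) * snd z) by ring.
    unfold sinh. field.
Qed.

Lemma theta1_th1 (L : R) (z : C) : 0 < L -> theta1 (exp (- L)) z = th1 L z.
Proof.
  intros HL. unfold th1, theta, Czsum, zsum, zpair.
  unfold theta1, CSeries, Cscal, Copp. cbn [fst snd].
  rewrite <- !Series_scal_l, <- !Series_opp.
  f_equal; apply Series_ext; intros m; unfold theta_term, cexp, Csin, Cmult, Cplus, hpi, RtoC; cbn [fst snd];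
    rewrite minus_IZR, opp_IZR, <- INR_IZR_INZ; rewrite Rpower_exp_sq, S_INR;
    replace (- INR m - 1 + 1 / 2) with (- (INR m + 1 / 2)) by field;
    replace (2 * (INR m + 1) - 1) with (2 * (INR m + 1 / 2)) by field;
    replace (INR m + 1 - 1 / 2) with (INR m + 1 / 2) by field;
    set (c := INR m + 1 / 2);
    replace (2 * c * (fst z + PI / 2)) with (PI / 2 + (2 * c * fst z + INR m * PI)) by (unfold c; field);
    replace (2 * - c * (fst z + PI / 2)) with (- (PI / 2 + (2 * c * fst z + INR m * PI))) by (unfold c; field);
    rewrite ?cos_neg, ?sin_neg;
    replace (- L * c ^ 2 - 2 * c * (snd z + 0)) with (- L * c ^ 2 + - (2 * c * snd z)) by ring;
    replace (- L * (- c) ^ 2 - 2 * - c * (snd z + 0)) with (- L * c ^ 2 + 2 * c * snd z) by ring;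
    rewrite !exp_plus;
    replace (2 * c * fst z - 0 * snd z) with (2 * c * fst z) by ring;
    replace (2 * c * snd z + 0 * fst z) with (2 * c * snd z) by ring;
    destruct (pow_m1_cos_sin m (2 * c * fst z)) as [Hc Hs];
    unfold sinh, cosh.
  - rewrite cos_plus, cos_PI2, sin_PI2, Hs. field.
  - rewrite sin_plus, cos_PI2, sin_PI2, Hc. field.
Qed.

Lemma theta3_0_th3 (L : R) : 0 < L -> RtoC (theta3_0 (exp (- L))) = th3 L 0.
Proof.
  intros HL. destruct (Czabs_theta L 0 0 HL) as [H1 H2].
  unfold th3, theta, Czsum. rewrite (zsum_sym _ H1), (zsum_sym _ H2).
  unfold theta3_0. rewrite <- Series_scal_l. unfold RtoC at 1.
  f_equal.
  - f_equal.
    + unfold theta_term, cexp. simpl fst.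
      rewrite Rplus_0_l, Rmult_0_r, !Rmult_0_l, cos_0.
      replace (- L * 0 - 0) with 0 by ring. rewrite exp_0. ring.
    + apply Series_ext. intros m. unfold theta_term, cexp.
      rewrite opp_IZR, <- INR_IZR_INZ, !Rplus_0_r, pow_exp_sq.
      cbn [fst snd RtoC]. rewrite !Rmult_0_r, cos_0.
      replace (- L * (- INR (S m)) ^ 2) with (- L * INR (S m) ^ 2) by ring. rewrite !Rminus_0_r. ring.
  - unfold theta_term, cexp. cbn [fst snd RtoC]. rewrite (Series_ext _ (fun _ => 0 * 0)).
    + rewrite Series_scal_l, Rmult_0_r, sin_0. ring.
    + intros n. rewrite !Rmult_0_r, sin_0. ring.
Qed.

Lemma theta2_0_th2 (L : R) : 0 < L -> RtoC (theta2_0 (exp (- L))) = th2 L 0.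
Proof.
  intros HL. unfold th2, theta, Czsum, zsum, zpair, theta2_0. rewrite <- Series_scal_l.
  unfold RtoC at 1. f_equal.
  - apply Series_ext. intros m. unfold theta_term, cexp.
    rewrite minus_IZR, opp_IZR, <- INR_IZR_INZ, Rpower_exp_sq, S_INR.
    cbn [fst snd RtoC]. rewrite !Rmult_0_r, cos_0, !Rminus_0_r.
    replace (- INR m - 1 + 1 / 2) with (- (INR m + 1 / 2)) by field.
    replace (INR m + 1 - 1 / 2) with (INR m + 1 / 2) by field.
    replace (- L * (- (INR m + 1 / 2)) ^ 2) with (- L * (INR m + 1 / 2) ^ 2) by ring. ring.
  - rewrite (Series_ext _ (fun _ => 0 * 0)).
    + rewrite Series_scal_l. ring.
    + intros n. unfold theta_term, cexp. cbn [fst snd RtoC]. rewrite !Rmult_0_r, sin_0. ring.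
Qed.

(** * Addition formulas *)

(* Series of nome q^2: the product formulas are bilinear in them. *)
Definition pA (L : R) (z : C) : C := theta (2 * L) 0 (Cscal 2 z).
Definition pB (L : R) (z : C) : C := theta (2 * L) (1 / 2) (Cscal 2 z).
Definition pP (L : R) (z : C) : C := theta (2 * L) (1 / 4) (Cscal 2 z).

Lemma Cscal2_hpi (z : C) : Cscal 2 (z + hpi) = (Cscal 2 z + RtoC PI)%C.
Proof. apply injective_projections; simpl; field. Qed.

Lemma Cscal2_opp (z : C) : Cscal 2 (- z) = (- Cscal 2 z)%C.
Proof. apply injective_projections; simpl; field. Qed.

Section ThetaAlgebra.
Variable L : R.
Hypothesis HL : 0 < L.
Let HL2 : 0 < 2 * L. Proof. lra. Qed.

Lemma pA_hpi z : pA L (z + hpi) = pA L z.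
Proof.
  unfold pA. rewrite Cscal2_hpi, theta_PI by exact HL2.
  replace (2 * 0 * PI) with 0 by ring. unfold cexp. rewrite exp_0, cos_0, sin_0.
  apply injective_projections; simpl; ring.
Qed.

Lemma pB_hpi z : pB L (z + hpi) = (- pB L z)%C.
Proof.
  unfold pB. rewrite Cscal2_hpi, theta_PI by exact HL2.
  replace (2 * (1 / 2) * PI) with PI by field. unfold cexp. rewrite exp_0, cos_PI, sin_PI.
  apply injective_projections; simpl; ring.
Qed.

Lemma pP_hpi z : pP L (z + hpi) = (Ci * pP L z)%C.
Proof.
  unfold pP. rewrite Cscal2_hpi, theta_PI by exact HL2.
  replace (2 * (1 / 4) * PI) with (PI / 2) by field. unfold cexp. rewrite exp_0, cos_PI2, sin_PI2.
  apply injective_projections; simpl; ring.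
Qed.

Lemma theta0_opp M z : 0 < M -> theta M 0 (- z) = theta M 0 z.
Proof. intros HM. rewrite theta_opp, Ropp_0; auto. Qed.

Lemma theta_half_opp M z : 0 < M -> theta M (1 / 2) (- z) = theta M (1 / 2) z.
Proof.
  intros HM. rewrite theta_opp, <- theta_shift by auto. f_equal. lra.
Qed.

Lemma schroeter00 x y : (th3 L (x + y) * th3 L (x - y) = pA L x * pA L y + pB L x * pB L y)%C.
Proof.
  unfold th3, pA, pB. rewrite schroeter by exact HL.
  replace ((0 + 0) / 2) with 0 by field. replace ((0 - 0) / 2) with 0 by field.
  replace ((0 + 0 + 1) / 2) with (1 / 2) by field. replace ((0 - 0 + 1) / 2) with (1 / 2) by field.
  reflexivity.
Qed.

Lemma schroeter11 x y : (th2 L (x + y) * th2 L (x - y) = pB L x * pA L y + pA L x * pB L y)%C.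
Proof.
  unfold th2, pA, pB. rewrite schroeter by exact HL.
  replace ((1 / 2 + 1 / 2) / 2) with (1 / 2) by field. replace ((1 / 2 - 1 / 2) / 2) with 0 by field.
  replace ((1 / 2 + 1 / 2 + 1) / 2) with (0 + 1) by field.
  replace ((1 / 2 - 1 / 2 + 1) / 2) with (1 / 2) by field.
  now rewrite theta_shift by exact HL2.
Qed.

(** The characteristics 1/2 and 0 have half-sum 1/4, and the odd diagonals give 3/4, which is - 1/4
    up to an integer: the same series at the opposite argument. *)
Lemma schroeter10 x y :
  (th2 L (x + y) * th3 L (x - y) = pP L x * pP L y + pP L (- x) * pP L (- y))%C.
Proof.
  unfold th2, th3, pP. rewrite schroeter by exact HL. rewrite !Cscal2_opp, !theta_opp by exact HL2.
  replace ((1 / 2 + 0) / 2) with (1 / 4) by field. replace ((1 / 2 - 0) / 2) with (1 / 4) by field.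
  replace ((1 / 2 + 0 + 1) / 2) with (- (1 / 4) + 1) by field.
  replace ((1 / 2 - 0 + 1) / 2) with (- (1 / 4) + 1) by field.
  now rewrite !theta_shift by exact HL2.
Qed.

Lemma th2_hpi z : th2 L (z + hpi) = (- th1 L z)%C.
Proof. unfold th1, th2. ring. Qed.

Lemma th3_hpi z : th3 L (z + hpi) = th4 L z.
Proof. reflexivity. Qed.

Lemma hpi_hpi z : (z + hpi + hpi = z + RtoC PI)%C.
Proof. apply injective_projections; simpl; field. Qed.

Lemma th1_hpi z : th1 L (z + hpi) = th2 L z.
Proof.
  unfold th1, th2. rewrite hpi_hpi, theta_PI by exact HL.
  replace (2 * (1 / 2) * PI) with PI by field. unfold cexp. rewrite exp_0, cos_PI, sin_PI.
  apply injective_projections; simpl; ring.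
Qed.

Lemma th4_hpi z : th4 L (z + hpi) = th3 L z.
Proof.
  unfold th4, th3. rewrite hpi_hpi, theta_PI by exact HL.
  replace (2 * 0 * PI) with 0 by ring. unfold cexp. rewrite exp_0, cos_0, sin_0.
  apply injective_projections; simpl; ring.
Qed.

Lemma th2_opp z : th2 L (- z) = th2 L z.
Proof. exact (theta_half_opp L z HL). Qed.

Lemma th3_opp z : th3 L (- z) = th3 L z.
Proof. exact (theta0_opp L z HL). Qed.

Lemma th1_opp z : th1 L (- z) = (- th1 L z)%C.
Proof.
  rewrite <- th2_hpi, <- th2_opp.
  replace (- (z + hpi))%C with (- z - hpi)%C by ring.
  rewrite <- th1_hpi. f_equal. ring.
Qed.

Lemma th4_opp z : th4 L (- z) = th4 L z.
Proof.
  rewrite <- (th3_hpi z), <- th3_opp.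
  replace (- (z + hpi))%C with (- z - hpi)%C by ring.
  rewrite <- th4_hpi. f_equal. ring.
Qed.

Lemma th1_0 : th1 L 0 = 0%C.
Proof.
  assert (H := th1_opp 0). replace (- 0)%C with (RtoC 0) in H by ring.
  replace (th1 L 0) with (/ RtoC 2 * (th1 L 0 + th1 L 0))%C.
  - rewrite H at 2. ring.
  - field.
Qed.

Lemma th4_prod x y : (th4 L (x + y) * th4 L (x - y) = pA L x * pA L y - pB L x * pB L y)%C.
Proof.
  rewrite <- !th3_hpi. replace (x + y + hpi)%C with (x + hpi + y)%C by ring.
  replace (x - y + hpi)%C with (x + hpi - y)%C by ring.
  rewrite schroeter00, pA_hpi, pB_hpi. ring.
Qed.

Lemma th1_prod x y : (th1 L (x + y) * th1 L (x - y) = pA L x * pB L y - pB L x * pA L y)%C.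
Proof.
  transitivity (th2 L (x + hpi + y) * th2 L (x + hpi - y))%C.
  - replace (x + hpi + y)%C with (x + y + hpi)%C by ring.
    replace (x + hpi - y)%C with (x - y + hpi)%C by ring.
    rewrite !th2_hpi. ring.
  - rewrite schroeter11, pA_hpi, pB_hpi. ring.
Qed.

Lemma th4_sq x : (th4 L x * th4 L x = pA L x * pA L 0 - pB L x * pB L 0)%C.
Proof. rewrite <- th4_prod. f_equal; f_equal; ring. Qed.

Lemma th1_sq x : (th1 L x * th1 L x = pA L x * pB L 0 - pB L x * pA L 0)%C.
Proof. rewrite <- th1_prod. f_equal; f_equal; ring. Qed.

Lemma th3_sq x : (th3 L x * th3 L x = pA L x * pA L 0 + pB L x * pB L 0)%C.
Proof. rewrite <- schroeter00. f_equal; f_equal; ring. Qed.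

Lemma th2_sq x : (th2 L x * th2 L x = pB L x * pA L 0 + pA L x * pB L 0)%C.
Proof. rewrite <- schroeter11. f_equal; f_equal; ring. Qed.

Lemma th1_addition x y :
  (th1 L (x + y) * th1 L (x - y) * (th4 L 0 * th4 L 0) =
   th1 L x * th1 L x * (th4 L y * th4 L y) - th4 L x * th4 L x * (th1 L y * th1 L y))%C.
Proof. rewrite th1_prod, !th4_sq, !th1_sq. ring. Qed.

Lemma th4_addition x y :
  (th4 L (x + y) * th4 L (x - y) * (th4 L 0 * th4 L 0) =
   th4 L x * th4 L x * (th4 L y * th4 L y) - th1 L x * th1 L x * (th1 L y * th1 L y))%C.
Proof. rewrite th4_prod, !th4_sq, !th1_sq. ring. Qed.

Lemma th2_quadratic x :
  (th4 L 0 * th4 L 0 * (th2 L x * th2 L x) =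
   th2 L 0 * th2 L 0 * (th4 L x * th4 L x) - th3 L 0 * th3 L 0 * (th1 L x * th1 L x))%C.
Proof. rewrite !th4_sq, !th1_sq, !th2_sq, !th3_sq. ring. Qed.

Lemma th3_quadratic x :
  (th4 L 0 * th4 L 0 * (th3 L x * th3 L x) =
   th3 L 0 * th3 L 0 * (th4 L x * th4 L x) - th2 L 0 * th2 L 0 * (th1 L x * th1 L x))%C.
Proof. rewrite !th4_sq, !th1_sq, !th2_sq, !th3_sq. ring. Qed.

(** Jacobi's quartic identity. In terms of A = [pA L 0] and B = [pB L 0] it reads (A^2 + B^2)^2 = (2
    A B)^2 + (A^2 - B^2)^2. *)
Lemma theta_constants :
  (th3 L 0 * th3 L 0 * (th3 L 0 * th3 L 0) =
   th2 L 0 * th2 L 0 * (th2 L 0 * th2 L 0) + th4 L 0 * th4 L 0 * (th4 L 0 * th4 L 0))%C.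
Proof. rewrite !th4_sq, !th2_sq, !th3_sq. ring. Qed.

Lemma pP_opp_hpi z : pP L (- (z + hpi)) = (- Ci * pP L (- z))%C.
Proof.
  replace (- z)%C with (- (z + hpi) + hpi)%C by ring. rewrite pP_hpi.
  replace (- Ci * (Ci * pP L (- (z + hpi))))%C with (- (Ci * Ci) * pP L (- (z + hpi)))%C by ring.
  replace (Ci * Ci)%C with (RtoC (-1)) by (apply injective_projections; simpl; ring).
  apply injective_projections; simpl; ring.
Qed.

Lemma th1_th4_prod u v :
  (th1 L (u + v) * th4 L (u - v) = - Ci * (pP L u * pP L v - pP L (- u) * pP L (- v)))%C.
Proof.
  transitivity (- (th2 L (u + hpi + v) * th3 L (u + hpi - v)))%C.
  - replace (u + hpi + v)%C with (u + v + hpi)%C by ring.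
    replace (u + hpi - v)%C with (u - v + hpi)%C by ring.
    rewrite th2_hpi, th3_hpi. ring.
  - rewrite schroeter10, pP_hpi, pP_opp_hpi. ring.
Qed.

Lemma th2_th3_eq u : (th2 L u * th3 L u = pP L 0 * (pP L u + pP L (- u)))%C.
Proof.
  transitivity (th2 L (u + 0) * th3 L (u - 0))%C; [f_equal; f_equal; ring|].
  rewrite schroeter10. replace (- 0)%C with (RtoC 0) by ring. ring.
Qed.

Lemma th1_th4_eq v : (th1 L v * th4 L v = - Ci * pP L 0 * (pP L v - pP L (- v)))%C.
Proof.
  transitivity (th1 L (v + 0) * th4 L (v - 0))%C; [f_equal; f_equal; ring|].
  rewrite th1_th4_prod. replace (- 0)%C with (RtoC 0) by ring. ring.
Qed.

(** Antisymmetrising [th1_th4_prod] in [v] factors it as (P(u) + P(-u)) (P(v) - P(-v)) with P =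
    [pP L]; the factors are proportional to theta_2 theta_3 at [u] and theta_1 theta_4 at [v]. It is
    the finite form of the derivative of theta_1 / theta_4. *)
Lemma th_difference u v :
  (th2 L 0 * th3 L 0 * (th1 L (u + v) * th4 L (u - v) - th4 L (u + v) * th1 L (u - v)) =
   RtoC 2 * (th2 L u * th3 L u) * (th1 L v * th4 L v))%C.
Proof.
  rewrite !th2_th3_eq, th1_th4_eq, th1_th4_prod.
  replace (th4 L (u + v) * th1 L (u - v))%C with (th1 L (u + - v) * th4 L (u - - v))%C
    by (rewrite Cmult_comm; f_equal; f_equal; ring).
  rewrite th1_th4_prod. replace (- - v)%C with v by ring. replace (- 0)%C with (RtoC 0) by ring.
  replace (RtoC 2) with (1 + 1)%C by (apply injective_projections; simpl; ring).
  ring.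
Qed.

End ThetaAlgebra.

(** * Landen's doubling formulas *)

(** The factors are theta_3 at z + pi/2 and at z, that is, at x + pi/4 and x - pi/4 with x = z +
    pi/4. One of the two products in Schroeter's formula then contains theta_1(0) = 0. *)
Lemma landen34 (L : R) (z : C) : 0 < L ->
  (th4 L z * th3 L z = th4 (2 * L) (Cscal 2 z) * th4 (2 * L) 0)%C.
Proof.
  intros HL. set (r := RtoC (PI / 4)).
  assert (Hr : (r + r = hpi)%C) by (apply injective_projections; simpl; field).
  transitivity (th3 L (z + r + r) * th3 L (z + r - r))%C.
  - rewrite <- th3_hpi, <- Hr by exact HL. f_equal; f_equal; ring.
  - rewrite schroeter00 by exact HL. unfold pA, pB, th4.
    assert (E1 : Cscal 2 (z + r) = (Cscal 2 z + hpi)%C) by (apply injective_projections; simpl; field).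
    assert (E2 : Cscal 2 r = (0 + hpi)%C) by (apply injective_projections; simpl; field).
    rewrite E1, E2.
    replace (theta (2 * L) (1 / 2) (0 + hpi)) with (- th1 (2 * L) 0)%C by (unfold th1; ring).
    rewrite th1_0 by lra. ring.
Qed.

Lemma landen12 (L : R) (z : C) : 0 < L ->
  (th1 L z * th2 L z = th1 (2 * L) (Cscal 2 z) * th4 (2 * L) 0)%C.
Proof.
  intros HL. set (r := RtoC (PI / 4)).
  assert (Hr : (r + r = hpi)%C) by (apply injective_projections; simpl; field).
  transitivity (- (th2 L (z + r + r) * th2 L (z + r - r)))%C.
  - unfold th1. change (theta L (1 / 2)) with (th2 L). rewrite <- Hr.
    replace (z + (r + r))%C with (z + r + r)%C by ring. replace (z + r - r)%C with z by ring. ring.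
  - rewrite schroeter11 by exact HL. unfold pA, pB, th1, th4.
    assert (E1 : Cscal 2 (z + r) = (Cscal 2 z + hpi)%C) by (apply injective_projections; simpl; field).
    assert (E2 : Cscal 2 r = (0 + hpi)%C) by (apply injective_projections; simpl; field).
    rewrite E1, E2.
    replace (theta (2 * L) (1 / 2) (0 + hpi)) with (- th1 (2 * L) 0)%C by (unfold th1; ring).
    rewrite th1_0 by lra. ring.
Qed.

(** * Termwise differentiation along straight lines *)

Lemma zsum_dominated {T : Type} (F : (T -> Prop) -> Prop) {FF : ProperFilter F}
  (f : T -> Z -> R) (g M : Z -> R) :
  zabs M ->
  F (fun t => forall n, Rabs (f t n) <= M n) ->
  (forall n, filterlim (fun t => f t n) F (locally (g n))) ->
  filterlim (fun t => zsum (f t)) F (locally (zsum g)).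
Proof.
  intros HM Hb Hl. unfold zsum.
  apply (Series_dominated F (fun t => zpair (f t)) (zpair g) (zpair (fun n => Rabs (M n)))).
  - exact HM.
  - apply filter_imp with (2 := Hb). intros t Ht j. eapply Rle_trans; [apply zpair_abs|].
    unfold zpair. apply Rplus_le_compat; (eapply Rle_trans; [apply Ht|apply Rle_abs]).
  - intros j. unfold zpair.
    apply (filterlim_comp_2 (G := locally (g (Z.of_nat j))) (H := locally (g (- Z.of_nat j - 1)%Z))); auto.
    apply (filterlim_plus (g (Z.of_nat j)) (g (- Z.of_nat j - 1)%Z)).
Qed.

Lemma is_derive_quotient (f : R -> R) (x l : R) :
  is_derive f x l <->
  filterlim (fun h => (f (x + h) - f x) / h) (Rbar_locally' 0) (locally l).
Proof.
  split.
  - intros H. apply is_derive_Reals in H. apply filterlim_locally. intros eps.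
    destruct (H eps (cond_pos eps)) as [d Hd]. exists d. intros h Hh Hn.
    apply Hd; auto. change (Rabs (h - 0) < d) in Hh. now rewrite Rminus_0_r in Hh.
  - intros H. apply is_derive_Reals. intros eps He.
    assert (H' := proj1 (filterlim_locally (F := Rbar_locally' 0) _ l) H (mkposreal _ He)).
    destruct H' as [d Hd]. exists d. intros h Hn Hh.
    apply (Hd h); auto. change (Rabs (h - 0) < d). now rewrite Rminus_0_r.
Qed.

Lemma MVT_bound (f df : R -> R) (x h B : R) :
  (forall t, is_derive f t (df t)) ->
  (forall t, Rabs (t - x) <= Rabs h -> Rabs (df t) <= B) ->
  Rabs (f (x + h) - f x) <= B * Rabs h.
Proof.
  intros Hd HB.
  destruct (MVT_gen f x (x + h) df) as [c [Hc E]].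
  - intros; apply Hd.
  - intros. apply derivable_continuous_pt. exists (df x0). now apply is_derive_Reals.
  - rewrite E. replace (x + h - x) with h by ring. rewrite Rabs_mult.
    apply Rmult_le_compat_r; [apply Rabs_pos|]. apply HB.
    unfold Rmin, Rmax in Hc. destruct (Rle_dec x (x + h)); unfold Rabs;
    destruct (Rcase_abs (c - x)), (Rcase_abs h); lra.
Qed.

(** Tannery's theorem on the punctured neighbourhoods of 0: the mean value theorem bounds the
    difference quotients of every term by the majorant of its derivative. *)
Lemma zsum_derive (phi dphi : Z -> R -> R) (M : Z -> R) (t0 : R) :
  (forall n t, is_derive (phi n) t (dphi n t)) ->
  (forall n t, Rabs (t - t0) <= 1 -> Rabs (dphi n t) <= M n) ->
  zabs M -> (forall t, zabs (fun n => phi n t)) ->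
  is_derive (fun t => zsum (fun n => phi n t)) t0 (zsum (fun n => dphi n t0)).
Proof.
  intros Hd HB HM Hz. apply is_derive_quotient.
  apply filterlim_ext with (fun h => zsum (fun n => / h * phi n (t0 + h) + (- / h) * phi n t0)).
  { intros h. rewrite (zsum_lin (/ h) (- / h) (fun n => phi n (t0 + h)) (fun n => phi n t0)) by apply Hz.
    unfold Rdiv. ring. }
  apply (zsum_dominated (Rbar_locally' 0)) with (M := M); auto.
  - exists (mkposreal 1 Rlt_0_1). intros h Hh Hn n.
    change (Rabs (h - 0) < 1) in Hh. rewrite Rminus_0_r in Hh.
    replace (/ h * phi n (t0 + h) + - / h * phi n t0) with ((phi n (t0 + h) - phi n t0) / h)
      by (unfold Rdiv; ring).
    unfold Rdiv. rewrite Rabs_mult.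
    assert (Hp : 0 < Rabs h) by now apply Rabs_pos_lt.
    rewrite Rabs_inv. apply Rmult_le_reg_r with (Rabs h); auto.
    rewrite Rmult_assoc, Rinv_l, Rmult_1_r by lra.
    apply MVT_bound with (dphi n); [apply Hd|]. intros t Ht. apply HB. lra.
  - intros n. specialize (Hd n t0). apply is_derive_quotient in Hd.
    apply filterlim_ext with (2 := Hd). intros h. unfold Rdiv. ring.
Qed.

(** A straight line in the complex plane with velocity a + i b. The velocities 1 and i are the ones
    used, from 0 or from pi/2. *)
Definition path (x0 y0 a b t : R) : C := (x0 + a * t, y0 + b * t).

Definition dterm_re (L x0 y0 a b c t : R) : R :=
  exp (- L * c ^ 2 - 2 * c * (y0 + b * t)) *
   (- (2 * c * b) * cos (2 * c * (x0 + a * t)) - 2 * c * a * sin (2 * c * (x0 + a * t))).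
Definition dterm_im (L x0 y0 a b c t : R) : R :=
  exp (- L * c ^ 2 - 2 * c * (y0 + b * t)) *
   (- (2 * c * b) * sin (2 * c * (x0 + a * t)) + 2 * c * a * cos (2 * c * (x0 + a * t))).

Lemma dterm_bound (L x0 y0 a b c t Y u v : R) : Rabs (y0 + b * t) <= Y ->
  Rabs u <= 1 -> Rabs v <= 1 ->
  Rabs (exp (- L * c ^ 2 - 2 * c * (y0 + b * t)) * (2 * c * b * u + 2 * c * a * v)) <=
  exp (- L * c ^ 2 + (2 * Y + 2 * Rabs a + 2 * Rabs b) * Rabs c).
Proof.
  intros HY Hu Hv. rewrite Rabs_mult, Rabs_exp.
  replace (- L * c ^ 2 + (2 * Y + 2 * Rabs a + 2 * Rabs b) * Rabs c) with
    ((- L * c ^ 2 + 2 * Y * Rabs c) + (2 * Rabs a + 2 * Rabs b) * Rabs c) by ring.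
  rewrite exp_plus. apply Rmult_le_compat; [left; apply exp_pos|apply Rabs_pos| |].
  - apply exp_le.
    assert (Rabs (c * (y0 + b * t)) <= Y * Rabs c).
    { rewrite Rabs_mult, Rmult_comm. apply Rmult_le_compat_r; auto. apply Rabs_pos. }
    generalize (Rle_abs (- (c * (y0 + b * t)))). rewrite Rabs_Ropp. lra.
  (* The linear factor in [c] produced by the derivative is absorbed into the exponential by t <= 1
     + t <= exp t. *)
  - eapply Rle_trans; [|apply exp_ineq1_le].
    assert (Rabs (2 * c * b * u + 2 * c * a * v) <= (2 * Rabs a + 2 * Rabs b) * Rabs c); [|lra].
    eapply Rle_trans; [apply Rabs_triang|]. rewrite !Rabs_mult, (Rabs_pos_eq 2) by lra.
    generalize (Rabs_pos a) (Rabs_pos b) (Rabs_pos c). intros.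
    assert (Rabs c * Rabs b * Rabs u <= Rabs c * Rabs b * 1) by (apply Rmult_le_compat_l; auto; nra).
    assert (Rabs c * Rabs a * Rabs v <= Rabs c * Rabs a * 1) by (apply Rmult_le_compat_l; auto; nra).
    nra.
Qed.

Lemma theta_path_derive (L e x0 y0 a b t0 : R) : 0 < L ->
  is_derive (fun t => fst (theta L e (path x0 y0 a b t))) t0
    (zsum (fun n => dterm_re L x0 y0 a b (IZR n + e) t0)) /\
  is_derive (fun t => snd (theta L e (path x0 y0 a b t))) t0
    (zsum (fun n => dterm_im L x0 y0 a b (IZR n + e) t0)).
Proof.
  intros HL. set (Y := Rabs y0 + Rabs b * (Rabs t0 + 1)).
  assert (HY : forall t, Rabs (t - t0) <= 1 -> Rabs (y0 + b * t) <= Y).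
  { intros t Ht. unfold Y. eapply Rle_trans; [apply Rabs_triang|]. rewrite Rabs_mult.
    apply Rplus_le_compat_l, Rmult_le_compat_l; [apply Rabs_pos|].
    replace t with (t0 + (t - t0)) by ring. eapply Rle_trans; [apply Rabs_triang|]. lra. }
  assert (HC : forall x, Rabs (cos x) <= 1) by (intros; apply Rabs_le, COS_bound).
  assert (HS : forall x, Rabs (sin x) <= 1) by (intros; apply Rabs_le, SIN_bound).
  split.
  - apply (zsum_derive (fun n t => fst (theta_term L (IZR n + e) (path x0 y0 a b t)))
      (fun n t => dterm_re L x0 y0 a b (IZR n + e) t)
      (fun n => exp (- L * (IZR n + e) ^ 2 + (2 * Y + 2 * Rabs a + 2 * Rabs b) * Rabs (IZR n + e)))).
    + intros n t. unfold theta_term, path, cexp, dterm_re; simpl fst; simpl snd.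
      auto_derive; [exact I|]. simpl pow. unfold Rminus. Rring.
    + intros n t Ht. unfold dterm_re.
      replace (- (2 * (IZR n + e) * b) * cos (2 * (IZR n + e) * (x0 + a * t)) - 2 * (IZR n + e) * a * sin (2 * (IZR n + e) * (x0 + a * t)))
        with (2 * (IZR n + e) * b * - cos (2 * (IZR n + e) * (x0 + a * t)) + 2 * (IZR n + e) * a * - sin (2 * (IZR n + e) * (x0 + a * t))) by ring.
      apply dterm_bound; auto; rewrite Rabs_Ropp; auto.
    + now apply zabs_gauss.
    + intros t. now apply (Czabs_theta L e (path x0 y0 a b t)).
  - apply (zsum_derive (fun n t => snd (theta_term L (IZR n + e) (path x0 y0 a b t)))
      (fun n t => dterm_im L x0 y0 a b (IZR n + e) t)
      (fun n => exp (- L * (IZR n + e) ^ 2 + (2 * Y + 2 * Rabs a + 2 * Rabs b) * Rabs (IZR n + e)))).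
    + intros n t. unfold theta_term, path, cexp, dterm_im; simpl fst; simpl snd.
      auto_derive; [exact I|]. simpl pow. unfold Rminus. Rring.
    + intros n t Ht. unfold dterm_im.
      replace (- (2 * (IZR n + e) * b) * sin (2 * (IZR n + e) * (x0 + a * t)))
        with (2 * (IZR n + e) * b * - sin (2 * (IZR n + e) * (x0 + a * t))) by ring.
      apply dterm_bound; auto; rewrite Rabs_Ropp; auto.
    + now apply zabs_gauss.
    + intros t. now apply (Czabs_theta L e (path x0 y0 a b t)).
Qed.

(** * Reality on the axes *)

Lemma theta_conj (L e : R) (z : C) : 0 < L ->
  theta L e (Cconj z) = Cconj (theta L (- e) z).
Proof.
  intros HL. unfold theta.
  rewrite <- (Czsum_reflect 0 (fun n => theta_term L (IZR n + - e) z)) by now apply Czabs_theta.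
  apply injective_projections.
  - change (zsum (fun n => fst (theta_term L (IZR n + e) (Cconj z))) =
      zsum (fun n => fst (theta_term L (IZR (0 - n) + - e) z))).
    apply zsum_ext. intros n. rewrite minus_IZR. unfold theta_term, cexp, Cconj. cbn [fst snd].
    replace (2 * (0 - IZR n + - e) * fst z) with (- (2 * (IZR n + e) * fst z)) by ring.
    rewrite cos_neg. f_equal. f_equal. ring.
  - change (zsum (fun n => snd (theta_term L (IZR n + e) (Cconj z))) =
      - zsum (fun n => snd (theta_term L (IZR (0 - n) + - e) z))).
    rewrite <- (Rmult_1_l (zsum (fun n => snd (theta_term L (IZR (0 - n) + - e) z)))), Ropp_mult_distr_l, <- zsum_scal.
    apply zsum_ext. intros n. rewrite minus_IZR. unfold theta_term, cexp, Cconj. cbn [fst snd].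
    replace (2 * (0 - IZR n + - e) * fst z) with (- (2 * (IZR n + e) * fst z)) by ring.
    rewrite sin_neg.
    replace (- L * (0 - IZR n + - e) ^ 2 - 2 * (0 - IZR n + - e) * snd z) with
      (- L * (IZR n + e) ^ 2 - 2 * (IZR n + e) * - snd z) by ring. ring.
Qed.

Lemma Cconj_hpi z : (Cconj z + hpi)%C = Cconj (z + hpi).
Proof. apply injective_projections; simpl; ring. Qed.

Lemma th_conj (L : R) (z : C) : 0 < L ->
  th1 L (Cconj z) = Cconj (th1 L z) /\ th2 L (Cconj z) = Cconj (th2 L z) /\
  th3 L (Cconj z) = Cconj (th3 L z) /\ th4 L (Cconj z) = Cconj (th4 L z).
Proof.
  intros HL. unfold th1, th2, th3, th4. rewrite Cconj_hpi, !theta_conj, Ropp_0 by exact HL.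
  replace (- (1 / 2)) with (1 / 2 - 1) by field.
  assert (E : forall w, theta L (1 / 2 - 1) w = theta L (1 / 2) w).
  { intros w. rewrite <- theta_shift by exact HL. f_equal. ring. }
  rewrite !E. repeat split.
Qed.

(* On the imaginary axis theta_1 is purely imaginary and the others are real, hence [snd] in [i1]. *)
Definition t1 L x := fst (th1 L (x, 0)).
Definition t2 L x := fst (th2 L (x, 0)).
Definition t3 L x := fst (th3 L (x, 0)).
Definition t4 L x := fst (th4 L (x, 0)).
Definition i1 L y := snd (th1 L (0, y)).
Definition i2 L y := fst (th2 L (0, y)).
Definition i3 L y := fst (th3 L (0, y)).
Definition i4 L y := fst (th4 L (0, y)).

Lemma conj_fixed (w : C) : w = Cconj w -> w = RtoC (fst w).
Proof. destruct w as [a b]. intros H. injection H. intros. unfold RtoC; simpl; f_equal; lra. Qed.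

Lemma th_real (L x : R) : 0 < L ->
  th1 L (x, 0) = RtoC (t1 L x) /\ th2 L (x, 0) = RtoC (t2 L x) /\
  th3 L (x, 0) = RtoC (t3 L x) /\ th4 L (x, 0) = RtoC (t4 L x).
Proof.
  intros HL. destruct (th_conj L (x, 0) HL) as [H1 [H2 [H3 H4]]].
  replace (Cconj (x, 0)) with ((x, 0) : C) in * by (apply injective_projections; simpl; ring).
  repeat split; now apply conj_fixed.
Qed.

Lemma th_imag (L y : R) : 0 < L ->
  th1 L (0, y) = (0, i1 L y) /\ th2 L (0, y) = RtoC (i2 L y) /\
  th3 L (0, y) = RtoC (i3 L y) /\ th4 L (0, y) = RtoC (i4 L y).
Proof.
  intros HL. destruct (th_conj L (0, y) HL) as [H1 [H2 [H3 H4]]].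
  replace (Cconj (0, y)) with (- (0, y))%C in * by (apply injective_projections; simpl; ring).
  rewrite th1_opp in H1 by exact HL. rewrite th2_opp in H2 by exact HL.
  rewrite th3_opp in H3 by exact HL. rewrite th4_opp in H4 by exact HL.
  repeat split; try now apply conj_fixed.
  unfold i1. destruct (th1 L (0, y)) as [a b]. injection H1. intros H. simpl. f_equal. lra.
Qed.

(** * Zeros *)

Lemma INR_sq_ge (n : nat) : INR n <= INR n ^ 2.
Proof.
  simpl pow. rewrite Rmult_1_r, <- mult_INR. apply le_INR. nia.
Qed.

(** The term n = 0 equals 1, and by n <= n^2 the others are bounded by the geometric sum 2 r / (1 -
    r), which is below 1 precisely for r < 1/3. *)
Lemma theta0_pos (M : R) (z : C) : 0 < M -> exp (- (M - 2 * Rabs (snd z))) < 1 / 3 ->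
  0 < fst (theta M 0 z).
Proof.
  intros HM Hr. set (r := exp (- (M - 2 * Rabs (snd z)))) in *.
  assert (Hr0 : 0 < r) by apply exp_pos.
  destruct (Czabs_theta M 0 z HM) as [H1 _].
  unfold theta, Czsum. cbn [fst]. rewrite (zsum_sym _ H1).
  assert (E0 : fst (theta_term M (0 + 0) z) = 1).
  { unfold theta_term, cexp; cbn [fst]. rewrite Rplus_0_l, Rmult_0_r, !Rmult_0_l, cos_0.
    replace (- M * 0 ^ 2 - 0) with 0 by ring. rewrite exp_0. ring. }
  rewrite E0.
  assert (G : ex_series (fun m => 2 * r * r ^ m)).
  { apply (ex_series_scal_l (2 * r) (fun m => r ^ m)). apply ex_series_geom. rewrite Rabs_pos_eq; lra. }
  assert (B : forall k : R, forall m, Rabs k = INR (S m) -> Rabs (fst (theta_term M (k + 0) z)) <= r * r ^ m).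
  { intros k m Hk. eapply Rle_trans; [apply theta_term_bound|].
    rewrite Rplus_0_r. change (r * r ^ m) with (r ^ S m). unfold r. rewrite <- exp_pow_nat.
    apply exp_le. rewrite Hk, <- (pow2_abs k), Hk.
    generalize (INR_sq_ge (S m)). nra. }
  assert (Bs : forall m, Rabs (fst (theta_term M (IZR (Z.of_nat (S m)) + 0) z) +
       fst (theta_term M (IZR (- Z.of_nat (S m)) + 0) z)) <= 2 * r * r ^ m).
  { intros m. eapply Rle_trans; [apply Rabs_triang|].
    rewrite opp_IZR, <- INR_IZR_INZ.
    assert (P : 0 <= INR (S m)) by apply pos_INR.
    generalize (B (INR (S m)) m (Rabs_pos_eq _ P)) (B (- INR (S m)) m).
    rewrite Rabs_Ropp, (Rabs_pos_eq (INR (S m)) P). intros X1 X2. specialize (X2 eq_refl). lra. }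
  destruct (ex_series_bound _ _ G Bs) as [A1 A2].
  assert (Hs : Rabs (Series (fun m => fst (theta_term M (IZR (Z.of_nat (S m)) + 0) z) +
       fst (theta_term M (IZR (- Z.of_nat (S m)) + 0) z))) <= 2 * r * / (1 - r)).
  { eapply Rle_trans; [apply Series_Rabs; auto|].
    rewrite <- Series_geom by (rewrite Rabs_pos_eq; lra). rewrite <- Series_scal_l.
    apply Series_le; auto. intros n; split; [apply Rabs_pos|apply Bs]. }
  assert (2 * r * / (1 - r) < 1).
  { apply Rmult_lt_reg_r with (1 - r); [lra|]. rewrite Rmult_assoc, Rinv_l by lra. lra. }
  apply Rabs_le_between in Hs. lra.
Qed.

(** The argument is doubled before the recursive call, to match inductions that replace (L, z) by (2
    L, 2 z). *)
Fixpoint dbl (n : nat) (z : C) : C := match n with O => z | S n => dbl n (Cscal 2 z) end.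

Lemma snd_dbl n z : snd (dbl n z) = 2 ^ n * snd z.
Proof. revert z. induction n as [|n IH]; intros z; simpl; [ring|]. rewrite IH. simpl. ring. Qed.

Lemma pow2_ge_INR n : INR n < 2 ^ n.
Proof.
  induction n as [|n IH]; [simpl; lra|]. rewrite S_INR. simpl.
  assert (1 <= 2 ^ n) by (apply pow_R1_Rle; lra). lra.
Qed.

Lemma pow2_large (x : R) : exists n, x < 2 ^ n.
Proof.
  destruct (INR_unbounded x) as [n Hn]. exists n.
  generalize (pow2_ge_INR n). lra.
Qed.

Lemma exp_m2_lt : exp (-2) < 1 / 3.
Proof.
  replace (-2) with (- (1 + 1)) by ring. rewrite exp_Ropp, exp_plus.
  assert (1 + 1 <= exp 1) by apply exp_ineq1_le.
  replace (1 / 3) with (/ 3) by field. apply Rinv_lt_contravar; nra.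
Qed.

(** [L] and Im z double together, so the gap L - 2 |Im z| grows like 2^n once it is positive; past 2
    the bound exp(-2) < 1/3 applies. *)
Lemma th4_dbl_eventually (L : R) (z : C) : 0 < L -> 2 * Rabs (snd z) < L ->
  exists n, th4 (2 ^ n * L) (dbl n z) <> 0%C.
Proof.
  intros HL Hz. destruct (pow2_large (2 / (L - 2 * Rabs (snd z)))) as [n Hn]. exists n.
  assert (H2 : 0 < 2 ^ n) by (apply pow_lt; lra).
  intros E. assert (P : 0 < fst (th4 (2 ^ n * L) (dbl n z))); [|rewrite E in P; simpl in P; lra].
  apply (theta0_pos (2 ^ n * L) (dbl n z + hpi)%C); [nra|]. apply Rle_lt_trans with (2 := exp_m2_lt). apply exp_le.
  simpl snd. rewrite Rplus_0_r, snd_dbl, Rabs_mult, (Rabs_pos_eq (2 ^ n)) by lra.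
  apply (Rmult_lt_compat_r (L - 2 * Rabs (snd z))) in Hn; [|lra].
  unfold Rdiv in Hn. rewrite Rmult_assoc, Rinv_l in Hn by lra. lra.
Qed.

Lemma Cscal2_0 : Cscal 2 0 = 0%C.
Proof. apply injective_projections; simpl; ring. Qed.

Lemma dbl_0 n : dbl n 0 = 0%C.
Proof. induction n as [|n IH]; [reflexivity|]. simpl. now rewrite Cscal2_0. Qed.

Lemma Cmult_eq_0 (x y : C) : (x * y = 0)%C -> x = 0%C \/ y = 0%C.
Proof.
  intros H. destruct (Ceq_dec x 0) as [|Hx]; [now left|]. right.
  replace y with (/ x * (x * y))%C by (field; auto). rewrite H. ring.
Qed.

(** Precedes [th4_ne0] because Landen's formula carries the factor theta_4(0 | q^2). At z = 0 both
    factors on its right-hand side coincide, so the zero is passed on in any case. *)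
Lemma th4_0_ne0 (L : R) : 0 < L -> th4 L 0 <> 0%C.
Proof.
  intros HL H. destruct (th4_dbl_eventually L 0 HL) as [n Hn].
  { simpl. rewrite Rabs_R0. lra. }
  rewrite dbl_0 in Hn. apply Hn. clear Hn.
  revert L HL H. induction n as [|n IH]; intros L HL H; [now rewrite Rmult_1_l|].
  replace (2 ^ S n * L) with (2 ^ n * (2 * L)) by (simpl; ring). apply IH; [lra|].
  assert (E := landen34 L 0 HL). rewrite H, Cscal2_0 in E.
  destruct (Cmult_eq_0 (th4 (2 * L) 0) (th4 (2 * L) 0)); auto. rewrite <- E. ring.
Qed.

Lemma th4_ne0 (L : R) (z : C) : 0 < L -> 2 * Rabs (snd z) < L -> th4 L z <> 0%C.
Proof.
  intros HL Hz H. destruct (th4_dbl_eventually L z HL Hz) as [n Hn]. apply Hn. clear Hn Hz.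
  revert L z HL H. induction n as [|n IH]; intros L z HL H; [now rewrite Rmult_1_l|].
  replace (2 ^ S n * L) with (2 ^ n * (2 * L)) by (simpl; ring). apply IH; [lra|].
  assert (E := landen34 L z HL). rewrite H in E.
  destruct (Cmult_eq_0 (th4 (2 * L) (Cscal 2 z)) (th4 (2 * L) 0)); auto.
  - rewrite <- E. ring.
  - exfalso. apply (th4_0_ne0 (2 * L)); auto. lra.
Qed.

(** At i L / 2 the exponent is - L (n^2 + n), invariant under n -> - n - 1, while the sign (-1)^n
    changes: each pair cancels. *)
Lemma i4_half (L : R) : 0 < L -> i4 L (L / 2) = 0.
Proof.
  intros HL. unfold i4, th4, theta, Czsum. cbn [fst].
  transitivity (Series (fun _ => 0 * 0)); [|rewrite Series_scal_l; ring].
  apply Series_ext. intros n. unfold zpair, theta_term, cexp, hpi, Cplus, RtoC. cbn [fst snd].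
  rewrite minus_IZR, opp_IZR, <- INR_IZR_INZ.
  replace (- L * (- INR n - 1 + 0) ^ 2 - 2 * (- INR n - 1 + 0) * (L / 2 + 0)) with
    (- L * (INR n + 0) ^ 2 - 2 * (INR n + 0) * (L / 2 + 0)) by field.
  replace (2 * (INR n + 0) * (0 + PI / 2)) with (0 + INR n * PI) by field.
  replace (2 * (- INR n - 1 + 0) * (0 + PI / 2)) with (- (0 + INR (S n) * PI)) by (rewrite S_INR; field).
  rewrite cos_neg, !(proj1 (pow_m1_cos_sin _ _)). simpl. ring.
Qed.

Lemma is_derive_continuity_pt (f : R -> R) (x l : R) : is_derive f x l -> continuity_pt f x.
Proof. intros H. apply derivable_continuous_pt. exists l. now apply is_derive_Reals. Qed.

Lemma pos_of_ne0 (f : R -> R) (a b x0 : R) :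
  (forall x, a < x < b -> continuity_pt f x) -> (forall x, a < x < b -> f x <> 0) ->
  a < x0 < b -> 0 < f x0 -> forall x, a < x < b -> 0 < f x.
Proof.
  intros Hc Hn Hx0 Hf x Hx. destruct (Rlt_le_dec 0 (f x)) as [|Hle]; auto. exfalso.
  assert (Hlt : f x < 0) by (generalize (Hn x Hx); lra).
  assert (W : forall g u v, (forall t, u <= t <= v -> continuity_pt g t) -> u < v ->
     g u < 0 -> 0 < g v -> exists z, u <= z <= v /\ g z = 0).
  { intros g u v Hg Huv H1 H2. destruct (IVT_interv g u v Hg Huv H1 H2) as [z Hz]. now exists z. }
  destruct (Rtotal_order x x0) as [H|[H|H]].
  - destruct (W f x x0) as [z [Hz E]]; auto.
    + intros; apply Hc; lra.
    + apply (Hn z); auto; lra.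
  - subst; lra.
  - destruct (W (fun t => - f t) x0 x) as [z [Hz E]]; try lra.
    + intros; apply (continuity_pt_opp f); apply Hc; lra.
    + apply (Hn z); lra.
Qed.

Lemma zsum_pos (f : Z -> R) : zabs f -> (forall n, 0 < f n) -> 0 < zsum f.
Proof.
  intros H Hp. apply Rlt_le_trans with (sum_n (zpair f) 0).
  - rewrite sum_n_0R. unfold zpair. apply Rplus_lt_0_compat; apply Hp.
  - apply Series_partial_le; [|now apply zabs_ex].
    intros n. unfold zpair. left. apply Rplus_lt_0_compat; apply Hp.
Qed.

Lemma theta_imag_pos (L e y : R) : 0 < L -> 0 < fst (theta L e (0, y)).
Proof.
  intros HL. apply zsum_pos; [apply (Czabs_theta L e (0, y) HL)|].
  intros n. unfold theta_term, cexp. cbn [fst snd]. rewrite Rmult_0_r, cos_0, Rmult_1_r. apply exp_pos.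
Qed.

Lemma i2_pos (L y : R) : 0 < L -> 0 < i2 L y.
Proof. exact (theta_imag_pos L (1 / 2) y). Qed.

Lemma i3_pos (L y : R) : 0 < L -> 0 < i3 L y.
Proof. exact (theta_imag_pos L 0 y). Qed.

(** * Zeros of theta_1 on the real axis *)

Lemma t1_series (L x : R) : 0 < L ->
  t1 L x = 2 * Series (fun m => (-1) ^ m * exp (- L * (INR m + 1 / 2) ^ 2) * sin ((2 * INR m + 1) * x)).
Proof.
  intros HL. unfold t1. rewrite <- theta1_th1 by exact HL.
  unfold theta1, CSeries, Cscal. cbn [fst]. f_equal. apply Series_ext. intros m.
  rewrite S_INR. replace (INR m + 1 - 1 / 2) with (INR m + 1 / 2) by field. rewrite Rpower_exp_sq.
  unfold Csin, Cmult, RtoC. cbn [fst snd].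
  replace ((2 * (INR m + 1) - 1) * x - 0 * 0) with ((2 * INR m + 1) * x) by ring.
  replace ((2 * (INR m + 1) - 1) * 0 + 0 * x) with 0 by ring. rewrite cosh_0. ring.
Qed.

Lemma sin_mult_bound (n : nat) (x : R) : Rabs (sin (INR n * x)) <= INR n * Rabs (sin x).
Proof.
  induction n as [|n IH]; [simpl; rewrite !Rmult_0_l, sin_0, Rabs_R0; lra|].
  rewrite S_INR, Rmult_plus_distr_r, Rmult_1_l, sin_plus.
  eapply Rle_trans; [apply Rabs_triang|]. rewrite !Rabs_mult.
  assert (Rabs (cos x) <= 1) by apply Rabs_le, COS_bound.
  assert (Rabs (cos (INR n * x)) <= 1) by apply Rabs_le, COS_bound.
  generalize (Rabs_pos (sin x)) (Rabs_pos (sin (INR n * x))). intros. nra.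
Qed.

(** By |sin (n x)| <= n |sin x| every term is compared with the first one up to the common factor
    |sin x|, so the estimate does not degenerate near the zeros of sin. *)
Lemma t1_ne0_large (M x : R) : 2 <= M -> sin x <> 0 -> t1 M x <> 0.
Proof.
  intros HM Hx. rewrite t1_series by lra.
  set (a := fun m : nat => (-1) ^ m * exp (- M * (INR m + 1 / 2) ^ 2) * sin ((2 * INR m + 1) * x)).
  set (E0 := exp (- M / 4)). set (r := exp (-2)). assert (Hr : r < 1 / 3) by apply exp_m2_lt.
  assert (Hr0 : 0 < r) by apply exp_pos. assert (HE : 0 < E0) by apply exp_pos.
  assert (Hs : 0 < Rabs (sin x)) by now apply Rabs_pos_lt.
  assert (B : forall m, Rabs (a m) <= E0 * Rabs (sin x) * r ^ m).
  { intros m. unfold a. rewrite !Rabs_mult, <- RPow_abs, Rabs_exp.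
    replace (Rabs (-1)) with 1 by (rewrite Rabs_left; lra). rewrite pow1, Rmult_1_l.
    assert (S1 := sin_mult_bound (2 * m + 1) x). rewrite plus_INR, mult_INR in S1. simpl (INR 2) in S1. simpl (INR 1) in S1.
    replace (1 + 1) with 2 in S1 by ring.
    (* The weight 2 m + 1 is at most exp(2 m); since M >= 2 and m^2 >= m, the Gaussian factor still
       leaves exp(- 2 m). *)
    assert (X : exp (- M * (INR m + 1 / 2) ^ 2) * (2 * INR m + 1) <= E0 * r ^ m).
    { unfold E0, r. rewrite <- exp_pow_nat, <- exp_plus.
      apply Rle_trans with (exp (- M * (INR m + 1 / 2) ^ 2) * exp (2 * INR m)).
      - apply Rmult_le_compat_l; [left; apply exp_pos|]. rewrite Rplus_comm. apply exp_ineq1_le.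
      - rewrite <- exp_plus. apply exp_le. generalize (INR_sq_ge m) (pos_INR m). intros. nra. }
    apply Rle_trans with (exp (- M * (INR m + 1 / 2) ^ 2) * ((2 * INR m + 1) * Rabs (sin x))).
    - apply Rmult_le_compat_l; [left; apply exp_pos|exact S1].
    - rewrite <- Rmult_assoc. replace (E0 * Rabs (sin x) * r ^ m) with (E0 * r ^ m * Rabs (sin x)) by ring.
      apply Rmult_le_compat_r; lra. }
  assert (G : ex_series (fun m => E0 * Rabs (sin x) * r ^ m)).
  { apply (ex_series_scal_l (E0 * Rabs (sin x)) (fun m => r ^ m)). apply ex_series_geom. rewrite Rabs_pos_eq; lra. }
  assert (T := Series_split_bound a _ 0 G B). rewrite sum_n_0R in T.
  assert (Ts : Series (fun k => E0 * Rabs (sin x) * r ^ (1 + k)) = E0 * Rabs (sin x) * r * / (1 - r)).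
  { rewrite <- Series_geom by (rewrite Rabs_pos_eq; lra). rewrite <- Series_scal_l.
    apply Series_ext. intros n. simpl. ring. }
  rewrite Ts in T.
  assert (Hi : r * / (1 - r) < 1).
  { apply Rmult_lt_reg_r with (1 - r); [lra|]. rewrite Rmult_assoc, Rinv_l by lra. lra. }
  assert (Hi0 : 0 < / (1 - r)) by (apply Rinv_0_lt_compat; lra).
  assert (A0 : a 0%nat = E0 * sin x).
  { unfold a, E0. simpl. replace (- M * ((0 + 1 / 2) * ((0 + 1 / 2) * 1))) with (- M / 4) by field.
    replace ((2 * 0 + 1) * x) with x by ring. ring. }
  rewrite A0 in T.
  rewrite (Rabs_pos_eq (E0 * Rabs (sin x) * r * / (1 - r))) in T.
  2: { apply Rmult_le_pos; [|lra]. apply Rmult_le_pos; [|lra]. nra. }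
  intros E. assert (E' : Series a = 0) by lra. rewrite E' in T.
  rewrite Rminus_0_l, Rabs_Ropp, Rabs_mult, (Rabs_pos_eq E0) in T by lra.
  assert (0 < E0 * Rabs (sin x)) by nra. nra.
Qed.

Lemma sin_odd_mult (m : nat) (x : R) : cos x = 0 -> sin ((2 * INR m + 1) * x) = (-1) ^ m * sin x.
Proof.
  intros Hc. induction m as [|m IH]; [simpl; rewrite Rmult_0_r, Rplus_0_l, !Rmult_1_l; reflexivity|].
  rewrite S_INR. replace ((2 * (INR m + 1) + 1) * x) with ((2 * INR m + 1) * x + 2 * x) by ring.
  rewrite sin_plus, IH, cos_2a_sin, sin_2a, Hc. simpl.
  assert (S2 := sin2_cos2 x). unfold Rsqr in S2. rewrite Hc in S2.
  replace (1 - 2 * sin x * sin x) with (1 - 2 * (sin x * sin x)) by ring.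
  replace (sin x * sin x) with 1 by lra. ring.
Qed.

Lemma t2_0_series (L : R) : 0 < L -> t2 L 0 = 2 * Series (fun m => exp (- L * (INR m + 1 / 2) ^ 2)).
Proof.
  intros HL. unfold t2. change (0, 0) with (RtoC 0). rewrite <- theta2_0_th2 by exact HL. simpl fst.
  unfold theta2_0. f_equal. apply Series_ext. intros m. rewrite S_INR.
  replace (INR m + 1 - 1 / 2) with (INR m + 1 / 2) by field. apply Rpower_exp_sq.
Qed.

(** Covers the points where doubling breaks down: cos x = 0 makes sin (2 x) vanish. There the signs
    (-1)^m of the series and of the sines cancel, leaving theta_2(0) up to sign. *)
Lemma t1_cos0 (L x : R) : 0 < L -> cos x = 0 -> t1 L x = sin x * t2 L 0.
Proof.
  intros HL Hc. rewrite t1_series, t2_0_series by exact HL.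
  rewrite <- Rmult_assoc, (Rmult_comm (sin x)), Rmult_assoc, <- (Series_scal_l (sin x)). f_equal.
  apply Series_ext. intros m. rewrite sin_odd_mult by exact Hc.
  replace ((-1) ^ m * exp (- L * (INR m + 1 / 2) ^ 2) * ((-1) ^ m * sin x)) with
   (((-1) ^ m * (-1) ^ m) * (exp (- L * (INR m + 1 / 2) ^ 2) * sin x)) by ring.
  rewrite <- Rpow_mult_distr. replace (-1 * -1) with 1 by ring. rewrite pow1. ring.
Qed.

Lemma t2_0_pos (L : R) : 0 < L -> 0 < t2 L 0.
Proof. exact (i2_pos L 0). Qed.

Lemma t3_0_pos (L : R) : 0 < L -> 0 < t3 L 0.
Proof. exact (i3_pos L 0). Qed.

Lemma t1_dbl (L x : R) : 0 < L -> t1 L x = 0 -> t1 (2 * L) (2 * x) = 0.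
Proof.
  intros HL H. destruct (th_real L x HL) as [R1 [R2 _]].
  assert (E := landen12 L (x, 0) HL). rewrite R1, H in E.
  destruct (Cmult_eq_0 (th1 (2 * L) (Cscal 2 (x, 0))) (th4 (2 * L) 0)) as [K|K].
  - rewrite <- E. ring.
  - replace (Cscal 2 (x, 0)) with ((2 * x, 0) : C) in K by (apply injective_projections; simpl; ring).
    unfold t1. now rewrite K.
  - exfalso. apply (th4_0_ne0 (2 * L)); auto. lra.
Qed.

Lemma t1_ne0 (L x : R) : 0 < L -> sin x <> 0 -> t1 L x <> 0.
Proof.
  intros HL Hx H. destruct (pow2_large (2 / L)) as [n Hn].
  assert (HM : 2 <= 2 ^ n * L).
  { apply (Rmult_lt_compat_r L) in Hn; auto. unfold Rdiv in Hn. rewrite Rmult_assoc, Rinv_l in Hn; lra. }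
  clear Hn. revert L x HL Hx H HM. induction n as [|n IH]; intros L x HL Hx H HM.
  - simpl in HM. apply (t1_ne0_large L x); auto. lra.
  - destruct (Req_dec (cos x) 0) as [Hc|Hc].
    + rewrite t1_cos0 in H by auto. generalize (t2_0_pos L HL). intros.
      apply Rmult_integral in H. lra.
    + apply (IH (2 * L) (2 * x)).
      * lra.
      * rewrite sin_2a. apply Rmult_integral_contrapositive_currified; [|exact Hc]. lra.
      * now apply t1_dbl.
      * simpl in HM. lra.
Qed.

Lemma pair_plus (a b c d : R) : ((a, b) + (c, d))%C = (a + c, b + d).
Proof. reflexivity. Qed.

Lemma pair_minus (a b c d : R) : ((a, b) - (c, d))%C = (a - c, b - d).
Proof. reflexivity. Qed.

Lemma real_plus_hpi (x : R) : ((x, 0) + hpi)%C = (x + PI / 2, 0).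
Proof. apply injective_projections; simpl; ring. Qed.

Lemma t_shift (L x : R) : 0 < L ->
  t1 L (x + PI / 2) = t2 L x /\ t2 L (x + PI / 2) = - t1 L x /\
  t3 L (x + PI / 2) = t4 L x /\ t4 L (x + PI / 2) = t3 L x.
Proof.
  intros HL. unfold t1, t2, t3, t4. rewrite <- real_plus_hpi.
  rewrite th1_hpi, th2_hpi, th3_hpi, th4_hpi by exact HL. repeat split.
Qed.

(** * Differentiability along the axes *)

(** This is theta_1'(0); the sign and the base point pi/2 come from the definition of [th1]. *)
Definition thD (L : R) : R := - zsum (fun n => dterm_re L (PI / 2) 0 1 0 (IZR n + 1 / 2) 0).

Lemma t1_derive_0 (L : R) : 0 < L -> is_derive (t1 L) 0 (thD L).
Proof.
  intros HL. destruct (theta_path_derive L (1 / 2) (PI / 2) 0 1 0 0 HL) as [H _].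
  apply is_derive_ext with (fun t => - fst (theta L (1 / 2) (path (PI / 2) 0 1 0 t))).
  - intros t. change (- fst (theta L (1 / 2) (path (PI / 2) 0 1 0 t)) =
      - fst (theta L (1 / 2) ((t, 0) + hpi))).
    do 3 f_equal. apply injective_projections; simpl; ring.
  - exact (is_derive_opp _ _ _ H).
Qed.

(** A Cauchy-Riemann equation at 0, checked term by term. The same constant on both axes makes [lam]
    common to K and K', so that it drops out of K'/K. *)
Lemma i1_derive_0 (L : R) : 0 < L -> is_derive (i1 L) 0 (thD L).
Proof.
  intros HL. destruct (theta_path_derive L (1 / 2) (PI / 2) 0 0 1 0 HL) as [_ H].
  apply is_derive_ext with (fun t => - snd (theta L (1 / 2) (path (PI / 2) 0 0 1 t))).
  - intros t. change (- snd (theta L (1 / 2) (path (PI / 2) 0 0 1 t)) =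
      - snd (theta L (1 / 2) ((0, t) + hpi))).
    do 3 f_equal. apply injective_projections; simpl; ring.
  - replace (thD L) with (opp (zsum (fun n => dterm_im L (PI / 2) 0 0 1 (IZR n + 1 / 2) 0))).
    + exact (is_derive_opp _ _ _ H).
    + unfold thD, opp; simpl. f_equal. apply zsum_ext. intros n. unfold dterm_re, dterm_im.
      replace (0 + 1 * 0) with 0 by ring. replace (0 + 0 * 0) with 0 by ring.
      replace (PI / 2 + 1 * 0) with (PI / 2 + 0 * 0) by ring. ring.
Qed.

Lemma ex_derive_axis (L e x0 y0 a b x : R) (f : R -> R) : 0 < L ->
  (forall t, f t = fst (theta L e (path x0 y0 a b t))) \/
  (forall t, f t = - fst (theta L e (path x0 y0 a b t))) \/
  (forall t, f t = - snd (theta L e (path x0 y0 a b t))) ->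
  ex_derive f x.
Proof.
  intros HL H. destruct (theta_path_derive L e x0 y0 a b x HL) as [H1 H2].
  destruct H as [H|[H|H]].
  - eexists. apply is_derive_ext with (1 := fun t => eq_sym (H t)). exact H1.
  - eexists. apply is_derive_ext with (1 := fun t => eq_sym (H t)). exact (is_derive_opp _ _ _ H1).
  - eexists. apply is_derive_ext with (1 := fun t => eq_sym (H t)). exact (is_derive_opp _ _ _ H2).
Qed.

Lemma t_ex_derive (L x : R) : 0 < L ->
  ex_derive (t1 L) x /\ ex_derive (t2 L) x /\ ex_derive (t3 L) x /\ ex_derive (t4 L) x.
Proof.
  intros HL. split; [|split; [|split]].
  - apply (ex_derive_axis L (1 / 2) (PI / 2) 0 1 0); auto. right; left. intros t.
    change (- fst (theta L (1 / 2) ((t, 0) + hpi)) = - fst (theta L (1 / 2) (path (PI / 2) 0 1 0 t))).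
    do 3 f_equal. apply injective_projections; simpl; ring.
  - apply (ex_derive_axis L (1 / 2) 0 0 1 0); auto. left. intros t.
    unfold t2, th2, path. do 2 f_equal. apply injective_projections; simpl; ring.
  - apply (ex_derive_axis L 0 0 0 1 0); auto. left. intros t.
    unfold t3, th3, path. do 2 f_equal. apply injective_projections; simpl; ring.
  - apply (ex_derive_axis L 0 (PI / 2) 0 1 0); auto. left. intros t.
    unfold t4, th4, path, hpi. do 2 f_equal. apply injective_projections; simpl; ring.
Qed.

Lemma i_ex_derive (L x : R) : 0 < L ->
  ex_derive (i1 L) x /\ ex_derive (i2 L) x /\ ex_derive (i3 L) x /\ ex_derive (i4 L) x.
Proof.
  intros HL. split; [|split; [|split]].
  - apply (ex_derive_axis L (1 / 2) (PI / 2) 0 0 1); auto. right; right. intros t.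
    change (- snd (theta L (1 / 2) ((0, t) + hpi)) = - snd (theta L (1 / 2) (path (PI / 2) 0 0 1 t))).
    do 3 f_equal. apply injective_projections; simpl; ring.
  - apply (ex_derive_axis L (1 / 2) 0 0 0 1); auto. left. intros t.
    unfold i2, th2, path. do 2 f_equal. apply injective_projections; simpl; ring.
  - apply (ex_derive_axis L 0 0 0 0 1); auto. left. intros t.
    unfold i3, th3, path. do 2 f_equal. apply injective_projections; simpl; ring.
  - apply (ex_derive_axis L 0 (PI / 2) 0 0 1); auto. left. intros t.
    unfold i4, th4, path, hpi. do 2 f_equal. apply injective_projections; simpl; ring.
Qed.

Lemma ex_derive_continuity_pt (f : R -> R) (x : R) : ex_derive f x -> continuity_pt f x.
Proof. intros [l H]. now apply is_derive_continuity_pt with l. Qed.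

Lemma t4_ne0 (L x : R) : 0 < L -> t4 L x <> 0.
Proof.
  intros HL H. destruct (th_real L x HL) as [_ [_ [_ R4]]]. rewrite H in R4.
  apply (th4_ne0 L (x, 0)) in R4; auto. simpl. rewrite Rabs_R0. lra.
Qed.

Lemma t4_pos (L x : R) : 0 < L -> 0 < t4 L x.
Proof.
  (* The sign is read off at pi/2, where theta_4 equals theta_3(0), a series of positive terms; the
     interval is widened to contain both [x] and this point. *)
  intros HL. apply (pos_of_ne0 (t4 L) (Rmin x 0 - 1) (Rmax x (PI / 2) + 1) (PI / 2)).
  - intros y _. exact (ex_derive_continuity_pt _ _ (proj2 (proj2 (proj2 (t_ex_derive L y HL))))).
  - intros. now apply t4_ne0.
  - generalize (Rmin_r x 0) (Rmax_r x (PI / 2)) PI_RGT_0. lra.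
  - rewrite <- (Rplus_0_l (PI / 2)). destruct (t_shift L 0 HL) as [_ [_ [_ E]]]. rewrite E.
    now apply t3_0_pos.
  - generalize (Rmin_l x 0) (Rmax_l x (PI / 2)). lra.
Qed.

Lemma t3_pos (L x : R) : 0 < L -> 0 < t3 L x.
Proof. intros HL. destruct (t_shift L x HL) as [_ [_ [_ E]]]. rewrite <- E. now apply t4_pos. Qed.

Lemma t1_pos (L x : R) : 0 < L -> 0 < x < PI -> 0 < t1 L x.
Proof.
  intros HL Hx. apply (pos_of_ne0 (t1 L) 0 PI (PI / 2)); auto.
  - intros y _. exact (ex_derive_continuity_pt _ _ (proj1 (t_ex_derive L y HL))).
  - intros y Hy. apply t1_ne0; auto. generalize (sin_gt_0 y); lra.
  - generalize PI_RGT_0; lra.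
  - rewrite t1_cos0, sin_PI2, Rmult_1_l by (auto; apply cos_PI2). now apply t2_0_pos.
Qed.

Lemma t2_pos (L x : R) : 0 < L -> - PI / 2 < x < PI / 2 -> 0 < t2 L x.
Proof. intros HL Hx. destruct (t_shift L x HL) as [E _]. rewrite <- E. apply t1_pos; lra. Qed.

Lemma t4_0_i4 (L : R) : t4 L 0 = i4 L 0.
Proof. reflexivity. Qed.

Lemma i4_pos (L y : R) : 0 < L -> - (L / 2) < y < L / 2 -> 0 < i4 L y.
Proof.
  intros HL Hy. apply (pos_of_ne0 (i4 L) (- (L / 2)) (L / 2) 0); auto.
  - intros z _. exact (ex_derive_continuity_pt _ _ (proj2 (proj2 (proj2 (i_ex_derive L z HL))))).
  - intros x Hx H. destruct (th_imag L x HL) as [_ [_ [_ R4]]]. rewrite H in R4.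
    apply (th4_ne0 L (0, x)) in R4; auto. simpl.
    unfold Rabs; destruct (Rcase_abs x); lra.
  - lra.
  - rewrite <- t4_0_i4. now apply t4_pos.
Qed.

(** * Jacobi functions on the axes and their derivatives *)

Ltac Rfield := match goal with |- @eq _ ?a ?b => change (@eq R a b); field end.

Lemma RtoC_fst (x y : R) : RtoC x = RtoC y -> x = y.
Proof. intros H. exact (f_equal fst H). Qed.

(* Differentiating the difference formula in [v] at [0] gives the Wronskian of theta_1 and theta_4. *)
Lemma wronskian (p1 p2 p3 p4 : R -> R) (k D a4 u : R) :
  (forall u v, k * (p1 (u + v) * p4 (u - v) - p4 (u + v) * p1 (u - v)) =
     2 * (p2 u * p3 u) * (p1 v * p4 v)) ->
  (forall x, ex_derive p1 x) -> (forall x, ex_derive p4 x) ->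
  p1 0 = 0 -> p4 0 = a4 -> is_derive p1 0 D ->
  k * (Derive p1 u * p4 u - p1 u * Derive p4 u) = p2 u * p3 u * (D * a4).
Proof.
  intros H E1 E4 H1 H4 HD.
  assert (D1 : is_derive (fun v => k * (p1 (u + v) * p4 (u - v) - p4 (u + v) * p1 (u - v))) 0
     (2 * (k * (Derive p1 u * p4 u - p1 u * Derive p4 u)))).
  { auto_derive.
    - repeat split; auto.
    - replace (u + 0) with u by ring. replace (u + - 0) with u by ring.
      change (fun x => p1 x) with p1. change (fun x => p4 x) with p4. ring. }
  assert (D2 : is_derive (fun v => 2 * (p2 u * p3 u) * (p1 v * p4 v)) 0 (2 * (p2 u * p3 u) * (D * a4))).
  { auto_derive; [repeat split; auto|].
    change (fun x => p1 x) with p1. change (fun x => p4 x) with p4.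
    rewrite H1, H4, (is_derive_unique _ _ _ HD). ring. }
  assert (D3 := is_derive_ext _ _ _ _ (H u) D1).
  assert (X := eq_trans (eq_sym (is_derive_unique _ _ _ D2)) (is_derive_unique _ _ _ D3)). lra.
Qed.

(* The modulus and the factor 2K/PI, see [ellK_kap]. *)
Definition kap (L : R) : R := t2 L 0 ^ 2 / t3 L 0 ^ 2.
Definition lam (L : R) : R := thD L * t3 L 0 / (t2 L 0 * t4 L 0).

(* sn, cn, dn as functions of the theta variable PI u/(2K): on the real axis (R), and on the
   imaginary axis (I) after dividing sn by i. *)
Definition sR L x := t3 L 0 / t2 L 0 * (t1 L x / t4 L x).
Definition cR L x := t4 L 0 / t2 L 0 * (t2 L x / t4 L x).
Definition dR L x := t4 L 0 / t3 L 0 * (t3 L x / t4 L x).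
Definition sI L y := t3 L 0 / t2 L 0 * (i1 L y / i4 L y).
Definition cI L y := t4 L 0 / t2 L 0 * (i2 L y / i4 L y).
Definition dI L y := t4 L 0 / t3 L 0 * (i3 L y / i4 L y).

Lemma th_at_0 (L : R) : 0 < L ->
  th2 L 0 = RtoC (t2 L 0) /\ th3 L 0 = RtoC (t3 L 0) /\ th4 L 0 = RtoC (t4 L 0).
Proof. intros HL. destruct (th_real L 0 HL) as [_ [H2 [H3 H4]]]. auto. Qed.

Lemma t_difference (L u v : R) : 0 < L ->
  t2 L 0 * t3 L 0 * (t1 L (u + v) * t4 L (u - v) - t4 L (u + v) * t1 L (u - v)) =
  2 * (t2 L u * t3 L u) * (t1 L v * t4 L v).
Proof.
  intros HL. assert (H := th_difference L HL (u, 0) (v, 0)).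
  rewrite pair_plus, pair_minus, Rplus_0_r, Rminus_0_r in H.
  destruct (th_real L u HL) as [_ [A2 [A3 _]]]. destruct (th_real L v HL) as [B1 [_ [_ B4]]].
  destruct (th_real L (u + v) HL) as [C1 [_ [_ C4]]]. destruct (th_real L (u - v) HL) as [D1 [_ [_ D4]]].
  destruct (th_at_0 L HL) as [Z2 [Z3 Z4]].
  rewrite A2, A3, B1, B4, C1, C4, D1, D4, Z2, Z3 in H.
  rewrite <- !RtoC_mult, <- RtoC_minus, <- !RtoC_mult in H. now apply RtoC_fst.
Qed.

Lemma imag_scal (a b : R) : (RtoC a * (0, b))%C = (0, a * b).
Proof. apply injective_projections; simpl; ring. Qed.

Lemma imag_scal_r (a b : R) : ((0, b) * RtoC a)%C = (0, b * a).
Proof. apply injective_projections; simpl; ring. Qed.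

Lemma imag_mult (a b : R) : ((0, a) * (0, b))%C = RtoC (- (a * b)).
Proof. apply injective_projections; simpl; ring. Qed.

Lemma i_difference (L u v : R) : 0 < L ->
  t2 L 0 * t3 L 0 * (i1 L (u + v) * i4 L (u - v) - i4 L (u + v) * i1 L (u - v)) =
  2 * (i2 L u * i3 L u) * (i1 L v * i4 L v).
Proof.
  intros HL. assert (H := th_difference L HL (0, u) (0, v)).
  rewrite pair_plus, pair_minus, Rplus_0_r, Rminus_0_r in H.
  destruct (th_imag L u HL) as [_ [A2 [A3 _]]]. destruct (th_imag L v HL) as [B1 [_ [_ B4]]].
  destruct (th_imag L (u + v) HL) as [C1 [_ [_ C4]]]. destruct (th_imag L (u - v) HL) as [D1 [_ [_ D4]]].
  destruct (th_at_0 L HL) as [Z2 [Z3 Z4]].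
  rewrite A2, A3, B1, B4, C1, C4, D1, D4, Z2, Z3 in H.
  rewrite !imag_scal, !imag_scal_r, <- !RtoC_mult, pair_minus, Rminus_0_r, !imag_scal in H.
  exact (f_equal snd H).
Qed.

Lemma quadratic_real (L x : R) : 0 < L ->
  t4 L 0 ^ 2 * t2 L x ^ 2 = t2 L 0 ^ 2 * t4 L x ^ 2 - t3 L 0 ^ 2 * t1 L x ^ 2 /\
  t4 L 0 ^ 2 * t3 L x ^ 2 = t3 L 0 ^ 2 * t4 L x ^ 2 - t2 L 0 ^ 2 * t1 L x ^ 2.
Proof.
  intros HL. assert (H := th2_quadratic L HL (x, 0)). assert (H' := th3_quadratic L HL (x, 0)).
  destruct (th_real L x HL) as [A1 [A2 [A3 A4]]]. destruct (th_at_0 L HL) as [Z2 [Z3 Z4]].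
  rewrite A1, A2, A4, Z2, Z3, Z4 in H. rewrite A1, A3, A4, Z2, Z3, Z4 in H'.
  rewrite <- !RtoC_mult, <- RtoC_minus in H, H'. apply RtoC_fst in H, H'. split; nra.
Qed.

Lemma quadratic_imag (L y : R) : 0 < L ->
  t4 L 0 ^ 2 * i2 L y ^ 2 = t2 L 0 ^ 2 * i4 L y ^ 2 + t3 L 0 ^ 2 * i1 L y ^ 2 /\
  t4 L 0 ^ 2 * i3 L y ^ 2 = t3 L 0 ^ 2 * i4 L y ^ 2 + t2 L 0 ^ 2 * i1 L y ^ 2.
Proof.
  intros HL. assert (H := th2_quadratic L HL (0, y)). assert (H' := th3_quadratic L HL (0, y)).
  destruct (th_imag L y HL) as [A1 [A2 [A3 A4]]]. destruct (th_at_0 L HL) as [Z2 [Z3 Z4]].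
  rewrite A1, A2, A4, Z2, Z3, Z4, imag_mult in H. rewrite A1, A3, A4, Z2, Z3, Z4, imag_mult in H'.
  rewrite <- !RtoC_mult, <- RtoC_minus in H, H'. apply RtoC_fst in H, H'. split; nra.
Qed.

Lemma constants_real (L : R) : 0 < L -> t3 L 0 ^ 4 = t2 L 0 ^ 4 + t4 L 0 ^ 4.
Proof.
  intros HL. assert (H := theta_constants L HL). destruct (th_at_0 L HL) as [Z2 [Z3 Z4]].
  rewrite Z2, Z3, Z4 in H. rewrite <- !RtoC_mult, <- RtoC_plus in H. apply RtoC_fst in H.
  simpl. lra.
Qed.

Lemma t1_0 (L : R) : 0 < L -> t1 L 0 = 0.
Proof. intros HL. unfold t1. change (0, 0) with (RtoC 0). now rewrite th1_0. Qed.

Lemma i1_0 (L : R) : 0 < L -> i1 L 0 = 0.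
Proof. intros HL. unfold i1. change (0, 0) with (RtoC 0). now rewrite th1_0. Qed.

Lemma kap_bounds (L : R) : 0 < L -> 0 < kap L < 1.
Proof.
  intros HL. generalize (t2_0_pos L HL) (t3_0_pos L HL) (t4_pos L 0 HL) (constants_real L HL).
  unfold kap. intros P2 P3 P4 E.
  assert (0 < t2 L 0 ^ 2) by nra. assert (0 < t3 L 0 ^ 2) by nra. assert (0 < t4 L 0 ^ 2) by nra.
  split; [now apply Rdiv_lt_0_compat|].
  apply Rmult_lt_reg_r with (t3 L 0 ^ 2); auto. unfold Rdiv. rewrite Rmult_assoc, Rinv_l, Rmult_1_r, Rmult_1_l by lra.
  destruct (Rlt_le_dec (t2 L 0 ^ 2) (t3 L 0 ^ 2)); auto. exfalso.
  assert (t3 L 0 ^ 4 <= t2 L 0 ^ 4).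
  { replace (t3 L 0 ^ 4) with (t3 L 0 ^ 2 * t3 L 0 ^ 2) by ring.
    replace (t2 L 0 ^ 4) with (t2 L 0 ^ 2 * t2 L 0 ^ 2) by ring. nra. }
  assert (0 < t4 L 0 ^ 4) by (replace (t4 L 0 ^ 4) with (t4 L 0 ^ 2 * t4 L 0 ^ 2) by ring; nra).
  lra.
Qed.

Lemma jacobi_real (L x : R) : 0 < L ->
  cR L x ^ 2 = 1 - sR L x ^ 2 /\ dR L x ^ 2 = 1 - kap L ^ 2 * sR L x ^ 2 /\
  is_derive (sR L) x (lam L * (cR L x * dR L x)).
Proof.
  intros HL. generalize (t2_0_pos L HL) (t3_0_pos L HL) (t4_pos L 0 HL) (t4_pos L x HL).
  intros P2 P3 P4 PX. destruct (quadratic_real L x HL) as [Q2 Q3].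
  unfold sR, cR, dR, kap, lam. split; [|split].
  - replace ((t4 L 0 / t2 L 0 * (t2 L x / t4 L x)) ^ 2) with
      ((t4 L 0 ^ 2 * t2 L x ^ 2) / (t2 L 0 ^ 2 * t4 L x ^ 2)) by (field; lra).
    rewrite Q2. field. lra.
  - replace ((t4 L 0 / t3 L 0 * (t3 L x / t4 L x)) ^ 2) with
      ((t4 L 0 ^ 2 * t3 L x ^ 2) / (t3 L 0 ^ 2 * t4 L x ^ 2)) by (field; lra).
    rewrite Q3. field. lra.
  - assert (W := wronskian (t1 L) (t2 L) (t3 L) (t4 L) (t2 L 0 * t3 L 0) (thD L) (t4 L 0) x
       (fun u v => t_difference L u v HL) (fun y => proj1 (t_ex_derive L y HL))
       (fun y => proj2 (proj2 (proj2 (t_ex_derive L y HL)))) (t1_0 L HL) eq_refl (t1_derive_0 L HL)).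
    auto_derive.
    + repeat split; [apply (t_ex_derive L x HL)|exact (proj2 (proj2 (proj2 (t_ex_derive L x HL))))|lra].
    + change (fun y => t1 L y) with (t1 L). change (fun y => t4 L y) with (t4 L).
      replace (thD L * t3 L 0 / (t2 L 0 * t4 L 0) *
        (t4 L 0 / t2 L 0 * (t2 L x / t4 L x) * (t4 L 0 / t3 L 0 * (t3 L x / t4 L x)))) with
        ((t2 L x * t3 L x * (thD L * t4 L 0)) / (t2 L 0 ^ 2 * t4 L x ^ 2)) by (field; lra).
      rewrite <- W. field. lra.
Qed.

Lemma jacobi_imag (L y : R) : 0 < L -> - (L / 2) < y < L / 2 ->
  cI L y ^ 2 = 1 + sI L y ^ 2 /\ dI L y ^ 2 = 1 + kap L ^ 2 * sI L y ^ 2 /\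
  is_derive (sI L) y (lam L * (cI L y * dI L y)).
Proof.
  intros HL Hy. generalize (t2_0_pos L HL) (t3_0_pos L HL) (t4_pos L 0 HL) (i4_pos L y HL Hy).
  intros P2 P3 P4 PX. destruct (quadratic_imag L y HL) as [Q2 Q3].
  unfold sI, cI, dI, kap, lam. split; [|split].
  - replace ((t4 L 0 / t2 L 0 * (i2 L y / i4 L y)) ^ 2) with
      ((t4 L 0 ^ 2 * i2 L y ^ 2) / (t2 L 0 ^ 2 * i4 L y ^ 2)) by (field; lra).
    rewrite Q2. field. lra.
  - replace ((t4 L 0 / t3 L 0 * (i3 L y / i4 L y)) ^ 2) with
      ((t4 L 0 ^ 2 * i3 L y ^ 2) / (t3 L 0 ^ 2 * i4 L y ^ 2)) by (field; lra).
    rewrite Q3. field. lra.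
  - assert (W := wronskian (i1 L) (i2 L) (i3 L) (i4 L) (t2 L 0 * t3 L 0) (thD L) (t4 L 0) y
       (fun u v => i_difference L u v HL) (fun y => proj1 (i_ex_derive L y HL))
       (fun y => proj2 (proj2 (proj2 (i_ex_derive L y HL)))) (i1_0 L HL) eq_refl (i1_derive_0 L HL)).
    auto_derive.
    + repeat split; [apply (i_ex_derive L y HL)|exact (proj2 (proj2 (proj2 (i_ex_derive L y HL))))|lra].
    + change (fun y => i1 L y) with (i1 L). change (fun y => i4 L y) with (i4 L).
      replace (thD L * t3 L 0 / (t2 L 0 * t4 L 0) *
        (t4 L 0 / t2 L 0 * (i2 L y / i4 L y) * (t4 L 0 / t3 L 0 * (i3 L y / i4 L y)))) with
        ((i2 L y * i3 L y * (thD L * t4 L 0)) / (t2 L 0 ^ 2 * i4 L y ^ 2)) by (field; lra).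
      rewrite <- W. field. lra.
Qed.

Lemma dR_pos (L x : R) : 0 < L -> 0 < dR L x.
Proof.
  intros HL. unfold dR. apply Rmult_lt_0_compat; apply Rdiv_lt_0_compat;
  auto using t4_pos, t3_pos.
Qed.

Lemma cR_pos (L x : R) : 0 < L -> - PI / 2 < x < PI / 2 -> 0 < cR L x.
Proof.
  intros HL Hx. unfold cR. apply Rmult_lt_0_compat; apply Rdiv_lt_0_compat;
  auto using t4_pos, t2_0_pos, t2_pos.
Qed.

Lemma cI_pos (L y : R) : 0 < L -> - (L / 2) < y < L / 2 -> 0 < cI L y.
Proof.
  intros HL Hy. unfold cI. apply Rmult_lt_0_compat; apply Rdiv_lt_0_compat;
  auto using t4_pos, t2_0_pos, i2_pos, i4_pos.
Qed.

Lemma dI_pos (L y : R) : 0 < L -> - (L / 2) < y < L / 2 -> 0 < dI L y.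
Proof.
  intros HL Hy. unfold dI. apply Rmult_lt_0_compat; apply Rdiv_lt_0_compat;
  auto using t4_pos, t3_0_pos, i3_pos, i4_pos.
Qed.

Lemma sR_0 (L : R) : 0 < L -> sR L 0 = 0.
Proof. intros HL. unfold sR. rewrite t1_0 by exact HL. unfold Rdiv. ring. Qed.

Lemma sI_0 (L : R) : 0 < L -> sI L 0 = 0.
Proof. intros HL. unfold sI. rewrite i1_0 by exact HL. unfold Rdiv. ring. Qed.

Lemma sR_shift (L x : R) : 0 < L -> sR L (x + PI / 2) = cR L x / dR L x.
Proof.
  intros HL. destruct (t_shift L x HL) as [E1 [E2 [E3 E4]]].
  generalize (t2_0_pos L HL) (t3_0_pos L HL) (t4_pos L 0 HL) (t4_pos L x HL) (t3_pos L x HL). intros.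
  unfold sR, cR, dR. rewrite E1, E4. field. lra.
Qed.

(** Up to [lam] this is the derivative of [sR] at the shifted point; it feeds [is_derive_cR]. The
    factor 1 - k^2 comes from the quartic identity of the theta constants. *)
Lemma cd_shift (L x : R) : 0 < L ->
  cR L (x + PI / 2) * dR L (x + PI / 2) = - (1 - kap L ^ 2) * sR L x / dR L x ^ 2.
Proof.
  intros HL. destruct (t_shift L x HL) as [E1 [E2 [E3 E4]]].
  generalize (t2_0_pos L HL) (t3_0_pos L HL) (t4_pos L 0 HL) (t4_pos L x HL) (t3_pos L x HL)
    (constants_real L HL). intros P1 P2 P3 P4 P5 Q.
  unfold sR, cR, dR, kap. rewrite E2, E3, E4.
  replace (1 - (t2 L 0 ^ 2 / t3 L 0 ^ 2) ^ 2) with ((t3 L 0 ^ 4 - t2 L 0 ^ 4) / t3 L 0 ^ 4) by (field; lra).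
  replace (t3 L 0 ^ 4 - t2 L 0 ^ 4) with (t4 L 0 ^ 4) by lra. field. lra.
Qed.

Lemma sR_PI2 (L : R) : 0 < L -> sR L (PI / 2) = 1.
Proof.
  intros HL. rewrite <- (Rplus_0_l (PI / 2)), sR_shift by exact HL.
  generalize (t2_0_pos L HL) (t3_0_pos L HL) (t4_pos L 0 HL). intros.
  unfold cR, dR. field. lra.
Qed.

Lemma sR_plus_PI (L x : R) : 0 < L -> sR L (x + PI) = - sR L x.
Proof.
  intros HL. replace (x + PI) with (x + PI / 2 + PI / 2) by field.
  destruct (t_shift L x HL) as [E1 [E2 [E3 E4]]].
  destruct (t_shift L (x + PI / 2) HL) as [F1 [F2 [F3 F4]]].
  unfold sR. rewrite F1, F4, E2, E3. unfold Rdiv. ring.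
Qed.

(** On the real axis dn is positive, hence the square root of 1 - k^2 sn^2, which can be
    differentiated. For cn, which changes sign, this argument would fail at the zeros. *)
Lemma is_derive_dR (L x : R) : 0 < L ->
  is_derive (dR L) x (- lam L * kap L ^ 2 * (sR L x * cR L x)).
Proof.
  intros HL. destruct (jacobi_real L x HL) as [_ [Hd Hs]].
  apply is_derive_ext with (fun t => sqrt (1 - kap L ^ 2 * sR L t ^ 2)).
  - intros t. destruct (jacobi_real L t HL) as [_ [Hd' _]]. rewrite <- Hd'.
    apply sqrt_pow2. left. now apply dR_pos.
  - assert (P := dR_pos L x HL).
    auto_derive.
    + repeat split; [eexists; exact Hs|]. change (sR L x * (sR L x * 1)) with (sR L x ^ 2).
      change (kap L * (kap L * 1)) with (kap L ^ 2).
      replace (1 + - (kap L ^ 2 * sR L x ^ 2)) with (dR L x ^ 2) by lra. nra.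
    + change (fun y => sR L y) with (sR L). rewrite (is_derive_unique _ _ _ Hs).
      change (sR L x * (sR L x * 1)) with (sR L x ^ 2).
      change (kap L * (kap L * 1)) with (kap L ^ 2).
      replace (1 + - (kap L ^ 2 * sR L x ^ 2)) with (dR L x ^ 2) by lra.
      rewrite sqrt_pow2 by lra. simpl. field. lra.
Qed.

(* [cR] is [dR] times the quarter-period shift of [sR], which makes it differentiable also at its zeros. *)
Lemma is_derive_cR (L x : R) : 0 < L ->
  is_derive (cR L) x (- lam L * (sR L x * dR L x)).
Proof.
  intros HL. apply is_derive_ext with (fun t => sR L (t + PI / 2) * dR L t).
  - intros t. rewrite sR_shift by exact HL. Rfield. generalize (dR_pos L t HL); lra.
  - destruct (jacobi_real L x HL) as [Hc [Hd _]]. destruct (jacobi_real L (x + PI / 2) HL) as [_ [_ Hs]].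
    assert (HdR := is_derive_dR L x HL). assert (P := dR_pos L x HL).
    auto_derive.
    + repeat split; [eexists; exact Hs|eexists; exact HdR].
    + change (fun y => sR L y) with (sR L). change (fun y => dR L y) with (dR L).
      rewrite (is_derive_unique _ _ _ Hs), (is_derive_unique _ _ _ HdR), cd_shift, sR_shift by exact HL.
      replace (- lam L * (sR L x * dR L x)) with (- lam L * sR L x * dR L x ^ 2 / dR L x) by (field; lra).
      replace (dR L x ^ 2) with (1 - kap L ^ 2 + kap L ^ 2 * cR L x ^ 2) at 2 by (rewrite Hc, Hd; ring).
      field. lra.
Qed.

(** Between 0 and pi/2 the function [sR] rises from 0 to 1 while cn dn stays nonnegative; the mean
    value theorem then decides the sign of the factor [lam]. *)
Lemma lam_pos (L : R) : 0 < L -> 0 < lam L.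
Proof.
  intros HL. destruct (MVT_gen (sR L) 0 (PI / 2) (fun x => lam L * (cR L x * dR L x))) as [z [Hz E]].
  - intros x _. now apply jacobi_real.
  - intros x _. eapply is_derive_continuity_pt. now apply jacobi_real.
  - rewrite sR_PI2, sR_0 in E by exact HL.
    assert (PP := PI_RGT_0). rewrite Rmin_left, Rmax_right in Hz by lra.
    assert (Hc : 0 <= cR L z).
    { destruct (Req_dec z (PI / 2)) as [->|Hn].
      - destruct (jacobi_real L (PI / 2) HL) as [Hc _]. rewrite sR_PI2 in Hc by exact HL. nra.
      - left. apply cR_pos; auto. lra. }
    assert (Hd := dR_pos L z HL).
    destruct (Rlt_le_dec 0 (lam L)); auto. exfalso.
    assert (0 <= cR L z * dR L z * (PI / 2)) by (apply Rmult_le_pos; [apply Rmult_le_pos|]; lra).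
    nra.
Qed.

(** * Complete elliptic integrals by inversion *)

Definition ell_integrand (k t : R) : R := / sqrt (1 - k ^ 2 * sin t ^ 2).

Lemma sin_sq_bound (t : R) : 0 <= sin t ^ 2 <= 1.
Proof. generalize (SIN_bound t). intros. nra. Qed.

Lemma ell_radicand_pos (k t : R) : k ^ 2 < 1 -> 0 < 1 - k ^ 2 * sin t ^ 2.
Proof. intros Hk. generalize (sin_sq_bound t) (pow2_ge_0 k). intros. nra. Qed.

Lemma ell_integrand_pos (k t : R) : k ^ 2 < 1 -> 0 < ell_integrand k t.
Proof. intros Hk. apply Rinv_0_lt_compat, sqrt_lt_R0. now apply ell_radicand_pos. Qed.

Lemma ell_integrand_continuous (k t : R) : k ^ 2 < 1 -> continuous (ell_integrand k) t.
Proof.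
  intros Hk. apply (ex_derive_continuous (ell_integrand k)). unfold ell_integrand. auto_derive.
  assert (H := ell_radicand_pos k t Hk).
  change (k * (k * 1)) with (k ^ 2). change (sin t * (sin t * 1)) with (sin t ^ 2).
  split; [lra|split; auto]. apply Rgt_not_eq, sqrt_lt_R0. lra.
Qed.

(** Legendre's incomplete integral F(phi, k). *)
Definition eF (k phi : R) : R := RInt (ell_integrand k) 0 phi.

Lemma eF_derive (k phi : R) : k ^ 2 < 1 -> is_derive (eF k) phi (ell_integrand k phi).
Proof.
  intros Hk. apply (is_derive_RInt (ell_integrand k) (eF k) 0 phi).
  - exists (mkposreal 1 Rlt_0_1). intros y _. apply (@RInt_correct R_CompleteNormedModule).
    apply (@ex_RInt_continuous R_CompleteNormedModule). intros; now apply ell_integrand_continuous.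
  - now apply ell_integrand_continuous.
Qed.

Lemma eF_0 (k : R) : eF k 0 = 0.
Proof. apply (@RInt_point R_CompleteNormedModule). Qed.

Lemma MVT_open (f df : R -> R) (a b : R) : a < b ->
  (forall x, a < x < b -> is_derive f x (df x)) ->
  (forall x, a <= x <= b -> continuity_pt f x) ->
  exists c, a < c < b /\ f b - f a = df c * (b - a).
Proof.
  intros Hab Hd Hc.
  assert (D1 : forall c, a < c < b -> derivable_pt f c).
  { intros c Hcc. exists (df c). apply is_derive_Reals. auto. }
  destruct (MVT f id a b D1 (fun c _ => derivable_pt_id c) Hab Hc) as [c [Pc E]].
  - intros; apply derivable_continuous_pt, derivable_pt_id.
  - exists c. split; auto.
    rewrite derive_pt_id in E. unfold id in E.
    replace (derive_pt f c (D1 c Pc)) with (df c) in E; [lra|].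
    symmetry. apply derive_pt_eq_0. apply is_derive_Reals. auto.
Qed.

Lemma eF_lt (k a b : R) : k ^ 2 < 1 -> a < b -> eF k a < eF k b.
Proof.
  intros Hk Hab. destruct (MVT_open (eF k) (ell_integrand k) a b Hab) as [c [_ E]].
  - intros; now apply eF_derive.
  - intros; eapply is_derive_continuity_pt; now apply eF_derive.
  - generalize (ell_integrand_pos k c Hk). intros. nra.
Qed.

(** The substitution g = tan phi turns the integrand into dg / sqrt((1 + g^2) (1 + k'^2 g^2)). The
    tangent avoids the endpoint singularity that the sine would have: sin phi has derivative 0 at
    phi = pi/2. *)
Lemma eF_atan_derive (k l : R) (g : R -> R) (y : R) : k ^ 2 < 1 ->
  is_derive g y (l * sqrt ((1 + g y ^ 2) * (1 + (1 - k ^ 2) * g y ^ 2))) ->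
  is_derive (fun t => eF k (atan (g t))) y l.
Proof.
  intros Hk Hg.
  assert (Ha : is_derive atan (g y) (/ (1 + g y ^ 2))).
  { apply is_derive_Reals. exact (derivable_pt_lim_atan (g y)). }
  assert (H1 := is_derive_comp atan g y _ _ Ha Hg).
  assert (H2 := is_derive_comp (eF k) (fun t => atan (g t)) y _ _ (eF_derive k (atan (g y)) Hk) H1).
  replace l with (scal (scal (l * sqrt ((1 + g y ^ 2) * (1 + (1 - k ^ 2) * g y ^ 2))) (/ (1 + g y ^ 2)))
    (ell_integrand k (atan (g y)))); [exact H2|].
  unfold scal; simpl; unfold mult; simpl. clear H1 H2 Ha Hg.
  unfold ell_integrand. rewrite sin_atan.
  change (g y * (g y * 1)) with (g y ^ 2). change (k * (k * 1)) with (k ^ 2).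
  set (A := 1 + g y ^ 2). set (B := 1 + (1 - k ^ 2) * g y ^ 2).
  assert (HA : 0 < A) by (unfold A; generalize (pow2_ge_0 (g y)); lra).
  assert (HB : 0 < B) by (unfold B; generalize (pow2_ge_0 (g y)); nra).
  assert (SA := sqrt_lt_R0 A HA). assert (SB := sqrt_lt_R0 B HB).
  assert (EA := sqrt_sqrt A (Rlt_le _ _ HA)).
  replace (1 - k ^ 2 * (g y / sqrt (1 + Rsqr (g y))) ^ 2) with (B / A).
  - rewrite sqrt_mult, sqrt_div by lra.
    replace (/ A) with (/ (sqrt A * sqrt A)) by now rewrite EA. field. lra.
  - replace (1 + Rsqr (g y)) with A by (unfold A, Rsqr; ring).
    replace (1 - k ^ 2 * (g y / sqrt A) ^ 2) with (1 - k ^ 2 * g y ^ 2 / (sqrt A * sqrt A)) by (field; lra).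
    rewrite EA. unfold B, A. field. fold A. lra.
Qed.

Lemma ellK_inversion (k l Y : R) (g : R -> R) : k ^ 2 < 1 -> 0 < l -> 0 < Y -> g 0 = 0 ->
  (forall y, 0 <= y < Y -> is_derive g y (l * sqrt ((1 + g y ^ 2) * (1 + (1 - k ^ 2) * g y ^ 2)))) ->
  (forall M, exists y, 0 <= y < Y /\ M < g y) ->
  ellK k = l * Y.
Proof.
  intros Hk Hl HY Hg0 Hg Hinf. change (ellK k) with (eF k (PI / 2)).
  assert (H : forall y, 0 <= y < Y -> eF k (atan (g y)) = l * y).
  { intros y Hy. destruct (Req_dec y 0) as [->|Hn].
    - rewrite Hg0, atan_0, eF_0. ring.
    - destruct (MVT_open (fun t => eF k (atan (g t))) (fun _ => l) 0 y) as [c [_ E]]; [lra| | |].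
      + intros x Hx. apply eF_atan_derive; auto. apply Hg. lra.
      + intros x Hx. eapply is_derive_continuity_pt. apply eF_atan_derive; auto. apply Hg. lra.
      + rewrite Hg0, atan_0, eF_0 in E. lra. }
  assert (P0 : 0 < eF k (PI / 2)).
  { rewrite <- (eF_0 k). apply eF_lt; auto. generalize PI_RGT_0; lra. }
  apply Rle_antisym; apply Rnot_lt_le; intros C.
  (* If l Y < K, some angle below pi/2 already has F > l Y. As [g] is unbounded, atan g passes this
     angle at some y < Y, where F is only l y. *)
  - assert (Hc : continuity_pt (eF k) (PI / 2)) by (eapply is_derive_continuity_pt; now apply eF_derive).
    destruct (Hc (eF k (PI / 2) - l * Y)) as [d [Hd Hd']]; [lra|].
    set (e := Rmin (d / 2) (PI / 4)).
    assert (He : 0 < e /\ e < d /\ e < PI / 2).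
    { assert (PP := PI_RGT_0). unfold e. generalize (Rmin_l (d / 2) (PI / 4)) (Rmin_r (d / 2) (PI / 4)).
      intros. split; [apply Rmin_pos; lra|lra]. }
    assert (B : l * Y < eF k (PI / 2 - e)).
    { assert (X : dist R_met (eF k (PI / 2 - e)) (eF k (PI / 2)) < eF k (PI / 2) - l * Y).
      { apply Hd'. split.
        - split; [exact I|]. lra.
        - simpl. unfold R_dist. replace (PI / 2 - e - PI / 2) with (- e) by ring.
          rewrite Rabs_Ropp, Rabs_pos_eq; lra. }
      simpl in X. unfold R_dist in X. apply Rabs_def2 in X. lra. }
    destruct (Hinf (tan (PI / 2 - e))) as [y [Hy Hgy]].
    assert (A : PI / 2 - e < atan (g y)).
    { rewrite <- (atan_tan (PI / 2 - e)) by (generalize PI_RGT_0; lra). now apply atan_increasing. }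
    apply (eF_lt k) in A; auto. rewrite (H y Hy) in A. nra.
  (* If K < l Y, the point y = K / l lies before [Y] and forces F(atan (g y)) = F(pi/2), although
     atan stays below pi/2. *)
  - set (y := eF k (PI / 2) / l).
    assert (Hy : 0 <= y < Y).
    { unfold y. split; [left; now apply Rdiv_lt_0_compat|].
      apply Rmult_lt_reg_r with l; auto. unfold Rdiv. rewrite Rmult_assoc, Rinv_l; lra. }
    assert (E := H y Hy). replace (l * y) with (eF k (PI / 2)) in E by (unfold y; field; lra).
    assert (A : atan (g y) < PI / 2) by apply atan_bound.
    apply (eF_lt k) in A; auto. lra.
Qed.

(** Inversion of sn/cn, whose derivative is lam dn / cn^2 and which blows up at pi/2, where cn
    vanishes and sn = 1. *)
Lemma ellK_kap (L : R) : 0 < L -> ellK (kap L) = lam L * (PI / 2).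
Proof.
  intros HL. assert (Hk := kap_bounds L HL). assert (PP := PI_RGT_0).
  apply (ellK_inversion (kap L) (lam L) (PI / 2) (fun x => sR L x / cR L x)).
  - nra.
  - now apply lam_pos.
  - lra.
  - rewrite sR_0 by exact HL. unfold Rdiv. ring.
  - intros x Hx. assert (Hc : 0 < cR L x) by (apply cR_pos; lra). assert (Hd := dR_pos L x HL).
    destruct (jacobi_real L x HL) as [Ec [Ed Ds]]. assert (Dc := is_derive_cR L x HL).
    replace (lam L * sqrt ((1 + (sR L x / cR L x) ^ 2) * (1 + (1 - kap L ^ 2) * (sR L x / cR L x) ^ 2)))
      with (lam L * dR L x / cR L x ^ 2).
    + auto_derive.
      * repeat split; [eexists; exact Ds|eexists; exact Dc|lra].
      * change (fun x => sR L x) with (sR L). change (fun x => cR L x) with (cR L).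
        rewrite (is_derive_unique _ _ _ Ds), (is_derive_unique _ _ _ Dc).
        transitivity (lam L * dR L x * (cR L x ^ 2 + sR L x ^ 2) / cR L x ^ 2); [field; lra|].
        replace (cR L x ^ 2 + sR L x ^ 2) with 1 by lra. field. lra.
    + replace ((1 + (sR L x / cR L x) ^ 2) * (1 + (1 - kap L ^ 2) * (sR L x / cR L x) ^ 2)) with
        ((dR L x / cR L x ^ 2) ^ 2).
      * rewrite sqrt_pow2; [field; lra|]. left. apply Rdiv_lt_0_compat; nra.
      * replace ((dR L x / cR L x ^ 2) ^ 2) with (dR L x ^ 2 / cR L x ^ 4) by (field; lra).
        replace ((1 + (sR L x / cR L x) ^ 2) * (1 + (1 - kap L ^ 2) * (sR L x / cR L x) ^ 2)) with
        ((cR L x ^ 2 + sR L x ^ 2) * (cR L x ^ 2 + (1 - kap L ^ 2) * sR L x ^ 2) / cR L x ^ 4) by (field; lra).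
        rewrite Ed, Ec. f_equal. ring.
  - intros M.
    assert (C1 : continuity_pt (cR L) (PI / 2)) by (eapply is_derive_continuity_pt; now apply is_derive_cR).
    assert (C2 : continuity_pt (sR L) (PI / 2)) by (eapply is_derive_continuity_pt; now apply jacobi_real).
    assert (Z : cR L (PI / 2) = 0).
    { destruct (jacobi_real L (PI / 2) HL) as [Ec _]. rewrite sR_PI2 in Ec by exact HL. nra. }
    set (B := Rabs M + 1). assert (HB : 0 < B) by (unfold B; generalize (Rabs_pos M); lra).
    destruct (C1 (/ (2 * B))) as [d1 [Hd1 K1]]; [apply Rinv_0_lt_compat; lra|].
    destruct (C2 (1 / 2)) as [d2 [Hd2 K2]]; [lra|].
    set (e := Rmin (PI / 4) (Rmin (d1 / 2) (d2 / 2))).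
    assert (He : 0 < e /\ e < d1 /\ e < d2 /\ e < PI / 2).
    { unfold e. generalize (Rmin_l (PI / 4) (Rmin (d1 / 2) (d2 / 2))) (Rmin_r (PI / 4) (Rmin (d1 / 2) (d2 / 2)))
       (Rmin_l (d1 / 2) (d2 / 2)) (Rmin_r (d1 / 2) (d2 / 2)). intros.
      split; [repeat apply Rmin_pos; lra|lra]. }
    assert (Q : forall d, e < d -> D_x no_cond (PI / 2) (PI / 2 - e) /\ dist R_met (PI / 2 - e) (PI / 2) < d).
    { intros d Hd. split; [split; [exact I|lra]|]. simpl. unfold R_dist.
      replace (PI / 2 - e - PI / 2) with (- e) by ring. rewrite Rabs_Ropp, Rabs_pos_eq; lra. }
    exists (PI / 2 - e). split; [lra|].
    assert (X1 := K1 _ (Q d1 ltac:(lra))). assert (X2 := K2 _ (Q d2 ltac:(lra))).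
    simpl in X1, X2. unfold R_dist in X1, X2. rewrite Z, Rminus_0_r in X1. rewrite sR_PI2 in X2 by exact HL.
    apply Rabs_def2 in X1. apply Rabs_def2 in X2.
    assert (Pc : 0 < cR L (PI / 2 - e)) by (apply cR_pos; lra).
    apply Rle_lt_trans with (Rabs M); [apply Rle_abs|].
    apply Rmult_lt_reg_r with (cR L (PI / 2 - e)); auto.
    unfold Rdiv. rewrite Rmult_assoc, Rinv_l by lra.
    assert (B * cR L (PI / 2 - e) < 1 / 2).
    { destruct X1 as [X1 _]. apply (Rmult_lt_compat_l B) in X1; auto.
      replace (B * / (2 * B)) with (1 / 2) in X1 by (field; lra). exact X1. }
    unfold B in *. nra.
Qed.

Lemma sI_nonneg (L y : R) : 0 < L -> 0 <= y < L / 2 -> 0 <= sI L y.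
Proof.
  intros HL Hy. destruct (Req_dec y 0) as [->|Hn]; [rewrite sI_0; auto; lra|].
  destruct (MVT_open (sI L) (fun y => lam L * (cI L y * dI L y)) 0 y) as [c [Hc E]]; [lra| | |].
  - intros x Hx. apply jacobi_imag; auto; lra.
  - intros x Hx. eapply is_derive_continuity_pt. apply jacobi_imag; auto; lra.
  - rewrite sI_0 in E by exact HL.
    assert (0 < cI L c) by (apply cI_pos; auto; lra). assert (0 < dI L c) by (apply dI_pos; auto; lra).
    assert (HP := lam_pos L HL).
    assert (0 < lam L * (cI L c * dI L c)) by (apply Rmult_lt_0_compat; [exact HP|now apply Rmult_lt_0_compat]).
    rewrite Rminus_0_r, Rminus_0_r in E. rewrite E. apply Rmult_le_pos; lra.
Qed.

(** The blow-up is shown for [cI], whose numerator theta_2 is a sum of positive terms on the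
    imaginary axis while theta_4 tends to 0; it passes to [sI] by cI^2 = 1 + sI^2. *)
Lemma sI_unbounded (L M : R) : 0 < L -> exists y, 0 <= y < L / 2 /\ M < sI L y.
Proof.
  intros HL. set (B := Rabs M + 2). assert (HB : 2 <= B) by (unfold B; generalize (Rabs_pos M); lra).
  set (w := t4 L 0 / t2 L 0).
  assert (Hw : 0 < w) by (apply Rdiv_lt_0_compat; [now apply t4_pos|now apply t2_0_pos]).
  assert (P2 := i2_pos L (L / 2) HL).
  assert (C2 : continuity_pt (i2 L) (L / 2)) by (apply ex_derive_continuity_pt; exact (proj1 (proj2 (i_ex_derive L _ HL)))).
  assert (C4 : continuity_pt (i4 L) (L / 2)) by (apply ex_derive_continuity_pt; exact (proj2 (proj2 (proj2 (i_ex_derive L _ HL))))).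
  set (z := w * (i2 L (L / 2) / 2) / B).
  assert (Hz : 0 < z) by (unfold z; apply Rdiv_lt_0_compat; [apply Rmult_lt_0_compat|]; lra).
  destruct (C4 z Hz) as [d1 [Hd1 K1]].
  destruct (C2 (i2 L (L / 2) / 2)) as [d2 [Hd2 K2]]; [lra|].
  set (e := Rmin (L / 4) (Rmin (d1 / 2) (d2 / 2))).
  assert (He : 0 < e /\ e < d1 /\ e < d2 /\ e < L / 2).
  { unfold e. generalize (Rmin_l (L / 4) (Rmin (d1 / 2) (d2 / 2))) (Rmin_r (L / 4) (Rmin (d1 / 2) (d2 / 2)))
     (Rmin_l (d1 / 2) (d2 / 2)) (Rmin_r (d1 / 2) (d2 / 2)). intros.
    split; [repeat apply Rmin_pos; lra|lra]. }
  assert (Q : forall d, e < d -> D_x no_cond (L / 2) (L / 2 - e) /\ dist R_met (L / 2 - e) (L / 2) < d).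
  { intros d Hd. split; [split; [exact I|lra]|]. simpl. unfold R_dist.
    replace (L / 2 - e - L / 2) with (- e) by ring. rewrite Rabs_Ropp, Rabs_pos_eq; lra. }
  exists (L / 2 - e). split; [lra|].
  assert (X1 := K1 _ (Q d1 ltac:(lra))). assert (X2 := K2 _ (Q d2 ltac:(lra))).
  simpl in X1, X2. unfold R_dist in X1, X2. rewrite i4_half, Rminus_0_r in X1 by exact HL.
  apply Rabs_def2 in X1. apply Rabs_def2 in X2.
  assert (Hy : - (L / 2) < L / 2 - e < L / 2) by lra.
  assert (P4 := i4_pos L _ HL Hy).
  assert (Hc : B < cI L (L / 2 - e)).
  { unfold cI. fold w. apply Rmult_lt_reg_r with (i4 L (L / 2 - e)); auto.
    replace (w * (i2 L (L / 2 - e) / i4 L (L / 2 - e)) * i4 L (L / 2 - e)) with (w * i2 L (L / 2 - e)) by (field; lra).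
    apply Rlt_trans with (B * z); [apply Rmult_lt_compat_l; lra|].
    unfold z. replace (B * (w * (i2 L (L / 2) / 2) / B)) with (w * (i2 L (L / 2) / 2)) by (field; lra).
    apply Rmult_lt_compat_l; lra. }
  destruct (jacobi_imag L _ HL Hy) as [Ec _].
  assert (S0 : 0 <= sI L (L / 2 - e)) by (apply sI_nonneg; lra).
  apply Rle_lt_trans with (Rabs M); [apply Rle_abs|].
  assert (0 <= Rabs M) by apply Rabs_pos. unfold B in *. nra.
Qed.

Lemma kprime_sq (k : R) : 0 < k < 1 -> kprime k ^ 2 = 1 - k ^ 2.
Proof. intros Hk. unfold kprime. rewrite pow2_sqrt; nra. Qed.

(** Jacobi's imaginary transformation: sn(i u, k) / i is sn/cn of modulus k', so its equation is
    that of the inversion lemma with k and k' exchanged. *)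
Lemma ellK_kprime_kap (L : R) : 0 < L -> ellK (kprime (kap L)) = lam L * (L / 2).
Proof.
  intros HL. assert (Hk := kap_bounds L HL).
  apply (ellK_inversion (kprime (kap L)) (lam L) (L / 2) (sI L)).
  - rewrite kprime_sq; nra.
  - now apply lam_pos.
  - lra.
  - now apply sI_0.
  - intros y Hy. assert (Hy' : - (L / 2) < y < L / 2) by lra.
    destruct (jacobi_imag L y HL Hy') as [Ec [Ed Ds]].
    rewrite kprime_sq by exact Hk. replace (1 - (1 - kap L ^ 2)) with (kap L ^ 2) by ring.
    rewrite <- Ec, <- Ed. rewrite sqrt_mult, !sqrt_pow2 by (try apply pow2_ge_0; left; auto using cI_pos, dI_pos).
    exact Ds.
  - intros M. now apply sI_unbounded.
Qed.

(** * The nome determines the modulus *)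

Lemma ellK_lt (k1 k2 : R) : 0 <= k1 -> k1 < k2 -> k2 < 1 -> ellK k1 < ellK k2.
Proof.
  intros H0 H1 H2. assert (PP := PI_RGT_0).
  apply (RInt_lt (ell_integrand k1) (ell_integrand k2)); [lra| | |].
  - intros x _. apply ell_integrand_continuous. nra.
  - intros x _. apply ell_integrand_continuous. nra.
  - intros x Hx. assert (0 < sin x) by (apply sin_gt_0; lra).
    assert (Q1 := ell_radicand_pos k2 x ltac:(nra)).
    apply Rinv_lt_contravar.
    + apply Rmult_lt_0_compat; apply sqrt_lt_R0; apply ell_radicand_pos; nra.
    + apply sqrt_lt_1_alt. split; [lra|]. assert (HS : 0 < sin x ^ 2) by nra. assert (HK : k1 ^ 2 < k2 ^ 2) by nra.
      apply (Rmult_lt_compat_r _ _ _ HS) in HK. lra.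
Qed.

Lemma ellK_pos (k : R) : 0 <= k < 1 -> 0 < ellK k.
Proof.
  intros Hk. change (ellK k) with (eF k (PI / 2)). rewrite <- (eF_0 k).
  apply eF_lt; [nra|]. generalize PI_RGT_0; lra.
Qed.

Lemma kprime_bounds (k : R) : 0 < k < 1 -> 0 < kprime k < 1.
Proof.
  intros Hk. unfold kprime. split; [apply sqrt_lt_R0; nra|].
  rewrite <- sqrt_1 at 2. apply sqrt_lt_1_alt. nra.
Qed.

Lemma nome_lt (k1 k2 : R) : 0 < k1 -> k1 < k2 -> k2 < 1 -> nome k1 < nome k2.
Proof.
  intros H0 H1 H2. unfold nome. apply exp_increasing.
  assert (P1 := ellK_pos k1 ltac:(lra)). assert (P2 := ellK_lt k1 k2 ltac:(lra) H1 H2).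
  assert (B1 := kprime_bounds k1 ltac:(lra)). assert (B2 := kprime_bounds k2 ltac:(lra)).
  assert (KP : kprime k2 < kprime k1) by (unfold kprime; apply sqrt_lt_1_alt; nra).
  assert (Q1 := ellK_pos (kprime k2) ltac:(lra)).
  assert (Q2 := ellK_lt (kprime k2) (kprime k1) ltac:(lra) KP ltac:(lra)).
  assert (PP := PI_RGT_0).
  apply Rmult_lt_reg_r with (ellK k1 * ellK k2); [apply Rmult_lt_0_compat; lra|].
  replace (- PI * ellK (kprime k1) / ellK k1 * (ellK k1 * ellK k2)) with (- (PI * (ellK (kprime k1) * ellK k2))) by (field; lra).
  replace (- PI * ellK (kprime k2) / ellK k2 * (ellK k1 * ellK k2)) with (- (PI * (ellK (kprime k2) * ellK k1))) by (field; lra).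
  apply Ropp_lt_contravar, Rmult_lt_compat_l; auto.
  apply Rmult_gt_0_lt_compat; lra.
Qed.

Lemma nome_kap (L : R) : 0 < L -> nome (kap L) = exp (- L).
Proof.
  intros HL. unfold nome. rewrite ellK_kprime_kap, ellK_kap by exact HL.
  f_equal. field. split; [apply Rgt_not_eq, PI_RGT_0|]. generalize (lam_pos L HL); lra.
Qed.

(* [L] encodes the nome of the modulus [k]: q = exp (-L). *)
Definition modulus_of (k L : R) : Prop :=
  0 < L /\ kap L = k /\ nome k = exp (- L) /\
  ellK k = lam L * (PI / 2) /\ ellK (kprime k) = lam L * (L / 2).

(** Surjectivity of [kap] follows from injectivity of the nome: with L = pi K'/K, the moduli k and
    [kap L] have the same nome exp(- L). *)
Lemma theta_modulus (k : R) : 0 < k < 1 -> exists L, modulus_of k L.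
Proof.
  intros Hk. set (L := PI * ellK (kprime k) / ellK k).
  assert (PP := PI_RGT_0). assert (P1 := ellK_pos k ltac:(lra)).
  assert (P2 : 0 < ellK (kprime k)) by (apply ellK_pos; generalize (kprime_bounds k Hk); lra).
  assert (HL : 0 < L) by (unfold L; apply Rdiv_lt_0_compat; nra).
  assert (N : nome k = exp (- L)) by (unfold nome, L; f_equal; field; lra).
  assert (E : kap L = k).
  { assert (B := kap_bounds L HL). assert (N' := nome_kap L HL).
    destruct (Rtotal_order (kap L) k) as [H|[H|H]]; auto.
    - generalize (nome_lt (kap L) k ltac:(lra) H ltac:(lra)). lra.
    - generalize (nome_lt k (kap L) ltac:(lra) H ltac:(lra)). lra. }
  exists L. unfold modulus_of. rewrite <- E at 3 4. repeat split; auto; [now apply ellK_kap|now apply ellK_kprime_kap].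
Qed.

Lemma sR_lt (L a b : R) : 0 < L -> - PI / 2 <= a -> a < b -> b <= PI / 2 -> sR L a < sR L b.
Proof.
  intros HL Ha Hab Hb.
  destruct (MVT_open (sR L) (fun x => lam L * (cR L x * dR L x)) a b Hab) as [c [Hc E]].
  - intros; now apply jacobi_real.
  - intros; eapply is_derive_continuity_pt; now apply jacobi_real.
  - assert (P : 0 < lam L * (cR L c * dR L c)).
    { apply Rmult_lt_0_compat; [now apply lam_pos|]. apply Rmult_lt_0_compat; [|now apply dR_pos].
      apply cR_pos; auto; lra. }
    assert (0 < lam L * (cR L c * dR L c) * (b - a)) by (apply Rmult_lt_0_compat; lra). lra.
Qed.

Lemma sI_lt (L a b : R) : 0 < L -> - (L / 2) < a -> a < b -> b < L / 2 -> sI L a < sI L b.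
Proof.
  intros HL Ha Hab Hb.
  destruct (MVT_open (sI L) (fun x => lam L * (cI L x * dI L x)) a b Hab) as [c [Hc E]].
  - intros; apply jacobi_imag; auto; lra.
  - intros; eapply is_derive_continuity_pt; apply jacobi_imag; auto; lra.
  - assert (P : 0 < lam L * (cI L c * dI L c)).
    { apply Rmult_lt_0_compat; [now apply lam_pos|].
      apply Rmult_lt_0_compat; [apply cI_pos|apply dI_pos]; auto; lra. }
    assert (0 < lam L * (cI L c * dI L c) * (b - a)) by (apply Rmult_lt_0_compat; lra). lra.
Qed.

Lemma sR_surj (L v : R) : 0 < L -> 0 < v < 1 -> exists x, 0 < x < PI / 2 /\ sR L x = v.
Proof.
  intros HL Hv. assert (PP := PI_RGT_0).
  destruct (IVT_interv (fun x => sR L x - v) 0 (PI / 2)) as [x [Hx E]].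
  - intros a _. apply continuity_pt_minus; [|apply continuity_pt_const; intros ? ?; reflexivity].
    eapply is_derive_continuity_pt. now apply jacobi_real.
  - lra.
  - rewrite sR_0 by exact HL. lra.
  - rewrite sR_PI2 by exact HL. lra.
  - exists x. split; [|lra].
    assert (x <> 0) by (intros ->; rewrite sR_0 in E by exact HL; lra).
    assert (x <> PI / 2) by (intros ->; rewrite sR_PI2 in E by exact HL; lra). lra.
Qed.

Lemma sI_surj (L v : R) : 0 < L -> 0 < v -> exists y, 0 < y < L / 2 /\ sI L y = v.
Proof.
  intros HL Hv. destruct (sI_unbounded L v HL) as [z [Hz Hvz]].
  assert (Hz0 : 0 < z).
  { destruct (Req_dec z 0) as [->|]; [|lra]. rewrite sI_0 in Hvz by exact HL. lra. }
  destruct (IVT_interv (fun x => sI L x - v) 0 z) as [x [Hx E]].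
  - intros a Ha. apply continuity_pt_minus; [|apply continuity_pt_const; intros ? ?; reflexivity].
    eapply is_derive_continuity_pt. apply jacobi_imag; auto; lra.
  - lra.
  - rewrite sI_0 by exact HL. lra.
  - lra.
  - exists x. split; [|lra].
    destruct (Req_dec x 0) as [->|N0]; [rewrite sI_0 in E by exact HL; lra|lra].
Qed.

(** * [sn], [Hth] and [Theta] of modulus k *)

Section Jacobi.
Variables k L : R.
Hypothesis Hm : modulus_of k L.

Let HL : 0 < L. Proof. apply Hm. Qed.
Let Hlam : 0 < lam L. Proof. exact (lam_pos L HL). Qed.

(** The rescaling by pi/(2 K) = 1/lam, not Jacobi's quotient sn/cn. *)
Definition sc (z : C) : C := (RtoC (/ lam L) * z)%C.

Lemma sc_ellK z : (RtoC (PI / (2 * ellK k)) * z)%C = sc z.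
Proof.
  unfold sc. destruct Hm as [_ [_ [_ [E _]]]]. rewrite E. do 2 f_equal. field.
  split; [lra|apply PI_neq0].
Qed.

Lemma Hth_th1 z : Hth k z = th1 L (sc z).
Proof.
  unfold Hth. rewrite sc_ellK. destruct Hm as [_ [_ [E _]]]. rewrite E. now apply theta1_th1.
Qed.

Lemma Theta_th4 z : Theta k z = th4 L (sc z).
Proof.
  unfold Theta. rewrite sc_ellK. destruct Hm as [_ [_ [E _]]]. rewrite E. now apply theta4_th4.
Qed.

Lemma theta_ratio : theta3_0 (nome k) / theta2_0 (nome k) = t3 L 0 / t2 L 0.
Proof.
  destruct Hm as [_ [_ [E _]]]. rewrite E.
  destruct (th_at_0 L HL) as [Z2 [Z3 _]].
  rewrite <- theta2_0_th2 in Z2 by exact HL. rewrite <- theta3_0_th3 in Z3 by exact HL.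
  apply RtoC_fst in Z2, Z3. now rewrite Z2, Z3.
Qed.

Lemma sn_th z : sn k z = (RtoC (t3 L 0 / t2 L 0) * th1 L (sc z) / th4 L (sc z))%C.
Proof. unfold sn. now rewrite theta_ratio, Hth_th1, Theta_th4. Qed.

Lemma sc_real x : sc (x, 0) = (x / lam L, 0).
Proof. unfold sc. apply injective_projections; simpl; field; lra. Qed.

Lemma sc_imag y : sc (0, y) = (0, y / lam L).
Proof. unfold sc. apply injective_projections; simpl; field; lra. Qed.

Lemma sn_real x : sn k (RtoC x) = RtoC (sR L (x / lam L)).
Proof.
  rewrite sn_th. unfold RtoC at 2 3. rewrite sc_real.
  destruct (th_real L (x / lam L) HL) as [A1 [_ [_ A4]]]. rewrite A1, A4.
  assert (P := t4_pos L (x / lam L) HL).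
  rewrite <- RtoC_mult, <- RtoC_div by lra. f_equal. unfold sR. field.
  generalize (t2_0_pos L HL). lra.
Qed.

Lemma sn_imag y : 0 <= y < ellK (kprime k) -> sn k (0, y) = (0, sI L (y / lam L)).
Proof.
  intros Hy. destruct Hm as [_ [_ [_ [_ E]]]]. rewrite E in Hy.
  assert (Hy' : - (L / 2) < y / lam L < L / 2).
  { split.
    - apply Rlt_le_trans with 0; [lra|]. apply Rmult_le_pos; [lra|]. left. now apply Rinv_0_lt_compat.
    - apply Rmult_lt_reg_r with (lam L); auto. unfold Rdiv at 1. rewrite Rmult_assoc, Rinv_l; lra. }
  rewrite sn_th, sc_imag. destruct (th_imag L (y / lam L) HL) as [A1 [_ [_ A4]]]. rewrite A1, A4.
  assert (P := i4_pos L _ HL Hy'). unfold Cdiv. rewrite <- RtoC_inv by lra.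
  rewrite imag_scal, imag_scal_r. f_equal. unfold sI, Rdiv. ring.
Qed.

Lemma sn_range_real x : 0 < x < ellK k <-> 0 < x / lam L < PI / 2.
Proof.
  destruct Hm as [_ [_ [_ [E _]]]]. rewrite E. split; intros [H1 H2]; split.
  - now apply Rdiv_lt_0_compat.
  - apply Rmult_lt_reg_r with (lam L); auto. unfold Rdiv at 1. rewrite Rmult_assoc, Rinv_l; lra.
  - replace x with (x / lam L * lam L) by (field; lra). now apply Rmult_lt_0_compat.
  - replace x with (x / lam L * lam L) by (field; lra). rewrite (Rmult_comm (lam L)). now apply Rmult_lt_compat_r.
Qed.

Lemma sn_range_imag y : 0 < y < ellK (kprime k) <-> 0 < y / lam L < L / 2.
Proof.
  destruct Hm as [_ [_ [_ [_ E]]]]. rewrite E. split; intros [H1 H2]; split.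
  - now apply Rdiv_lt_0_compat.
  - apply Rmult_lt_reg_r with (lam L); auto. unfold Rdiv at 1. rewrite Rmult_assoc, Rinv_l; lra.
  - replace y with (y / lam L * lam L) by (field; lra). now apply Rmult_lt_0_compat.
  - replace y with (y / lam L * lam L) by (field; lra). rewrite (Rmult_comm (lam L)). now apply Rmult_lt_compat_r.
Qed.

Lemma sn_real_bijective v : 0 < v < 1 ->
  exists! x, 0 < x < ellK k /\ sn k (RtoC x) = RtoC v.
Proof.
  intros Hv. destruct (sR_surj L v HL Hv) as [x [Hx E]].
  assert (X : x * lam L / lam L = x) by (field; lra).
  exists (x * lam L). split.
  - split; [apply sn_range_real; now rewrite X|]. now rewrite sn_real, X, E.
  - intros y [Hy Ey]. rewrite sn_real in Ey. apply RtoC_fst in Ey. apply sn_range_real in Hy.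
    replace y with (y / lam L * lam L) by (field; lra). f_equal.
    assert (PP := PI_RGT_0).
    destruct (Rtotal_order x (y / lam L)) as [H|[H|H]]; auto; exfalso;
    [generalize (sR_lt L x (y / lam L) HL)|generalize (sR_lt L (y / lam L) x HL)]; lra.
Qed.

Lemma sn_imag_bijective v : 0 < v ->
  exists! y, 0 < y < ellK (kprime k) /\ sn k (0, y) = (0, v).
Proof.
  intros Hv. destruct (sI_surj L v HL Hv) as [x [Hx E]].
  assert (X : x * lam L / lam L = x) by (field; lra).
  assert (HX : 0 < x * lam L < ellK (kprime k)) by (apply sn_range_imag; now rewrite X).
  exists (x * lam L). split.
  - split; auto. rewrite sn_imag, X, E by lra. reflexivity.
  - intros y [Hy Ey]. rewrite sn_imag in Ey by lra. assert (Ey' := f_equal snd Ey). simpl in Ey'.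
    apply sn_range_imag in Hy.
    replace y with (y / lam L * lam L) by (field; lra). f_equal.
    destruct (Rtotal_order x (y / lam L)) as [H|[H|H]]; auto; exfalso;
    [generalize (sI_lt L x (y / lam L) HL)|generalize (sI_lt L (y / lam L) x HL)]; lra.
Qed.

Lemma sc_minus x y : sc (x - y) = (sc x - sc y)%C.
Proof. unfold sc. ring. Qed.

Lemma sc_plus x y : sc (x + y) = (sc x + sc y)%C.
Proof. unfold sc. ring. Qed.

Lemma sc_0 : sc 0 = 0%C.
Proof. unfold sc. ring. Qed.

Lemma kap_theta : RtoC k = ((th2 L 0 * th2 L 0) / (th3 L 0 * th3 L 0))%C.
Proof.
  destruct (th_at_0 L HL) as [Z2 [Z3 _]]. rewrite Z2, Z3, <- !RtoC_mult.
  generalize (t3_0_pos L HL). intros.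
  rewrite <- RtoC_div by nra. f_equal. destruct Hm as [_ [E _]]. rewrite <- E. unfold kap. f_equal; ring.
Qed.

Lemma RtoC_ne0 x : x <> 0 -> RtoC x <> 0%C.
Proof. intros H E. apply H. exact (f_equal fst E). Qed.

Lemma theta_const_ne0 : th2 L 0 <> 0%C /\ th3 L 0 <> 0%C /\ th4 L 0 <> 0%C.
Proof.
  destruct (th_at_0 L HL) as [Z2 [Z3 Z4]]. rewrite Z2, Z3, Z4.
  generalize (t2_0_pos L HL) (t3_0_pos L HL) (t4_pos L 0 HL). intros.
  repeat split; apply RtoC_ne0; lra.
Qed.

Lemma sn_theta_constants z : sn k z = (th3 L 0 / th2 L 0 * th1 L (sc z) / th4 L (sc z))%C.
Proof.
  rewrite sn_th. destruct (th_at_0 L HL) as [Z2 [Z3 Z4]]. rewrite Z2, Z3, RtoC_div; auto.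
  generalize (t2_0_pos L HL). lra.
Qed.

Lemma Theta_real_ne0 x : Theta k (RtoC x) <> 0%C.
Proof.
  rewrite Theta_th4. unfold RtoC. rewrite sc_real.
  destruct (th_real L (x / lam L) HL) as [_ [_ [_ ->]]].
  apply RtoC_ne0. now apply t4_ne0.
Qed.

Lemma Theta_product_real x y :
  (Theta k (RtoC x - RtoC y) * Theta k (RtoC x + RtoC y) * (th4 L 0 * th4 L 0) =
   Theta k (RtoC x) * Theta k (RtoC x) * (Theta k (RtoC y) * Theta k (RtoC y)) *
   (1 - RtoC (k ^ 2) * (sn k (RtoC x) * sn k (RtoC x)) * (sn k (RtoC y) * sn k (RtoC y))))%C.
Proof.
  assert (N1 := Theta_real_ne0 x). assert (N2 := Theta_real_ne0 y).
  destruct theta_const_ne0 as [C2 [C3 C4]].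
  replace (RtoC (k ^ 2)) with (RtoC k * RtoC k)%C by (rewrite <- RtoC_mult; f_equal; ring).
  rewrite kap_theta, !sn_theta_constants. rewrite !Theta_th4 in *.
  rewrite sc_minus, sc_plus, (Cmult_comm (th4 L (_ - _))).
  rewrite th4_addition by exact HL. field. auto.
Qed.

(** The arguments are complex, which lets [y] be an imaginary beta; hence nonvanishing of [Theta] is
    assumed rather than derived from reality. *)
Lemma Hth_product z y :
  Theta k z <> 0%C -> Theta k y <> 0%C ->
  (Hth k (z - y) * Hth k (z + y) * (th4 L 0 * th4 L 0) =
   Theta k z * Theta k z * (Theta k y * Theta k y) * RtoC k *
   (sn k z * sn k z - sn k y * sn k y))%C.
Proof.
  intros N1 N2. destruct theta_const_ne0 as [C2 [C3 C4]].
  rewrite kap_theta, !sn_theta_constants. rewrite !Theta_th4 in *. rewrite !Hth_th1.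
  rewrite sc_minus, sc_plus, (Cmult_comm (th1 L (_ - _))).
  rewrite th1_addition by exact HL. field. auto.
Qed.

Lemma Hth_sn z : Theta k z <> 0%C -> (Hth k z * Hth k z = RtoC k * (sn k z * sn k z) * (Theta k z * Theta k z))%C.
Proof.
  intros N. destruct theta_const_ne0 as [C2 [C3 C4]].
  rewrite kap_theta, !sn_theta_constants, Hth_th1. rewrite !Theta_th4 in *. field. auto.
Qed.

(** The inverse of 0 in [C] is 0, so at a zero of [Theta] the quotient [sn] takes the default value
    0. A nonzero prescribed value of sn(beta) thus excludes such a zero. *)
Lemma sn_ne0_Theta z : sn k z <> 0%C -> Theta k z <> 0%C.
Proof.
  intros N E. apply N. unfold sn. rewrite E. unfold Cdiv.
  replace (/ 0)%C with (RtoC 0).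
  - ring.
  - apply injective_projections; simpl; unfold Rdiv; ring.
Qed.
End Jacobi.

(** * The differential equation *)

Definition traj (b c : R) (f f1 : R -> R) : Prop :=
  forall x, is_derive f x (f1 x) /\ is_derive f1 x (2 * f x ^ 3 - c * f x + b).

Lemma traj_of_ode b c phi : ode_solution b c phi -> traj b c phi (Derive phi).
Proof.
  intros H x. destruct (H x) as [H1 [H2 H3]]. split; [now apply Derive_correct|].
  replace (2 * phi x ^ 3 - c * phi x + b) with (Derive (Derive phi) x).
  - now apply Derive_correct.
  - change (Derive_n phi 2 x) with (Derive (Derive phi) x) in H3. lra.
Qed.

Lemma ode_of_traj b c f f1 : traj b c f f1 -> ode_solution b c f.
Proof.
  intros H x.
  assert (E : forall y, Derive f y = f1 y) by (intros y; apply is_derive_unique, H).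
  assert (H2 : is_derive (Derive f) x (2 * f x ^ 3 - c * f x + b)).
  { apply is_derive_ext with (1 := fun y => eq_sym (E y)). apply H. }
  split; [exists (f1 x); exact (proj1 (H x))|]. split; [eexists; exact H2|].
  change (Derive_n f 2 x) with (Derive (Derive f) x). rewrite (is_derive_unique _ _ _ H2). ring.
Qed.

Lemma constant_of_derive_0 (f : R -> R) : (forall x, is_derive f x 0) -> forall x, f x = f 0.
Proof.
  intros H x. assert (C : forall a b, a < b -> f b = f a).
  { intros a b Hab. destruct (MVT_open f (fun _ => 0) a b Hab) as [c [_ E]]; [auto| |lra].
    intros y _. now apply is_derive_continuity_pt with 0. }
  destruct (Rtotal_order x 0) as [Hx|[->|Hx]]; auto.
  symmetry. auto.
Qed.

Lemma traj_invariant b c f f1 : traj b c f f1 ->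
  forall x, f1 x ^ 2 - f x ^ 4 + c * f x ^ 2 - 2 * b * f x =
            f1 0 ^ 2 - f 0 ^ 4 + c * f 0 ^ 2 - 2 * b * f 0.
Proof.
  intros H. apply (constant_of_derive_0 (fun x => f1 x ^ 2 - f x ^ 4 + c * f x ^ 2 - 2 * b * f x)).
  intros x. destruct (H x) as [H1 H2]. auto_derive.
  - repeat split; eexists; eassumption.
  - change (fun x => f x) with f. change (fun x => f1 x) with f1.
    rewrite (is_derive_unique _ _ _ H1), (is_derive_unique _ _ _ H2). ring.
Qed.

(** E exp(B t) is nondecreasing and E exp(- B t) nonincreasing; the first is used to the left of 0,
    the second to the right. *)
Lemma gronwall_zero (E E1 : R -> R) (B : R) : (forall x, 0 <= E x) -> E 0 = 0 ->
  (forall x, is_derive E x (E1 x)) -> (forall x, Rabs (E1 x) <= B * E x) -> forall x, E x = 0.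
Proof.
  intros Hp H0 Hd HB x.
  assert (K : forall s y, is_derive (fun t => E t * exp (s * t)) y ((E1 y + s * E y) * exp (s * y))).
  { intros s y. auto_derive; [eexists; apply Hd|]. change (fun x => E x) with E.
    rewrite (is_derive_unique _ _ _ (Hd y)). ring. }
  destruct (Rtotal_order x 0) as [Hx|[->|Hx]]; auto.
  - destruct (MVT_open (fun t => E t * exp (B * t)) (fun y => (E1 y + B * E y) * exp (B * y)) x 0 Hx) as [z [_ Z]].
    + intros; apply K.
    + intros; eapply is_derive_continuity_pt; apply K.
    + rewrite H0 in Z. specialize (HB z). apply Rabs_le_between in HB.
      generalize (exp_pos (B * z)) (exp_pos (B * x)) (Hp x). intros P1 P2 P3.
      assert (0 <= (E1 z + B * E z) * exp (B * z)) by (apply Rmult_le_pos; lra).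
      assert (0 <= (E1 z + B * E z) * exp (B * z) * (0 - x)) by (apply Rmult_le_pos; lra).
      assert (E x * exp (B * x) <= 0) by lra. nra.
  - destruct (MVT_open (fun t => E t * exp (- B * t)) (fun y => (E1 y + - B * E y) * exp (- B * y)) 0 x Hx) as [z [_ Z]].
    + intros; apply K.
    + intros; eapply is_derive_continuity_pt; apply K.
    + rewrite H0 in Z. specialize (HB z). apply Rabs_le_between in HB.
      generalize (exp_pos (- B * z)) (exp_pos (- B * x)) (Hp x). intros P1 P2 P3.
      assert (0 <= (B * E z - E1 z) * exp (- B * z)) by (apply Rmult_le_pos; lra).
      assert (0 <= (B * E z - E1 z) * exp (- B * z) * (x - 0)) by (apply Rmult_le_pos; lra).
      assert (E x * exp (- B * x) <= 0) by lra. nra.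
Qed.

(** The cubic is only locally Lipschitz; the bounds on both solutions supply the constant for
    Gronwall. *)
Lemma traj_unique b c f f1 g g1 : traj b c f f1 -> traj b c g g1 ->
  bounded_fun f -> bounded_fun g -> f 0 = g 0 -> f1 0 = g1 0 -> forall x, f x = g x.
Proof.
  intros Hf Hg [M1 HM1] [M2 HM2] H0 H1 x.
  set (w := fun x => f x - g x). set (v := fun x => f1 x - g1 x).
  (* Factoring f^3 - g^3 gives w' = v and v' = h w, so w^2 + v^2 has derivative 2 w v (1 + h). With
     |f|, |g| <= M the last factor is at most 6 M^2 + |c| + 1. *)
  set (h := fun x => 2 * (f x ^ 2 + f x * g x + g x ^ 2) - c).
  set (M := Rabs M1 + Rabs M2). set (B := 6 * M ^ 2 + Rabs c + 1).
  assert (E : w x ^ 2 + v x ^ 2 = 0).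
  { apply (gronwall_zero (fun x => w x ^ 2 + v x ^ 2) (fun x => 2 * w x * v x * (1 + h x)) B).
    - intros y. generalize (pow2_ge_0 (w y)) (pow2_ge_0 (v y)); lra.
    - unfold w, v. rewrite H0, H1. ring.
    - intros y. unfold w, v. destruct (Hf y) as [F1 F2]. destruct (Hg y) as [G1 G2].
      auto_derive.
      + repeat split; eexists; eassumption.
      + change (fun x => f x) with f. change (fun x => f1 x) with f1.
        change (fun x => g x) with g. change (fun x => g1 x) with g1.
        rewrite (is_derive_unique _ _ _ F1), (is_derive_unique _ _ _ F2),
          (is_derive_unique _ _ _ G1), (is_derive_unique _ _ _ G2). unfold h. ring.
    - intros y. assert (Hh : Rabs (1 + h y) <= B).
      { assert (Bf : - M <= f y <= M).
        { apply Rabs_le_between. eapply Rle_trans; [apply HM1|]. unfold M.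
          generalize (Rle_abs M1) (Rabs_pos M2); lra. }
        assert (Bg : - M <= g y <= M).
        { apply Rabs_le_between. eapply Rle_trans; [apply HM2|]. unfold M.
          generalize (Rle_abs M2) (Rabs_pos M1); lra. }
        assert (Bc := proj1 (Rabs_le_between c (Rabs c)) (Rle_refl _)).
        assert (Q1 : f y ^ 2 <= M ^ 2) by nra. assert (Q2 : g y ^ 2 <= M ^ 2) by nra.
        assert (Q3 : - M ^ 2 <= f y * g y <= M ^ 2) by (split; nra).
        assert (P1 := pow2_ge_0 (f y)). assert (P2 := pow2_ge_0 (g y)).
        apply Rabs_le_between. unfold h, B. lra. }
      rewrite Rabs_mult.
      assert (Rabs (2 * w y * v y) <= w y ^ 2 + v y ^ 2).
      { apply Rabs_le_between. generalize (pow2_ge_0 (w y - v y)) (pow2_ge_0 (w y + v y)). intros. nra. }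
      rewrite (Rmult_comm B). apply Rmult_le_compat; auto; apply Rabs_pos. }
  assert (w x = 0) by (generalize (pow2_ge_0 (w x)) (pow2_ge_0 (v x)); nra).
  unfold w in *. lra.
Qed.

Lemma traj_shift b c f f1 a : traj b c f f1 -> traj b c (fun x => f (x + a)) (fun x => f1 (x + a)).
Proof.
  intros H x. destruct (H (x + a)) as [H1 H2]. split.
  - auto_derive; [eexists; exact H1|]. change (fun x => f x) with f. rewrite (is_derive_unique _ _ _ H1). ring.
  - auto_derive; [eexists; exact H2|]. change (fun x => f1 x) with f1. rewrite (is_derive_unique _ _ _ H2). ring.
Qed.

(** * Extrema of periodic functions *)

Lemma periodic_Z (f : R -> R) (T : R) : (forall x, f (x + T) = f x) -> forall (n : Z) x, f (x + IZR n * T) = f x.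
Proof.
  intros H.
  assert (N : forall (n : nat) x, f (x + INR n * T) = f x).
  { induction n as [|n IH]; intros x; [simpl; f_equal; ring|].
    rewrite S_INR. replace (x + (INR n + 1) * T) with (x + INR n * T + T) by ring. now rewrite H. }
  intros n x. destruct (Z_le_gt_dec 0 n) as [Hn|Hn].
  - rewrite <- (Z2Nat.id n Hn), <- INR_IZR_INZ. apply N.
  - rewrite <- (N (Z.to_nat (- n)) (x + IZR n * T)). f_equal.
    rewrite INR_IZR_INZ, Z2Nat.id by lia. rewrite opp_IZR. ring.
Qed.

Lemma periodic_min (f : R -> R) : (forall x, continuity_pt f x) -> periodic_fun f ->
  exists m, forall x, f m <= f x.
Proof.
  intros Hc [T [HT H]].
  destruct (continuity_ab_min f 0 T) as [m [Hm _]]; [lra|auto|].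
  exists m. intros x. set (n := Int_part (x / T)).
  rewrite <- (periodic_Z f T H (- n) x). apply Hm.
  destruct (base_Int_part (x / T)) as [B1 B2]. fold n in B1, B2. rewrite opp_IZR.
  assert (E : x = x / T * T) by (field; lra).
  split; [assert (IZR n * T <= x / T * T) by (apply Rmult_le_compat_r; lra); lra|].
  assert (x / T * T <= (IZR n + 1) * T) by (apply Rmult_le_compat_r; lra). lra.
Qed.

Lemma periodic_opp f : periodic_fun f -> periodic_fun (fun x => - f x).
Proof. intros [T [HT H]]. exists T. split; auto. intros x. now rewrite H. Qed.

Lemma derive_at_min (f : R -> R) (m l : R) : is_derive f m l -> (forall x, f m <= f x) -> l = 0.
Proof.
  intros Hd Hm. apply is_derive_Reals in Hd.
  assert (E := deriv_minimum f (m - 1) (m + 1) m (exist _ l Hd) ltac:(lra) ltac:(lra) (fun x _ _ => Hm x)).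
  exact E.
Qed.

(** Extends a sign condition to the endpoint of an interval: [A + B t + t ^ 2] is the cofactor of
    the quartic expanded at an extremum of the solution. *)
Lemma quadratic_limit (A B delta : R) : 0 < delta ->
  (forall t, 0 < t < delta -> A + B * t + t ^ 2 <= 0) -> A <= 0.
Proof.
  intros Hd H. apply Rnot_lt_le. intros HA.
  assert (PB := Rabs_pos B).
  set (t := Rmin (delta / 2) (A / (2 * (Rabs B + 1)))).
  assert (Q : 0 < A / (2 * (Rabs B + 1))) by (apply Rdiv_lt_0_compat; lra).
  assert (Ht : 0 < t) by (apply Rmin_pos; lra).
  assert (T1 := Rmin_l (delta / 2) (A / (2 * (Rabs B + 1)))). fold t in T1.
  assert (T2 := Rmin_r (delta / 2) (A / (2 * (Rabs B + 1)))). fold t in T2.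
  specialize (H t ltac:(lra)).
  assert (X : t * (Rabs B + 1) <= A / 2).
  { apply (Rmult_le_compat_r (Rabs B + 1)) in T2; [|lra].
    replace (A / (2 * (Rabs B + 1)) * (Rabs B + 1)) with (A / 2) in T2 by (field; lra). exact T2. }
  assert (- B <= Rabs B) by (rewrite <- Rabs_Ropp; apply Rle_abs).
  nra.
Qed.

(* The minimum and the maximum of a periodic solution are simple roots of the quartic
   u^4 - c u^2 + 2 b u + 2 d, which is nonnegative between them; its quadratic cofactor is therefore
   negative at both and contributes one root on each side. The parameters are the half-sums of roots. *)
Lemma periodic_parameters b c d phi :
  ode_solution b c phi -> bounded_fun phi -> periodic_fun phi -> nonconstant_fun phi ->
  invariant b c d phi ->
  exists z1 z2 z3 xm, z2 < z1 /\ z3 < z2 /\ 0 < z2 + z3 /\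
    b = b_of z1 z2 z3 /\ c = c_of z1 z2 z3 /\ d = d_of z1 z2 z3 /\
    phi xm = z2 + z3 - z1 /\ Derive phi xm = 0.
Proof.
  intros Ho Hb Hp [y1 [y2 Hy]] Hi.
  assert (Ht := traj_of_ode _ _ _ Ho).
  assert (Hc : forall x, continuity_pt phi x) by (intros x; exact (is_derive_continuity_pt _ _ _ (proj1 (Ht x)))).
  destruct (periodic_min phi Hc Hp) as [xm Hm].
  destruct (periodic_min (fun x => - phi x)) as [xM HM].
  { intros x. apply continuity_pt_opp. apply Hc. }
  { now apply periodic_opp. }
  assert (Dm : Derive phi xm = 0) by (apply (derive_at_min phi xm); [apply Ht|exact Hm]).
  assert (DM : Derive phi xM = 0).
  { assert (- Derive phi xM = 0); [|lra].
    apply (derive_at_min (fun x => - phi x) xM); [|exact HM].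
    apply (is_derive_opp phi). apply Ht. }
  set (m := phi xm) in *. set (M := phi xM) in *.
  assert (HmM : m < M).
  { destruct (Rlt_le_dec m M); auto. exfalso. apply Hy.
    generalize (Hm y1) (Hm y2) (HM y1) (HM y2). fold M. lra. }
  (* An extremal value at an equilibrium would make the solution constant, by uniqueness. *)
  assert (NE : forall x0 u, phi x0 = u -> Derive phi x0 = 0 -> 2 * u ^ 3 - c * u + b <> 0).
  { intros x0 u Hu Hd E. apply Hy.
    assert (C : forall x, phi (x + x0) = u).
    { apply (traj_unique b c (fun x => phi (x + x0)) (fun x => Derive phi (x + x0)) (fun _ => u) (fun _ => 0)).
      - now apply traj_shift.
      - intros x. rewrite E. split; apply is_derive_Reals, derivable_pt_lim_const.
      - destruct Hb as [B HB]. exists B. intros; apply HB.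
      - exists (Rabs u). intros; lra.
      - now rewrite Rplus_0_l.
      - now rewrite Rplus_0_l. }
    generalize (C (y1 - x0)) (C (y2 - x0)).
    replace (y1 - x0 + x0) with y1 by ring. replace (y2 - x0 + x0) with y2 by ring. congruence. }
  assert (Nm := NE xm m eq_refl Dm). assert (NM := NE xM M eq_refl DM).
  assert (Qm : m ^ 4 - c * m ^ 2 + 2 * b * m + 2 * d = 0) by (unfold m; rewrite <- Hi, Dm; ring).
  assert (QM : M ^ 4 - c * M ^ 2 + 2 * b * M + 2 * d = 0) by (unfold M; rewrite <- Hi, DM; ring).
  assert (Qp : forall u, m < u < M -> 0 <= u ^ 4 - c * u ^ 2 + 2 * b * u + 2 * d).
  { intros u Hu. destruct (IVT_gen phi xm xM u) as [x [_ Hx]].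
    - intros x. apply Hc.
    - fold m M. rewrite Rmin_left, Rmax_right; lra.
    - rewrite <- Hx, <- Hi. apply pow2_ge_0. }
  set (p := m + M). set (r := p ^ 2 - m * M - c).
  (* The difference of the two root equations, divided by M - m. *)
  assert (Eb : 2 * b = p * (c - M ^ 2 - m ^ 2)).
  { apply Rmult_eq_reg_l with (M - m); [|lra]. unfold p. nra. }
  assert (Ed : 2 * d = - m ^ 4 + c * m ^ 2 - p * (c - M ^ 2 - m ^ 2) * m) by (rewrite <- Eb; lra).
  assert (F : forall u, u ^ 4 - c * u ^ 2 + 2 * b * u + 2 * d = (u - m) * (u - M) * (u ^ 2 + p * u + r)).
  { intros u. rewrite Eb, Ed. unfold r, p. ring. }
  assert (Rneg : forall u, m < u < M -> u ^ 2 + p * u + r <= 0).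
  { intros u Hu. specialize (Qp u Hu). rewrite F in Qp. apply Rnot_lt_le. intros K.
    assert (0 < (u - m) * (M - u) * (u ^ 2 + p * u + r)) by (repeat apply Rmult_lt_0_compat; lra). lra. }
  assert (Rm : m ^ 2 + p * m + r < 0).
  { assert (m ^ 2 + p * m + r <= 0).
    { apply (quadratic_limit _ (2 * m + p) (M - m)); [lra|]. intros t Htt.
      generalize (Rneg (m + t) ltac:(lra)). intros. lra. }
    (* The quartic has derivative 2 (2 u^3 - c u + b), so a double root at [m] would be an
       equilibrium. *)
    assert (m ^ 2 + p * m + r <> 0); [|lra]. intros K. apply Nm.
    assert (2 * (2 * m ^ 3 - c * m + b) = (m - M) * (m ^ 2 + p * m + r)) by
      (replace (2 * (2 * m ^ 3 - c * m + b)) with (4 * m ^ 3 - 2 * c * m + 2 * b) by ring; rewrite Eb; unfold r, p; ring).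
    rewrite K in *. lra. }
  assert (RM : M ^ 2 + p * M + r < 0).
  { assert (M ^ 2 + p * M + r <= 0).
    { apply (quadratic_limit _ (- (2 * M + p)) (M - m)); [lra|]. intros t Htt.
      generalize (Rneg (M - t) ltac:(lra)). intros. lra. }
    assert (M ^ 2 + p * M + r <> 0); [|lra]. intros K. apply NM.
    assert (2 * (2 * M ^ 3 - c * M + b) = (M - m) * (M ^ 2 + p * M + r)) by
      (replace (2 * (2 * M ^ 3 - c * M + b)) with (4 * M ^ 3 - 2 * c * M + 2 * b) by ring; rewrite Eb; unfold r, p; ring).
    rewrite K in *. lra. }
  set (D := p ^ 2 - 4 * r).
  assert (HD : (2 * M + p) ^ 2 < D) by (unfold D; nra).
  assert (HD' : (2 * m + p) ^ 2 < D) by (unfold D; nra).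
  assert (SD : sqrt D * sqrt D = D) by (apply sqrt_sqrt; generalize (pow2_ge_0 (2 * M + p)); lra).
  assert (S0 := sqrt_pos D). set (s := sqrt D) in *.
  assert (U1 : 2 * M + p < s) by nra.
  assert (U2 : - s < 2 * m + p) by nra.
  set (u1 := (- p + s) / 2).
  assert (Eu : u1 ^ 2 + p * u1 + r = 0) by (unfold u1; unfold D in SD; nra).
  assert (Er : r = - (u1 ^ 2 + p * u1)) by lra.
  assert (Ec : c = p ^ 2 - m * M + u1 ^ 2 + p * u1) by (unfold r in Er; lra).
  (* The fourth root is - (m + M + u1), as the cubic term is absent. Then z1 - z2 = (M - m)/2, z2 -
     z3 = (u1 - M)/2, and z2 + z3 is half the gap between [m] and the fourth root. *)
  exists ((u1 + M) / 2), ((u1 + m) / 2), ((m + M) / 2), xm.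
  assert (W : M < u1) by (unfold u1; lra).
  repeat split; try lra.
  - unfold u1, p in *. lra.
  - unfold b_of. apply Rmult_eq_reg_l with 2; [|lra]. rewrite Eb, Ec. unfold p. field.
  - unfold c_of. rewrite Ec. unfold p. field.
  - unfold d_of. apply Rmult_eq_reg_l with 2; [|lra]. rewrite Ed, Ec. unfold p. field.
  - fold m. field.
Qed.

(** c/2, b^2/16 and c^2/16 - d/2 are the elementary symmetric functions of the squares, so both
    triples of squares are the roots of one cubic. Evaluating it at the largest and the smallest
    roots matches the ordered triples. *)
Lemma parameters_unique z1 z2 z3 w1 w2 w3 :
  0 < z3 -> z3 < z2 -> z2 < z1 -> 0 < w3 -> w3 < w2 -> w2 < w1 ->
  b_of z1 z2 z3 = b_of w1 w2 w3 -> c_of z1 z2 z3 = c_of w1 w2 w3 -> d_of z1 z2 z3 = d_of w1 w2 w3 ->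
  z1 = w1 /\ z2 = w2 /\ z3 = w3.
Proof.
  intros Z3 Z2 Z1 W3 W2 W1 Eb Ec Ed. unfold b_of, c_of, d_of in *.
  set (A := z1 ^ 2). set (B := z2 ^ 2). set (C0 := z3 ^ 2).
  set (A' := w1 ^ 2). set (B' := w2 ^ 2). set (C' := w3 ^ 2).
  assert (O1 : C0 < B) by (unfold C0, B; nra). assert (O2 : B < A) by (unfold A, B; nra).
  assert (O1' : C' < B') by (unfold C', B'; nra). assert (O2' : B' < A') by (unfold A', B'; nra).
  assert (S1 : A + B + C0 = A' + B' + C') by (unfold A, B, C0, A', B', C'; lra).
  assert (S3 : A * B * C0 = A' * B' * C').
  { unfold A, B, C0, A', B', C'.
    replace (z1 ^ 2 * z2 ^ 2 * z3 ^ 2) with ((z1 * z2 * z3) ^ 2) by ring.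
    replace (w1 ^ 2 * w2 ^ 2 * w3 ^ 2) with ((w1 * w2 * w3) ^ 2) by ring. f_equal. lra. }
  assert (S2 : A * B + A * C0 + B * C0 = A' * B' + A' * C' + B' * C').
  { assert (Q : 1 / 2 * (A + B + C0) ^ 2 - 2 * (A * B + A * C0 + B * C0) =
                1 / 2 * (A' + B' + C') ^ 2 - 2 * (A' * B' + A' * C' + B' * C')).
    { unfold A, B, C0, A', B', C'. lra. }
    rewrite S1 in Q. lra. }
  assert (K : forall x, (x - A) * (x - B) * (x - C0) = (x - A') * (x - B') * (x - C')).
  { intros x. replace ((x - A) * (x - B) * (x - C0)) with
      (x ^ 3 - (A + B + C0) * x ^ 2 + (A * B + A * C0 + B * C0) * x - A * B * C0) by ring.
    rewrite S1, S2, S3. ring. }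
  assert (EA : A = A').
  { destruct (Rtotal_order A A') as [H|[H|H]]; auto; exfalso.
    - assert (X := K A'). assert (0 < (A' - A) * (A' - B) * (A' - C0)) by (repeat apply Rmult_lt_0_compat; lra).
      replace ((A' - A') * (A' - B') * (A' - C')) with 0 in X by ring. lra.
    - assert (X := K A). assert (0 < (A - A') * (A - B') * (A - C')) by (repeat apply Rmult_lt_0_compat; lra).
      replace ((A - A) * (A - B) * (A - C0)) with 0 in X by ring. lra. }
  assert (EC : C0 = C').
  { destruct (Rtotal_order C0 C') as [H|[H|H]]; auto; exfalso.
    - assert (X := K C0). assert (0 < (A' - C0) * (B' - C0) * (C' - C0)) by (repeat apply Rmult_lt_0_compat; lra).
      replace ((C0 - A) * (C0 - B) * (C0 - C0)) with 0 in X by ring. lra.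
    - assert (X := K C'). assert (0 < (A - C') * (B - C') * (C0 - C')) by (repeat apply Rmult_lt_0_compat; lra).
      replace ((C' - A') * (C' - B') * (C' - C')) with 0 in X by ring. lra. }
  assert (EB : B = B') by lra.
  assert (I : forall x y, 0 < x -> 0 < y -> x ^ 2 = y ^ 2 -> x = y) by (intros; nra).
  unfold A, B, C0, A', B', C' in *. repeat split; apply I; auto; lra.
Qed.

(** * The critical value of b *)

Lemma b_crit_spec c : 0 < c -> 0 < b_crit c /\ b_crit c ^ 2 = 2 * c ^ 3 / 27.
Proof.
  intros Hc. assert (P : 0 < 2 * c ^ 3) by (generalize (pow_lt c 3 Hc); lra).
  assert (S := sqrt_lt_R0 27 ltac:(lra)). assert (S' := sqrt_lt_R0 _ P).
  unfold b_crit. split; [now apply Rdiv_lt_0_compat|].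
  replace ((sqrt (2 * c ^ 3) / sqrt 27) ^ 2) with ((sqrt (2 * c ^ 3) * sqrt (2 * c ^ 3)) / (sqrt 27 * sqrt 27)) by (field; lra).
  rewrite !sqrt_sqrt; lra.
Qed.

Lemma b_crit_iff b c : 0 < c -> (- b_crit c < b < b_crit c <-> 27 * b ^ 2 < 2 * c ^ 3).
Proof.
  intros Hc. destruct (b_crit_spec c Hc) as [P E]. split.
  - intros H. assert (b ^ 2 < b_crit c ^ 2) by nra. lra.
  - intros H. assert (b ^ 2 < b_crit c ^ 2) by lra. split; nra.
Qed.

(* This is AM-GM for the squares of the parameters. *)
Lemma parameters_below_crit z1 z2 z3 : z2 < z1 -> z3 < z2 -> 0 < z2 + z3 ->
  0 < c_of z1 z2 z3 /\ 27 * b_of z1 z2 z3 ^ 2 < 2 * c_of z1 z2 z3 ^ 3.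
Proof.
  intros H1 H2 H3. assert (P2 : 0 < z2) by lra. assert (P1 : 0 < z1) by lra.
  unfold b_of, c_of. set (A := z1 ^ 2). set (B := z2 ^ 2). set (C0 := z3 ^ 2).
  assert (PA : 0 < A) by (unfold A; nra). assert (PB : 0 < B) by (unfold B; nra).
  assert (PC : 0 <= C0) by (unfold C0; nra). assert (AB : B < A) by (unfold A, B; nra).
  split; [lra|].
  replace (27 * (4 * z1 * z2 * z3) ^ 2) with (16 * (27 * A * B * C0)) by (unfold A, B, C0; ring).
  replace (2 * (2 * (A + B + C0)) ^ 3) with (16 * (A + B + C0) ^ 3) by ring.
  apply Rmult_lt_compat_l; [lra|]. apply Rlt_0_minus.
  replace ((A + B + C0) ^ 3 - 27 * A * B * C0) with
    ((A + B + C0) / 2 * (A - B) ^ 2 + (A + B + C0) / 2 * ((B - C0) ^ 2 + (A - C0) ^ 2)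
     + 3 * (A * (B - C0) ^ 2 + B * (A - C0) ^ 2 + C0 * (A - B) ^ 2)) by field.
  assert (0 < (A + B + C0) / 2 * (A - B) ^ 2) by (apply Rmult_lt_0_compat; [lra|nra]).
  assert (0 <= (A + B + C0) / 2 * ((B - C0) ^ 2 + (A - C0) ^ 2)).
  { apply Rmult_le_pos; [lra|]. generalize (pow2_ge_0 (B - C0)) (pow2_ge_0 (A - C0)); lra. }
  assert (0 <= A * (B - C0) ^ 2) by (apply Rmult_le_pos; [lra|apply pow2_ge_0]).
  assert (0 <= B * (A - C0) ^ 2) by (apply Rmult_le_pos; [lra|apply pow2_ge_0]).
  assert (0 <= C0 * (A - B) ^ 2) by (apply Rmult_le_pos; [lra|apply pow2_ge_0]).
  lra.
Qed.

(* With s = c/2 and p = b^2/16, the squares s/3 + e, s/3, s/3 - e with e^2 = (s/3)^2 - 3p/s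
   have sum s and product p. *)
Lemma parameters_exist b c : 0 < c -> 0 <= b -> 27 * b ^ 2 < 2 * c ^ 3 ->
  exists z1 z2 z3, 0 <= z3 /\ z3 < z2 /\ z2 < z1 /\ b = b_of z1 z2 z3 /\ c = c_of z1 z2 z3.
Proof.
  intros Hc Hb H. set (s := c / 2). set (p := b ^ 2 / 16).
  assert (Hs : 0 < s) by (unfold s; lra).
  assert (Hp : 0 <= p) by (unfold p; generalize (pow2_ge_0 b); lra).
  assert (Hps : 27 * p < s ^ 3) by (unfold p, s; lra).
  set (e2 := (s / 3) ^ 2 - 3 * p / s).
  assert (Q : 0 <= 3 * p / s) by (apply Rmult_le_pos; [lra|left; now apply Rinv_0_lt_compat]).
  assert (He2 : 0 < e2).
  { unfold e2. apply Rmult_lt_reg_r with s; auto. rewrite Rmult_0_l.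
    replace (((s / 3) ^ 2 - 3 * p / s) * s) with (s ^ 3 / 9 - 3 * p) by (field; lra). lra. }
  set (e := sqrt e2). assert (He : 0 < e) by now apply sqrt_lt_R0.
  assert (Ee : e * e = e2) by (apply sqrt_sqrt; lra).
  assert (Hes : e <= s / 3) by (unfold e2 in Ee; nra).
  exists (sqrt (s / 3 + e)), (sqrt (s / 3)), (sqrt (s / 3 - e)).
  split; [apply sqrt_pos|]. split; [apply sqrt_lt_1_alt; lra|]. split; [apply sqrt_lt_1_alt; lra|].
  assert (X1 := pow2_sqrt (s / 3 + e) ltac:(lra)). assert (X2 := pow2_sqrt (s / 3) ltac:(lra)).
  assert (X3 := pow2_sqrt (s / 3 - e) ltac:(lra)).
  split.
  - unfold b_of.
    assert (E : b ^ 2 = (4 * sqrt (s / 3 + e) * sqrt (s / 3) * sqrt (s / 3 - e)) ^ 2).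
    { replace ((4 * sqrt (s / 3 + e) * sqrt (s / 3) * sqrt (s / 3 - e)) ^ 2) with
       (16 * (sqrt (s / 3 + e) ^ 2 * sqrt (s / 3) ^ 2 * sqrt (s / 3 - e) ^ 2)) by ring.
      rewrite X1, X2, X3. replace ((s / 3 + e) * (s / 3) * (s / 3 - e)) with (((s / 3) ^ 2 - e * e) * (s / 3)) by ring.
      rewrite Ee. unfold e2. replace (((s / 3) ^ 2 - ((s / 3) ^ 2 - 3 * p / s)) * (s / 3)) with p by (field; lra).
      unfold p. field. }
    assert (0 <= 4 * sqrt (s / 3 + e) * sqrt (s / 3) * sqrt (s / 3 - e)).
    { repeat apply Rmult_le_pos; try apply sqrt_pos; lra. }
    rewrite <- (sqrt_pow2 b Hb), E, sqrt_pow2; auto.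
  - unfold c_of. rewrite X1, X2, X3. unfold s. field.
Qed.

(** * The profile as a Moebius function of sn^2 *)

(** The Moebius map that sends X = 0, 1, 1/k^2, infinity to the roots z2 + z3 - z1, z1 + z3 - z2, z1
    + z2 - z3, - (z1 + z2 + z3) of the quartic. Its zero is sn^2(beta) and its pole 1 / (k^2
    sn^2(alpha)), which is where alpha and beta come from. *)
Definition moebius (z1 z2 z3 X : R) : R :=
  ((z1 - z2) * (z1 + z2 + z3) * X - (z1 + z3) * (z1 - z2 - z3)) / (z1 + z3 - (z1 - z2) * X).

Lemma moebius_den_pos z1 z2 z3 X : 0 <= z3 -> z3 < z2 -> z2 < z1 -> X <= 1 ->
  0 < z1 + z3 - (z1 - z2) * X.
Proof. intros. nra. Qed.

(** Only the algebraic and differential relations of sn, cn, dn enter, so the verification is an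
    identity of rational functions in s^2. *)
Lemma moebius_traj (z1 z2 z3 nu k : R) (s c d : R -> R) :
  0 <= z3 -> z3 < z2 -> z2 < z1 -> nu ^ 2 = z1 ^ 2 - z3 ^ 2 -> k ^ 2 * nu ^ 2 = z1 ^ 2 - z2 ^ 2 ->
  (forall x, is_derive s x (nu * (c x * d x))) ->
  (forall x, is_derive c x (- nu * (s x * d x))) ->
  (forall x, is_derive d x (- nu * k ^ 2 * (s x * c x))) ->
  (forall x, c x ^ 2 = 1 - s x ^ 2) -> (forall x, d x ^ 2 = 1 - k ^ 2 * s x ^ 2) ->
  exists f1, traj (b_of z1 z2 z3) (c_of z1 z2 z3) (fun x => moebius z1 z2 z3 (s x ^ 2)) f1 /\
    (forall x, s x = 0 -> f1 x = 0) /\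
    (forall x, f1 x ^ 2 = moebius z1 z2 z3 (s x ^ 2) ^ 4 - c_of z1 z2 z3 * moebius z1 z2 z3 (s x ^ 2) ^ 2
       + 2 * b_of z1 z2 z3 * moebius z1 z2 z3 (s x ^ 2) + 2 * d_of z1 z2 z3).
Proof.
  intros H3 H2 H1 Hnu Hk Ds Dc Dd Ec Ed.
  (* The determinant of the Moebius map: its derivative is E divided by the square of the
     denominator. *)
  set (E := 2 * (z1 - z2) * (z1 + z3) * (z2 + z3)).
  assert (P : forall x, 0 < z1 + z3 - (z1 - z2) * s x ^ 2).
  { intros x. apply moebius_den_pos; auto. generalize (Ec x) (pow2_ge_0 (c x)); lra. }
  assert (Xs : forall x, ex_derive s x) by (intros x; exists (nu * (c x * d x)); exact (Ds x)).
  assert (Xc : forall x, ex_derive c x) by (intros x; exists (- nu * (s x * d x)); exact (Dc x)).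
  assert (Xd : forall x, ex_derive d x) by (intros x; exists (- nu * k ^ 2 * (s x * c x)); exact (Dd x)).
  exists (fun x => 2 * E * nu * (s x * c x * d x) / (z1 + z3 - (z1 - z2) * s x ^ 2) ^ 2).
  split; [|split].
  - intros x. specialize (P x). unfold moebius. split.
    + auto_derive.
      * repeat split; try exact (Xs x). apply Rgt_not_eq. simpl in P. lra.
      * change (fun x => s x) with s. rewrite (is_derive_unique _ _ _ (Ds x)).
        unfold E. simpl in P. field. lra.
    + auto_derive.
      * repeat split; try first [exact (Xs x)|exact (Xc x)|exact (Xd x)].
        simpl in P. apply Rgt_not_eq. apply Rmult_lt_0_compat; lra.
      * change (fun x => s x) with s. change (fun x => c x) with c. change (fun x => d x) with d.
        rewrite (is_derive_unique _ _ _ (Ds x)), (is_derive_unique _ _ _ (Dc x)), (is_derive_unique _ _ _ (Dd x)).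
        set (M := z1 + z3 - (z1 - z2) * s x ^ 2) in *.
        set (X := s x ^ 2) in *.
        replace (z1 + z3 + - ((z1 - z2) * (s x * (s x * 1)))) with M by (unfold M, X; ring).
        transitivity (2 * E * ((nu ^ 2 * c x ^ 2 * d x ^ 2 - nu ^ 2 * X * d x ^ 2 - (k ^ 2 * nu ^ 2) * X * c x ^ 2) / M ^ 2
           + 4 * (z1 - z2) * X * nu ^ 2 * (c x ^ 2 * d x ^ 2) / M ^ 3)).
        { unfold X. field. lra. }
        (* [nu] and [k] occur only in nu^2 dn^2 and k^2 nu^2, which are polynomials in the
           parameters and X; once they are replaced, the equation is rational in X. *)
        replace (nu ^ 2 * c x ^ 2 * d x ^ 2) with (c x ^ 2 * (nu ^ 2 * d x ^ 2)) by ring.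
        replace (nu ^ 2 * X * d x ^ 2) with (X * (nu ^ 2 * d x ^ 2)) by ring.
        replace (4 * (z1 - z2) * X * nu ^ 2 * (c x ^ 2 * d x ^ 2)) with (4 * (z1 - z2) * X * c x ^ 2 * (nu ^ 2 * d x ^ 2)) by ring.
        replace (nu ^ 2 * d x ^ 2) with ((z1 ^ 2 - z3 ^ 2) - (z1 ^ 2 - z2 ^ 2) * X) by (rewrite Ed, <- Hnu, <- Hk; unfold X; ring).
        rewrite Hk, Ec. fold X. unfold E, M, b_of, c_of. field. exact (Rgt_not_eq _ _ P).
  - intros x Hx. rewrite Hx. unfold Rdiv. ring.
  - intros x. specialize (P x). unfold moebius.
    set (M := z1 + z3 - (z1 - z2) * s x ^ 2) in *. set (X := s x ^ 2) in *.
    transitivity (4 * E ^ 2 * (X * c x ^ 2 * (nu ^ 2 * d x ^ 2)) / M ^ 4).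
    { unfold X. field. lra. }
    replace (nu ^ 2 * d x ^ 2) with ((z1 ^ 2 - z3 ^ 2) - (z1 ^ 2 - z2 ^ 2) * X) by (rewrite Ed, <- Hnu, <- Hk; unfold X; ring).
    rewrite Ec. fold X. unfold E, M, b_of, c_of, d_of. field. exact (Rgt_not_eq _ _ P).
Qed.

Lemma modulus_bounds z1 z2 z3 : 0 <= z3 -> z3 < z2 -> z2 < z1 ->
  0 < nu_of z1 z2 z3 /\ nu_of z1 z2 z3 ^ 2 = z1 ^ 2 - z3 ^ 2 /\ 0 < k_of z1 z2 z3 < 1 /\
  k_of z1 z2 z3 ^ 2 = (z1 ^ 2 - z2 ^ 2) / (z1 ^ 2 - z3 ^ 2).
Proof.
  intros H3 H2 H1. assert (P : 0 < z1 ^ 2 - z3 ^ 2) by nra. assert (Q : 0 < z1 ^ 2 - z2 ^ 2) by nra.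
  assert (K : 0 < (z1 ^ 2 - z2 ^ 2) / (z1 ^ 2 - z3 ^ 2)) by now apply Rdiv_lt_0_compat.
  unfold nu_of, k_of. repeat split.
  - now apply sqrt_lt_R0.
  - apply pow2_sqrt. lra.
  - now apply sqrt_lt_R0.
  - rewrite <- sqrt_1. apply sqrt_lt_1_alt. split; [lra|].
    apply Rmult_lt_reg_r with (z1 ^ 2 - z3 ^ 2); auto. unfold Rdiv. rewrite Rmult_assoc, Rinv_l by lra. nra.
  - apply pow2_sqrt. lra.
Qed.

Section Profile.
Variables z1 z2 z3 L : R.
Hypotheses (H3 : 0 <= z3) (H2 : z3 < z2) (H1 : z2 < z1).
Hypothesis HL : modulus_of (k_of z1 z2 z3) L.

Let PL : 0 < L. Proof. apply HL. Qed.
Let Plam : 0 < lam L. Proof. exact (lam_pos L PL). Qed.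
Let Pnu : 0 < nu_of z1 z2 z3. Proof. exact (proj1 (modulus_bounds z1 z2 z3 H3 H2 H1)). Qed.

Definition phase (x : R) : R := nu_of z1 z2 z3 * x / lam L.
Definition wave (x : R) : R := moebius z1 z2 z3 (sR L (phase x) ^ 2).

Lemma is_derive_phase (h : R -> R) (x l : R) : is_derive h (phase x) (lam L * l) ->
  is_derive (fun t => h (phase t)) x (nu_of z1 z2 z3 * l).
Proof.
  intros H. assert (D : is_derive phase x (nu_of z1 z2 z3 / lam L)).
  { unfold phase. auto_derive; [exact I|]. field. lra. }
  assert (C := is_derive_comp h phase x _ _ H D).
  replace (nu_of z1 z2 z3 * l) with (nu_of z1 z2 z3 / lam L * (lam L * l)) by (field; lra).
  exact C.
Qed.

Lemma wave_traj : exists f1, traj (b_of z1 z2 z3) (c_of z1 z2 z3) wave f1 /\ f1 0 = 0 /\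
  (forall x, f1 x ^ 2 = wave x ^ 4 - c_of z1 z2 z3 * wave x ^ 2
       + 2 * b_of z1 z2 z3 * wave x + 2 * d_of z1 z2 z3).
Proof.
  destruct (modulus_bounds z1 z2 z3 H3 H2 H1) as [_ [En [_ Ek]]].
  assert (K : kap L = k_of z1 z2 z3) by apply HL.
  destruct (moebius_traj z1 z2 z3 (nu_of z1 z2 z3) (k_of z1 z2 z3)
    (fun x => sR L (phase x)) (fun x => cR L (phase x)) (fun x => dR L (phase x))) as [f1 [T1 [T2 T3]]]; auto.
  - rewrite En, Ek. field. nra.
  - intros x. apply (is_derive_phase (sR L)). now apply jacobi_real.
  - intros x. replace (- nu_of z1 z2 z3 * (sR L (phase x) * dR L (phase x))) with
      (nu_of z1 z2 z3 * - (sR L (phase x) * dR L (phase x))) by ring.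
    apply (is_derive_phase (cR L)).
    replace (lam L * - (sR L (phase x) * dR L (phase x))) with (- lam L * (sR L (phase x) * dR L (phase x))) by ring.
    now apply is_derive_cR.
  - intros x. rewrite <- K. replace (- nu_of z1 z2 z3 * kap L ^ 2 * (sR L (phase x) * cR L (phase x))) with
      (nu_of z1 z2 z3 * - (kap L ^ 2 * (sR L (phase x) * cR L (phase x)))) by ring.
    apply (is_derive_phase (dR L)).
    replace (lam L * - (kap L ^ 2 * (sR L (phase x) * cR L (phase x)))) with
      (- lam L * kap L ^ 2 * (sR L (phase x) * cR L (phase x))) by ring.
    now apply is_derive_dR.
  - intros x. now apply jacobi_real.
  - intros x. rewrite <- K. now apply jacobi_real.
  - exists f1. split; [exact T1|split; [|exact T3]].
    apply T2. unfold phase. replace (nu_of z1 z2 z3 * 0 / lam L) with 0 by (field; lra). now apply sR_0.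
Qed.

Lemma sR_sq_le_1 x : 0 <= sR L x ^ 2 <= 1.
Proof.
  destruct (jacobi_real L x PL) as [E _]. generalize (pow2_ge_0 (sR L x)) (pow2_ge_0 (cR L x)). lra.
Qed.

Lemma wave_bounded : bounded_fun wave.
Proof.
  exists ((Rabs ((z1 - z2) * (z1 + z2 + z3)) + Rabs ((z1 + z3) * (z1 - z2 - z3))) / (z2 + z3)).
  intros x. unfold wave, moebius. assert (B := sR_sq_le_1 (phase x)). set (X := sR L (phase x) ^ 2) in *.
  assert (P : z2 + z3 <= z1 + z3 - (z1 - z2) * X) by nra.
  unfold Rdiv. rewrite Rabs_mult. apply Rmult_le_compat; try apply Rabs_pos.
  - unfold Rminus at 1. eapply Rle_trans; [apply Rabs_triang|]. rewrite Rabs_Ropp.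
    apply Rplus_le_compat_r. rewrite Rabs_mult, (Rabs_pos_eq X) by lra.
    generalize (Rabs_pos ((z1 - z2) * (z1 + z2 + z3))). nra.
  - rewrite Rabs_pos_eq by (left; apply Rinv_0_lt_compat; lra). apply Rinv_le_contravar; lra.
Qed.

Lemma wave_periodic : periodic_fun wave.
Proof.
  (* This is 2 K / nu: [sR] merely changes sign under a shift by pi, so its square has period pi. *)
  exists (lam L * PI / nu_of z1 z2 z3). split.
  - apply Rdiv_lt_0_compat; auto. apply Rmult_lt_0_compat; auto. apply PI_RGT_0.
  - intros x. unfold wave.
    replace (phase (x + lam L * PI / nu_of z1 z2 z3)) with (phase x + PI) by (unfold phase; field; lra).
    rewrite sR_plus_PI by exact PL. f_equal. ring.
Qed.

Lemma wave_0 : wave 0 = z2 + z3 - z1.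
Proof.
  unfold wave, phase, moebius. replace (nu_of z1 z2 z3 * 0 / lam L) with 0 by (field; lra).
  rewrite sR_0 by exact PL. field. lra.
Qed.

Lemma wave_nonconstant : nonconstant_fun wave.
Proof.
  exists 0, (lam L * (PI / 2) / nu_of z1 z2 z3). rewrite wave_0. unfold wave, moebius.
  replace (phase (lam L * (PI / 2) / nu_of z1 z2 z3)) with (PI / 2) by (unfold phase; field; lra).
  rewrite sR_PI2 by exact PL.
  replace (((z1 - z2) * (z1 + z2 + z3) * 1 ^ 2 - (z1 + z3) * (z1 - z2 - z3)) / (z1 + z3 - (z1 - z2) * 1 ^ 2))
    with (z1 + z3 - z2) by (field; lra). lra.
Qed.

Lemma sn_phase x : sn (k_of z1 z2 z3) (RtoC (nu_of z1 z2 z3 * x)) = RtoC (sR L (phase x)).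
Proof. exact (sn_real _ L HL (nu_of z1 z2 z3 * x)). Qed.

Lemma k_sa2 : k_of z1 z2 z3 ^ 2 * sa2 z1 z2 z3 = (z1 - z2) / (z1 + z3).
Proof.
  destruct (modulus_bounds z1 z2 z3 H3 H2 H1) as [_ [_ [_ Ek]]]. rewrite Ek. unfold sa2.
  field. repeat split; nra.
Qed.

Lemma sa2_range : 0 < sa2 z1 z2 z3 < 1.
Proof.
  unfold sa2. split; [apply Rdiv_lt_0_compat; lra|].
  apply Rmult_lt_reg_r with (z1 + z2); [lra|]. unfold Rdiv. rewrite Rmult_assoc, Rinv_l; lra.
Qed.

Lemma C_eq_div (x y e : C) : (x * e = y)%C -> e <> 0%C -> x = (y / e)%C.
Proof. intros H He. rewrite <- H. field. exact He. Qed.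

Lemma th4_sq_ne0 : (th4 L 0 * th4 L 0)%C <> 0%C.
Proof.
  destruct (th_at_0 L PL) as [_ [_ ->]]. rewrite <- RtoC_mult. apply RtoC_ne0.
  generalize (t4_pos L 0 PL). nra.
Qed.

Lemma Theta_pair alpha x : sn (k_of z1 z2 z3) (RtoC alpha) = RtoC (sqrt (sa2 z1 z2 z3)) ->
  let k := k_of z1 z2 z3 in let u := RtoC (nu_of z1 z2 z3 * x) in
  (Theta k (u - RtoC alpha) * Theta k (u + RtoC alpha) =
   Theta k u * Theta k u * (Theta k (RtoC alpha) * Theta k (RtoC alpha)) *
   RtoC (1 - (z1 - z2) / (z1 + z3) * sR L (phase x) ^ 2) / (th4 L 0 * th4 L 0))%C.
Proof.
  intros Ha k u. apply C_eq_div; [|exact th4_sq_ne0].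
  unfold u, k. rewrite (Theta_product_real _ L HL), Ha, sn_phase, <- k_sa2. f_equal.
  rewrite <- !RtoC_mult, <- RtoC_minus, sqrt_sqrt by (generalize sa2_range; lra).
  f_equal. ring.
Qed.

Lemma den_pos x : 0 < 1 - (z1 - z2) / (z1 + z3) * sR L (phase x) ^ 2.
Proof.
  assert (B := sR_sq_le_1 (phase x)).
  apply Rmult_lt_reg_r with (z1 + z3); [lra|]. rewrite Rmult_0_l.
  replace ((1 - (z1 - z2) / (z1 + z3) * sR L (phase x) ^ 2) * (z1 + z3)) with
    (z1 + z3 - (z1 - z2) * sR L (phase x) ^ 2) by (field; lra).
  apply moebius_den_pos; lra.
Qed.

(** All values of [Theta], the modulus and theta_4(0) cancel from the quotient. z1 <> z2 + z3 gives
    sn(beta) <> 0, hence a nonzero [Hth] at beta. *)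
Lemma profile1_wave alpha beta x :
  z1 <> z2 + z3 ->
  sn (k_of z1 z2 z3) (RtoC alpha) = RtoC (sqrt (sa2 z1 z2 z3)) ->
  (sn (k_of z1 z2 z3) beta * sn (k_of z1 z2 z3) beta)%C = RtoC (sb2 z1 z2 z3) ->
  profile1 z1 z2 z3 alpha beta x = RtoC (wave x).
Proof.
  intros Hne Ha Hb. unfold profile1. rewrite (Theta_pair alpha x Ha).
  set (k := k_of z1 z2 z3) in *. set (u := RtoC (nu_of z1 z2 z3 * x)).
  assert (Hd : z1 - z2 - z3 <> 0) by lra.
  assert (Hs : sb2 z1 z2 z3 <> 0).
  { unfold sb2. apply Rmult_integral_contrapositive_currified.
    - apply Rmult_integral_contrapositive_currified; lra.
    - apply Rinv_neq_0_compat, Rmult_integral_contrapositive_currified; lra. }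
  assert (Hsn : sn k beta <> 0%C).
  { intros E. rewrite E in Hb. apply Hs. apply RtoC_fst. rewrite <- Hb. ring. }
  assert (Nb := sn_ne0_Theta k beta Hsn).
  assert (Nu : Theta k u <> 0%C) by exact (Theta_real_ne0 k L HL _).
  assert (Na : Theta k (RtoC alpha) <> 0%C) by exact (Theta_real_ne0 k L HL _).
  assert (Ne := th4_sq_ne0).
  rewrite (C_eq_div _ _ _ (Hth_product k L HL u beta Nu Nb) Ne), (Hth_sn k L HL beta Nb), Hb.
  assert (Su : sn k u = RtoC (sR L (phase x))) by apply sn_phase. rewrite Su.
  assert (P := den_pos x).
  assert (Nk : RtoC k <> 0%C).
  { apply RtoC_ne0. unfold k. generalize (proj1 (proj1 (proj2 (proj2 (modulus_bounds z1 z2 z3 H3 H2 H1))))). lra. }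
  assert (NP := RtoC_ne0 _ (Rgt_not_eq _ _ P)). assert (NS := RtoC_ne0 _ Hs).
  set (e := (th4 L 0 * th4 L 0)%C) in *. set (q := RtoC (1 - _)) in *.
  transitivity (RtoC (z1 - z2 - z3) * (RtoC (sR L (phase x)) * RtoC (sR L (phase x)) - RtoC (sb2 z1 z2 z3)) / (q * RtoC (sb2 z1 z2 z3)))%C.
  - field. repeat split; auto.
  - unfold q. rewrite <- !RtoC_mult, <- RtoC_minus, <- RtoC_mult, <- RtoC_div.
    + f_equal. unfold wave, moebius, sb2.
      assert (P' := moebius_den_pos z1 z2 z3 (sR L (phase x) ^ 2) H3 H2 H1 (proj2 (sR_sq_le_1 _))).
      field. repeat split; try lra.
    + apply Rmult_integral_contrapositive_currified; lra.
Qed.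

(** The degenerate case in which the zero of the Moebius map moves to X = 0, so that its numerator
    becomes a multiple of sn^2. *)
Lemma profile2_wave alpha x :
  z1 = z2 + z3 -> 0 < z3 ->
  sn (k_of z1 z2 z3) (RtoC alpha) = RtoC (sqrt (sa2 z1 z2 z3)) ->
  profile2 z1 z2 z3 alpha x = RtoC (wave x).
Proof.
  intros Heq Hz3 Ha. unfold profile2. rewrite (Theta_pair alpha x Ha).
  set (k := k_of z1 z2 z3) in *. set (u := RtoC (nu_of z1 z2 z3 * x)).
  assert (Nu : Theta k u <> 0%C) by exact (Theta_real_ne0 k L HL _).
  assert (Na : Theta k (RtoC alpha) <> 0%C) by exact (Theta_real_ne0 k L HL _).
  assert (Ne := th4_sq_ne0).
  rewrite (Theta_th4 k L HL (RtoC 0)), sc_0.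
  assert (Su : sn k u = RtoC (sR L (phase x))) by apply sn_phase. rewrite Su.
  assert (P := den_pos x). assert (NP := RtoC_ne0 _ (Rgt_not_eq _ _ P)).
  assert (NZ : RtoC (z2 + 2 * z3) <> 0%C) by (apply RtoC_ne0; lra).
  assert (Ne' : th4 L 0 <> 0%C) by (intros E; apply Ne; rewrite E; ring).
  set (q := RtoC (1 - _)) in *.
  transitivity (RtoC (2 * (z2 + z3) * z3) * (RtoC (sR L (phase x)) * RtoC (sR L (phase x))) / (RtoC (z2 + 2 * z3) * q))%C.
  - field. repeat split; auto.
  - unfold q. rewrite <- !RtoC_mult, <- RtoC_div.
    + f_equal. unfold wave, moebius.
      assert (P' := moebius_den_pos z1 z2 z3 (sR L (phase x) ^ 2) H3 H2 H1 (proj2 (sR_sq_le_1 _))).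
      rewrite Heq in *. field. repeat split; lra.
    + apply Rmult_integral_contrapositive_currified; lra.
Qed.
End Profile.

(** * The arguments alpha and beta *)

Lemma sb2_below_1 z1 z2 z3 : 0 < z3 -> z3 < z2 -> z2 < z1 -> sb2 z1 z2 z3 < 1.
Proof.
  intros H3 H2 H1. unfold sb2. assert (P : 0 < (z1 - z2) * (z1 + z2 + z3)) by (apply Rmult_lt_0_compat; lra).
  apply Rmult_lt_reg_r with ((z1 - z2) * (z1 + z2 + z3)); auto.
  unfold Rdiv. rewrite Rmult_assoc, Rinv_l, Rmult_1_r, Rmult_1_l by lra.
  (* This product is the denominator of [sb2] minus its numerator. *)
  assert (0 < (z1 + z3 - z2) * (z2 + z3)) by (apply Rmult_lt_0_compat; lra). lra.
Qed.

Lemma sb2_sign z1 z2 z3 : 0 < z3 -> z3 < z2 -> z2 < z1 ->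
  (z2 + z3 < z1 -> 0 < sb2 z1 z2 z3) /\ (z1 < z2 + z3 -> sb2 z1 z2 z3 < 0).
Proof.
  intros H3 H2 H1. unfold sb2.
  assert (P : 0 < / ((z1 - z2) * (z1 + z2 + z3))) by (apply Rinv_0_lt_compat, Rmult_lt_0_compat; lra).
  split; intros H.
  - apply Rmult_lt_0_compat; auto. apply Rmult_lt_0_compat; lra.
  - assert (0 < (z1 + z3) * (z2 + z3 - z1) * / ((z1 - z2) * (z1 + z2 + z3))).
    { apply Rmult_lt_0_compat; auto. apply Rmult_lt_0_compat; lra. }
    unfold Rdiv. lra.
Qed.

Lemma alpha_unique z1 z2 z3 L : 0 < z3 -> z3 < z2 -> z2 < z1 -> modulus_of (k_of z1 z2 z3) L ->
  exists! alpha, alpha_ok z1 z2 z3 alpha.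
Proof.
  intros H3 H2 H1 HL. assert (R := sa2_range z1 z2 z3 ltac:(lra) H2 H1).
  apply (sn_real_bijective _ L HL). split; [apply sqrt_lt_R0; lra|].
  rewrite <- sqrt_1. apply sqrt_lt_1_alt. lra.
Qed.

Lemma beta_unique z1 z2 z3 L : 0 < z3 -> z3 < z2 -> z2 < z1 -> modulus_of (k_of z1 z2 z3) L ->
  z1 <> z2 + z3 -> exists! beta, beta_ok z1 z2 z3 beta.
Proof.
  intros H3 H2 H1 HL Hne. destruct (sb2_sign z1 z2 z3 H3 H2 H1) as [S1 S2].
  destruct (Rtotal_order z1 (z2 + z3)) as [H|[H|H]]; [| contradiction |].
  - destruct (sn_imag_bijective _ L HL (sqrt (- sb2 z1 z2 z3))) as [t [[Ht Et] U]].
    { apply sqrt_lt_R0. specialize (S2 H). lra. }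
    exists (0, t). split.
    + split; [intros; lra|]. intros _. exists t. auto.
    + intros beta [_ B]. destruct (B H) as [t' [-> [Ht' Et']]]. f_equal. apply U. auto.
  - destruct (sn_real_bijective _ L HL (sqrt (sb2 z1 z2 z3))) as [t [[Ht Et] U]].
    { specialize (S1 H). split; [now apply sqrt_lt_R0|].
      rewrite <- sqrt_1. apply sqrt_lt_1_alt. generalize (sb2_below_1 z1 z2 z3 H3 H2 H1). lra. }
    exists (RtoC t). split.
    + split; [|intros; lra]. intros _. exists t. auto.
    + intros beta [B _]. destruct (B H) as [t' [-> [Ht' Et']]].
      change (RtoC t = RtoC t'). f_equal. apply U. auto.
Qed.

Lemma beta_sq z1 z2 z3 beta : 0 < z3 -> z3 < z2 -> z2 < z1 -> z1 <> z2 + z3 -> beta_ok z1 z2 z3 beta ->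
  (sn (k_of z1 z2 z3) beta * sn (k_of z1 z2 z3) beta)%C = RtoC (sb2 z1 z2 z3).
Proof.
  intros H3 H2 H1 Hne [B1 B2]. destruct (sb2_sign z1 z2 z3 H3 H2 H1) as [S1 S2].
  destruct (Rtotal_order z1 (z2 + z3)) as [H|[H|H]]; [| contradiction |].
  - destruct (B2 H) as [t [_ [_ ->]]]. rewrite imag_mult, sqrt_sqrt by (specialize (S2 H); lra).
    f_equal. ring.
  - destruct (B1 H) as [t [_ [_ ->]]]. rewrite <- RtoC_mult, sqrt_sqrt by (specialize (S1 H); lra).
    reflexivity.
Qed.

(** * Existence of periodic solutions and the classification *)

Lemma modulus_exists z1 z2 z3 : 0 <= z3 -> z3 < z2 -> z2 < z1 -> exists L, modulus_of (k_of z1 z2 z3) L.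
Proof.
  intros H3 H2 H1. apply theta_modulus. apply (modulus_bounds z1 z2 z3 H3 H2 H1).
Qed.

Lemma wave_solution z1 z2 z3 : 0 <= z3 -> z3 < z2 -> z2 < z1 ->
  exists phi, ode_solution (b_of z1 z2 z3) (c_of z1 z2 z3) phi /\
    bounded_fun phi /\ periodic_fun phi /\ nonconstant_fun phi /\
    invariant (b_of z1 z2 z3) (c_of z1 z2 z3) (d_of z1 z2 z3) phi.
Proof.
  intros H3 H2 H1. destruct (modulus_exists z1 z2 z3 H3 H2 H1) as [L HL].
  destruct (wave_traj z1 z2 z3 L H3 H2 H1 HL) as [f1 [T [_ I]]].
  exists (wave z1 z2 z3 L). split; [now apply ode_of_traj with f1|].
  split; [now apply wave_bounded|]. split; [now apply wave_periodic|]. split; [now apply wave_nonconstant|].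
  intros x. rewrite <- I. f_equal. apply is_derive_unique, T.
Qed.

Lemma ode_solution_opp b c phi : ode_solution b c phi -> ode_solution (- b) c (fun x => - phi x).
Proof.
  intros H. assert (T := traj_of_ode _ _ _ H). apply ode_of_traj with (fun x => - Derive phi x).
  intros x. destruct (T x) as [T1 T2]. split.
  - exact (is_derive_opp _ _ _ T1).
  - replace (2 * (- phi x) ^ 3 - c * - phi x + - b) with (- (2 * phi x ^ 3 - c * phi x + b)) by ring.
    exact (is_derive_opp _ _ _ T2).
Qed.

(** Parameters with z3 >= 0 cover b >= 0, the value b = 0 being z3 = 0; negative [b] is reached by
    the symmetry (phi, b) -> (- phi, - b). *)
Lemma periodic_solution_exists b c : 0 < c -> - b_crit c < b < b_crit c ->
  exists phi, ode_solution b c phi /\ bounded_fun phi /\ periodic_fun phi /\ nonconstant_fun phi.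
Proof.
  intros Hc Hb. apply b_crit_iff in Hb; auto.
  assert (P : forall b, 0 <= b -> 27 * b ^ 2 < 2 * c ^ 3 ->
    exists phi, ode_solution b c phi /\ bounded_fun phi /\ periodic_fun phi /\ nonconstant_fun phi).
  { intros b' Hb0 Hb'. destruct (parameters_exist b' c Hc Hb0 Hb') as [z1 [z2 [z3 [H3 [H2 [H1 [-> ->]]]]]]].
    destruct (wave_solution z1 z2 z3 H3 H2 H1) as [phi [Q1 [Q2 [Q3 [Q4 _]]]]]. exists phi. auto. }
  destruct (Rle_lt_dec 0 b) as [H|H]; [now apply P|].
  destruct (P (- b)) as [phi [Q1 [[M Q2] [Q3 [x [y Q4]]]]]]; [lra|replace ((- b) ^ 2) with (b ^ 2) by ring; exact Hb|].
  exists (fun x => - phi x). split; [|split; [|split]].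
  - rewrite <- (Ropp_involutive b). now apply ode_solution_opp.
  - exists M. intros t. rewrite Rabs_Ropp. apply Q2.
  - now apply periodic_opp.
  - exists x, y. lra.
Qed.

Theorem theorem1 :
  (* the first-order invariant *)
  (forall b c phi, ode_solution b c phi -> exists d, invariant b c d phi) /\
  (* existence of bounded_fun periodic_fun nonconstant_fun solutions iff (b,c) in Omega *)
  (forall b c,
     (exists phi, ode_solution b c phi /\ bounded_fun phi /\ periodic_fun phi /\ nonconstant_fun phi)
     <-> (0 < c /\ - b_crit c < b < b_crit c)) /\
  (* each such solution with b in (0,b_c) has a unique parameter (z1,z2,z3) *)
  (forall b c d phi,
     0 < c -> 0 < b < b_crit c ->
     ode_solution b c phi -> bounded_fun phi -> periodic_fun phi -> nonconstant_fun phi ->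
     invariant b c d phi ->
     exists! z : R * R * R,
       let '(z1, z2, z3) := z in
       0 < z3 < z2 /\ z2 < z1 /\
       b = b_of z1 z2 z3 /\ c = c_of z1 z2 z3 /\ d = d_of z1 z2 z3) /\
  (* every admissible parameter arises from such a solution *)
  (forall z1 z2 z3, 0 < z3 < z2 -> z2 < z1 ->
     0 < c_of z1 z2 z3 /\ 0 < b_of z1 z2 z3 < b_crit (c_of z1 z2 z3) /\
     exists phi, ode_solution (b_of z1 z2 z3) (c_of z1 z2 z3) phi /\
       bounded_fun phi /\ periodic_fun phi /\ nonconstant_fun phi /\
       invariant (b_of z1 z2 z3) (c_of z1 z2 z3) (d_of z1 z2 z3) phi) /\
  (* explicit profiles *)
  (forall z1 z2 z3 phi, 0 < z3 < z2 -> z2 < z1 ->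
     ode_solution (b_of z1 z2 z3) (c_of z1 z2 z3) phi ->
     bounded_fun phi -> periodic_fun phi -> nonconstant_fun phi ->
     invariant (b_of z1 z2 z3) (c_of z1 z2 z3) (d_of z1 z2 z3) phi ->
     0 < nu_of z1 z2 z3 /\ 0 < k_of z1 z2 z3 < 1 /\
     (exists! alpha, alpha_ok z1 z2 z3 alpha) /\
     (z1 <> z2 + z3 -> exists! beta, beta_ok z1 z2 z3 beta) /\
     (forall alpha, alpha_ok z1 z2 z3 alpha ->
        (forall beta, z1 <> z2 + z3 -> beta_ok z1 z2 z3 beta ->
           exists x0, forall x, RtoC (phi (x + x0)) = profile1 z1 z2 z3 alpha beta x) /\
        (z1 = z2 + z3 ->
           exists x0, forall x, RtoC (phi (x + x0)) = profile2 z1 z2 z3 alpha x))).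
Proof.
  assert (Inv : forall b c phi, ode_solution b c phi -> exists d, invariant b c d phi).
  { intros b c phi H. assert (T := traj_invariant _ _ _ _ (traj_of_ode _ _ _ H)).
    exists ((Derive phi 0 ^ 2 - phi 0 ^ 4 + c * phi 0 ^ 2 - 2 * b * phi 0) / 2).
    intros x. specialize (T x). lra. }
  (* [periodic_parameters] yields only - z2 < z3 < z2; the sign of [b] is that of [z3]. *)
  assert (Pos : forall z1 z2 z3, z2 < z1 -> z3 < z2 -> 0 < z2 + z3 -> 0 < b_of z1 z2 z3 -> 0 < z3).
  { intros z1 z2 z3 H1 H2 H3 Hb. unfold b_of in Hb.
    assert (0 < 4 * z1 * z2) by (apply Rmult_lt_0_compat; lra).
    apply Rmult_lt_reg_l with (4 * z1 * z2); auto. lra. }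
  split; [exact Inv|]. split; [|split; [|split]].
  - intros b c. split.
    + intros [phi [Ho [Hb [Hp Hn]]]]. destruct (Inv _ _ _ Ho) as [d Hd].
      destruct (periodic_parameters b c d phi Ho Hb Hp Hn Hd) as [z1 [z2 [z3 [xm [H1 [H2 [H3 [-> [-> _]]]]]]]]].
      destruct (parameters_below_crit z1 z2 z3 H1 H2 H3) as [Q1 Q2].
      split; auto. now apply b_crit_iff.
    + intros [Hc Hb]. now apply periodic_solution_exists.
  - intros b c d phi Hc Hb0 Ho Hb Hp Hn Hd.
    destruct (periodic_parameters b c d phi Ho Hb Hp Hn Hd) as [z1 [z2 [z3 [xm [H1 [H2 [H3 [Eb [Ec [Ed _]]]]]]]]]].
    assert (H0 : 0 < z3) by (apply (Pos z1 z2 z3); auto; lra).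
    exists (z1, z2, z3). split; [repeat split; auto|].
    intros [[w1 w2] w3] [[W3 W2] [W1 [Fb [Fc Fd]]]].
    destruct (parameters_unique z1 z2 z3 w1 w2 w3) as [-> [-> ->]]; auto; congruence.
  - intros z1 z2 z3 [H3 H2] H1.
    destruct (parameters_below_crit z1 z2 z3 H1 H2 ltac:(lra)) as [Q1 Q2].
    split; auto. apply b_crit_iff in Q2; auto. split.
    + split; [|lra]. unfold b_of. repeat apply Rmult_lt_0_compat; lra.
    + apply wave_solution; lra.
  - intros z1 z2 z3 phi [H3 H2] H1 Ho Hb Hp Hn Hd.
    assert (H3' : 0 <= z3) by lra.
    destruct (modulus_exists z1 z2 z3 H3' H2 H1) as [L HL].
    destruct (modulus_bounds z1 z2 z3 H3' H2 H1) as [Pnu [_ [Pk _]]].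
    split; auto. split; auto. split; [now apply alpha_unique with L|].
    split; [now apply beta_unique with L|].
    destruct (periodic_parameters _ _ _ phi Ho Hb Hp Hn Hd) as [w1 [w2 [w3 [xm [W1 [W2 [W3 [Eb [Ec [Ed [Em Dm]]]]]]]]]]].
    assert (B0 : 0 < b_of w1 w2 w3).
    { rewrite <- Eb. unfold b_of. repeat apply Rmult_lt_0_compat; lra. }
    assert (W0 := Pos w1 w2 w3 W1 W2 W3 B0).
    destruct (parameters_unique z1 z2 z3 w1 w2 w3) as [<- [<- <-]]; auto.
    destruct (wave_traj z1 z2 z3 L H3' H2 H1 HL) as [f1 [T [F0 _]]].
    (* Translated to its minimum [xm], the solution has the same initial data as [wave]: the value
       z2 + z3 - z1 and slope 0. *)
    assert (K : forall x, phi (x + xm) = wave z1 z2 z3 L x).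
    { apply (traj_unique (b_of z1 z2 z3) (c_of z1 z2 z3) (fun x => phi (x + xm)) (fun x => Derive phi (x + xm)) _ f1); auto.
      - apply traj_shift. now apply traj_of_ode.
      - destruct Hb as [M HM]. exists M. intros; apply HM.
      - now apply wave_bounded.
      - rewrite Rplus_0_l, Em. symmetry. now apply wave_0.
      - rewrite Rplus_0_l, Dm. now symmetry. }
    intros alpha [_ Ha]. split.
    + intros beta Hne Hbeta. exists xm. intros x. rewrite K. symmetry.
      apply profile1_wave; auto. now apply beta_sq.
    + intros Heq. exists xm. intros x. rewrite K. symmetry. now apply profile2_wave.
Qed.
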